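(* Let $w$ be a weight function on $[0,\infty)$, let $A:=L_0^\infty(w)^*$ be equipped with the first Arens product, let $\theta:A\to A$ be a homomorphism and let $D:A\to A$ be a $\theta$-derivation. Then: (i) $D(\mathrm{ran}(A))\subseteq \mathrm{ran}(A)$ and $D(\Lambda(A))\subseteq \mathrm{ran}(A)$. (ii) If $\theta$ is an isomorphism of $A$ onto itself, then $D(A)\subseteq \mathrm{ran}(A)$.
   Context: A weight function is a continuous function $w:[0,\infty)\to[1,\infty)$ with $w(0)=1$ and $w(x+y)\le w(x)w(y)$ for all $x,y\ge 0$. $L^1(w)$ is the Banach space of (classes of) complex Lebesgue measurable functions $\varphi$ on $[0,\infty)$ with $\|\varphi\|_w=\int_0^\infty w(x)|\varphi(x)|\,dx<\infty$. $L_0^\infty(w)$ is the Banach space of (classes of) complex Lebesgue measurable functions $f$ on $[0,\infty)$ such that $f/w$ is essentially bounded and $\lim_{x\to\infty}\operatorname{ess\,sup}_{y>x}|f(y)|/w(y)=0$, with norm $\operatorname{ess\,sup}|f|/w$. For $f\in L_0^\infty(w)$ and $\varphi\in L^1(w)$ let $(f\varphi)(x)=\int_0^\infty f(x+y)\varphi(y)\,dy$ for $x\ge 0$, which defines an element of $L_0^\infty(w)$. For $n\in L_0^\infty(w)^*$ and $f\in L_0^\infty(w)$, $nf\in L_0^\infty(w)$ is the element determined by $\int_0^\infty (nf)(x)\varphi(x)\,dx=\langle n,f\varphi\rangle$ for all $\varphi\in L^1(w)$. The dual $A=L_0^\infty(w)^*$ is a Banach algebra under the first Arens product $\langle mn,f\rangle=\langle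 m,nf\rangle$. $\mathrm{ran}(A)=\{r\in A: ar=0\text{ for all }a\in A\}$ is the right annihilator. $\Lambda(A)$ is the set of right identities of $A$ (elements $u$ with $mu=m$ for all $m\in A$) of norm one. A homomorphism is a linear multiplicative map $A\to A$; an isomorphism on $A$ is a bijective homomorphism $A\to A$. Given a homomorphism $\theta$, a $\theta$-derivation on $A$ is a linear map $D:A\to A$ (no continuity assumed) with $D(mn)=D(m)\theta(n)+\theta(m)D(n)$ for all $m,n\in A$. *)

(* Defs.v *)
From HB Require Import structures.
From mathcomp Require Import all_boot all_order all_algebra.
From mathcomp Require Import all_classical all_reals all_analysis.
From mathcomp Require Import measurable_realfun ess_sup_inf generic_quotient ring_quotient.
From mathcomp.real_closed Require Import complex.

Set Implicit Arguments.
Unset Strict Implicit.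
Unset Printing Implicit Defensive.

Import Order.TTheory GRing.Theory Num.Theory.
Import numFieldNormedType.Exports.
Import ComplexField.Normc Quotient.

Local Open Scope classical_set_scope.
Local Open Scope ring_scope.
Local Open Scope complex_scope.

(* Functions on [0, +oo[ are encoded as functions on R whose values at
   negative reals are irrelevant: measurability, integrals, essential suprema
   and almost-everywhere equality are all taken over [0, +oo[. *)

Definition halfline (R : realType) : set R := `[0, +oo[.
Arguments halfline : clear implicits.

Record weight (R : realType) := Weight {
  weight_fun :> R -> R;
  weight_continuous : {within halfline R, continuous weight_fun};
  weight_ge1 : forall x, 0 <= x -> 1 <= weight_fun x;
  weight_at0 : weight_fun 0 = 1;
  weightD : forall x y, 0 <= x -> 0 <= y ->
    weight_fun (x + y) <= weight_fun x * weight_fun y }.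

Section functions.
Context {R : realType}.
Implicit Types (f : R -> R[i]) (w : weight R) (i : interval R).

Definition leb i : set (measurableTypeR R) -> \bar R :=
  mrestr (@lebesgue_measure R) (measurable_itv i).
HB.instance Definition _ i := Measure.on (leb i).

Definition cmeasurable f :=
  measurable_fun (halfline R) (fun x => complex.Re (f x)) /\
  measurable_fun (halfline R) (fun x => complex.Im (f x)).

Definition cintegral f : R[i] :=
  (\int[lebesgue_measure]_(x in halfline R) complex.Re (f x)) +i*
  (\int[lebesgue_measure]_(x in halfline R) complex.Im (f x)).

Definition L1 w f :=
  cmeasurable f /\
  (\int[lebesgue_measure]_(x in halfline R) (w x * normc (f x))%:E < +oo)%E.

Definition ess_sup_on i w f : \bar R :=
  ess_sup (leb i) (fun x => (normc (f x) / w x)%:E).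

(* Every Lebesgue measurable function agrees almost everywhere with a Borel
   one, so Borel representatives give the same classes. *)
Definition L0 w : {pred R -> R[i]} := mem [set f |
  [/\ cmeasurable f, (ess_sup_on `[0%R, +oo[ w f < +oo)%E &
      (ess_sup_on `]x, +oo[ w f @[x --> +oo%R] --> 0)%E]].

End functions.

Section closure.
Context {R : realType} (w : weight R).
Implicit Types (f g : R -> R[i]) (i : interval R).

Lemma lebE i (A : set R) : leb i A = lebesgue_measure (A `&` [set` i]).
Proof. by []. Qed.

Lemma ae_leb i (P : R -> Prop) :
  (forall x, x \in i -> P x) -> \forall x \ae leb i, P x.
Proof.
move=> iP; exists (~` [set` i]); split.
- by apply: measurableC; exact: measurable_itv.
- rewrite lebE setICl; exact: measure0.
- by move=> x /= nPx ix; apply: nPx; exact: iP.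
Qed.

Lemma cmeasurable0 : cmeasurable (0 : R -> R[i]).
Proof. by split; exact: measurable_cst. Qed.

Lemma cmeasurableZD (a : R[i]) f g :
  cmeasurable f -> cmeasurable g -> cmeasurable (a *: f + g).
Proof.
move=> [f1 f2] [g1 g2]; case: a => a b; split.
- rewrite (_ : (fun _ => _) = (fun x =>
    (a * complex.Re (f x) - b * complex.Im (f x)) + complex.Re (g x))); last first.
    by apply/funext => x /=; rewrite !fctE; case: (f x) (g x) => [? ?] [].
  by apply: measurable_funD => //; apply: measurable_funB;
    apply: measurable_funM => //; exact: measurable_cst.
- rewrite (_ : (fun _ => _) = (fun x =>
    (a * complex.Im (f x) + b * complex.Re (f x)) + complex.Im (g x))); last first.
    by apply/funext => x /=; rewrite !fctE; case: (f x) (g x) => [? ?] [].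
  by apply: measurable_funD => //; apply: measurable_funD;
    apply: measurable_funM => //; exact: measurable_cst.
Qed.

Lemma leb_tail_gt0 (x : R) : (0 < leb `]x, +oo[ [set: _])%E.
Proof. by rewrite lebE setTI lebesgue_measure_itv/= ltry addye ?ltry. Qed.

Lemma leb_gt0 : (0 < leb `[0%R, +oo[ [set: R])%E.
Proof. by rewrite lebE setTI lebesgue_measure_itv/= ltry addye ?ltry. Qed.

Lemma ess_sup_on_ge0 i f : (0 < leb i [set: R])%E ->
  {subset i <= `[0, +oo[} -> (0 <= ess_sup_on i w f)%E.
Proof.
move=> i0 si; apply: ess_sup_gee => //; apply: ae_leb => x /si.
rewrite in_itv/= andbT => x0; rewrite lee_fin divr_ge0//; last first.
  exact: le_trans ler01 (weight_ge1 w x0).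
by case: (f x) => a b /=; exact: sqrtr_ge0.
Qed.

Lemma ess_sup_onZD i (a : R[i]) f g : (0 < leb i [set: R])%E ->
  {subset i <= `[0, +oo[} ->
  (ess_sup_on i w (a *: f + g)%R <=
   (normc a)%:E * ess_sup_on i w f + ess_sup_on i w g)%E.
Proof.
move=> i0 si; rewrite -ess_supZl//; last first.
  by case: a => a b /=; exact: sqrtr_ge0.
apply: le_trans (ess_supD _ _ _); apply: le_ess_sup; apply: ae_leb => x /si.
rewrite in_itv/= andbT => x0.
rewrite /cst/= -EFinM -EFinD lee_fin mulrA -mulrDl ler_wpM2r//.
  by rewrite invr_ge0 (le_trans ler01)// weight_ge1.
by rewrite -normcM; exact: le_normcD.
Qed.

Lemma sub_tail (x : R) : 0 <= x -> {subset `]x, +oo[ <= `[0, +oo[}.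
Proof.
by move=> x0 y; rewrite !in_itv/= !andbT => /ltW; exact: le_trans.
Qed.

Lemma ess_sup_on0 i : (0 < leb i [set: R])%E -> ess_sup_on i w 0 = 0%E.
Proof.
move=> i0; apply: ess_sup_ae_cst => //; apply: nearW => x.
by rewrite [(0 : R -> R[i]) x](_ : _ = 0)// normc0 mul0r.
Qed.

Lemma L0_submod_closed : submod_closed (L0 w).
Proof.
split.
  rewrite inE/=; split; first exact: cmeasurable0.
    by rewrite ess_sup_on0// ?leb_gt0.
  under eq_fun do rewrite ess_sup_on0 ?leb_tail_gt0//.
  exact: cvg_cst.
move=> a f g; rewrite !inE/= => -[mf bf lf] [mg bg lg].
have a0 : 0 <= normc a by case: (a) => ? ? /=; exact: sqrtr_ge0.
split; first exact: cmeasurableZD.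
- apply: le_lt_trans (ess_sup_onZD _ _ _ _ _) _ => //; first exact: leb_gt0.
  by rewrite lte_add_pinfty// lte_mul_pinfty// ess_sup_on_ge0// leb_gt0.
- apply: (@squeeze_cvge _ _ _ _ (cst 0%E) _ (fun x => (normc a)%:E *
    ess_sup_on `]x, +oo[ w f + ess_sup_on `]x, +oo[ w g)%E).
  + near=> x; have x0 : 0 <= x by near: x; exact: nbhs_pinfty_ge.
    by rewrite /cst ess_sup_on_ge0 ?ess_sup_onZD ?leb_tail_gt0//; exact: sub_tail.
  + exact: cvg_cst.
  + have lf' : ((normc a)%:E * ess_sup_on `]x, +oo[ w f @[x --> +oo%R] --> 0)%E.
      by rewrite -[X in _ --> X](mule0 (normc a)%:E); exact: cvgeZl.
    by rewrite -[X in _ --> X]adde0; exact: cvgeD.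
Unshelve. all: by end_near. Qed.

End closure.

HB.instance Definition _ (R : realType) (w : weight R) :=
  GRing.isSubmodClosed.Build _ _ (L0 w) (L0_submod_closed w).

Record L0fun (R : realType) (w : weight R) := MkL0fun {
  L0fun_val :> R -> R[i];
  L0fun_valP : L0fun_val \in L0 w }.

Section L0fun_lmod.
Context {R : realType} (w : weight R).

HB.instance Definition _ := [isSub for @L0fun_val R w].
HB.instance Definition _ := [Choice of L0fun w by <:].
HB.instance Definition _ := [SubChoice_isSubLmodule of L0fun w by <:].

Definition ae_null : {pred L0fun w} :=
  mem [set f | \forall x \ae leb `[(0 : R), +oo[, (f : L0fun w) x = 0].

Lemma ae_null_submod_closed : submod_closed ae_null.
Proof.
split; first by apply/mem_set; exact: ae_leb.
move=> a f g /set_mem f0 /set_mem g0; apply/mem_set.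
have F : Filter (almost_everywhere (leb `[(0 : R), +oo[)).
  exact: ae_filter_ringOfSetsType.
have := @filterS2 _ _ F _ _ _ _ f0 g0; apply => x fx gx.
by rewrite -[LHS]/(a * f x + g x) fx gx mulr0 addr0.
Qed.

HB.instance Definition _ :=
  GRing.isSubmodClosed.Build _ _ ae_null ae_null_submod_closed.

End L0fun_lmod.

(* The Banach space L_0^oo(w) of classes modulo almost-everywhere equality. *)
Definition Linf0 (R : realType) (w : weight R) := {quot (@ae_null R w)}.

Section Linf0_lmod.
Context {R : realType} (w : weight R).
Local Open Scope quotient_scope.
Local Notation Q := (Linf0 w).

HB.instance Definition _ := Choice.on Q.
HB.instance Definition _ := GRing.Zmodule.on Q.
HB.instance Definition _ := EqQuotient.on Q.

Definition Linf0_scale (a : R[i]) (x : Q) : Q := \pi_Q (a *: repr x).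

Lemma pi_Linf0_scale a : {morph \pi_Q : f / a *: f >-> Linf0_scale a f}.
Proof.
move=> f; apply/eqP; rewrite /Linf0_scale piE equivE -scalerBr rpredZ//.
by rewrite idealrBE reprK.
Qed.

Lemma Linf0_scaleA a b x :
  Linf0_scale a (Linf0_scale b x) = Linf0_scale (a * b) x.
Proof. by rewrite -[x]reprK -!pi_Linf0_scale reprK scalerA. Qed.

Lemma Linf0_scale1 : left_id 1 Linf0_scale.
Proof. by move=> x; rewrite -[x]reprK -pi_Linf0_scale scale1r. Qed.

Lemma Linf0_scaleDr : right_distributive Linf0_scale +%R.
Proof.
move=> a x y; rewrite -[x]reprK -[y]reprK -!pi_Linf0_scale -!raddfD/=.
by rewrite -pi_Linf0_scale scalerDr.
Qed.

Lemma Linf0_scaleDl x : {morph Linf0_scale^~ x : a b / a + b}.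
Proof.
by move=> a b; rewrite -[x]reprK -!pi_Linf0_scale -!raddfD/= scalerDl.
Qed.

HB.instance Definition _ := GRing.Zmodule_isLmodule.Build R[i] Q
  Linf0_scaleA Linf0_scale1 Linf0_scaleDr Linf0_scaleDl.

Definition Linf0_fun (x : Q) : R -> R[i] := repr x : L0fun w.

End Linf0_lmod.

Coercion Linf0_fun : Linf0 >-> Funclass.

Section dual.
Context {R : realType} (w : weight R).

Definition Linf0_norm (f : Linf0 w) : R := fine (ess_sup_on `[0%R, +oo[ w f).

Definition bounded_functional : {pred Linf0 w -> R[i]} := mem [set n |
  scalar n /\ exists M : R, forall f, normc (n f) <= M * Linf0_norm f].

Lemma bounded_functional_submod_closed : submod_closed bounded_functional.
Proof.
split.
  rewrite inE/=; split=> [a f g|].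
    by rewrite -[LHS]/0 -[RHS]/(a * 0 + 0) mulr0 addr0.
  exists 0 => f; rewrite mul0r.
  by rewrite expr0n/= addr0 sqrtr0.
move=> a m n; rewrite !inE/= => -[lm [M mM]] [ln [N nN]]; split=> [b f g|].
  rewrite -[LHS]/(a * m (b *: f + g) + n (b *: f + g)) lm ln.
  rewrite -[RHS]/(b * (a * m f + n f) + (a * m g + n g)).
  by rewrite !mulrDr !mulrA (mulrC b a) !addrA; congr (_ + _); rewrite addrAC.
have a0 : 0 <= normc a by case: (a) => ? ? /=; exact: sqrtr_ge0.
exists (normc a * M + N) => f; rewrite -[_ f]/(a * m f + n f).
apply: le_trans (le_normcD _ _) _; rewrite mulrDl lerD// normcM -mulrA.
exact: ler_wpM2l.
Qed.

HB.instance Definition _ := GRing.isSubmodClosed.Build _ _ bounded_functional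
  bounded_functional_submod_closed.

Record Linf0_dual := MkDual {
  dual_fun :> Linf0 w -> R[i];
  dual_funP : dual_fun \in bounded_functional }.

HB.instance Definition _ := [isSub for dual_fun].
HB.instance Definition _ := [Choice of Linf0_dual by <:].
HB.instance Definition _ := [SubChoice_isSubLmodule of Linf0_dual by <:].

Definition dual_norm (n : Linf0_dual) : R :=
  sup [set normc (n f) | f in [set f | Linf0_norm f <= 1]].

(* The three operations below are pinned down by a defining property with a
   unique solution; xget picks it. *)

(* f phi, the class of x |-> \int_0^oo f (x + y) phi y dy *)
Definition transl_conv (f : Linf0 w) (phi : R -> R[i]) : Linf0 w :=
  xget 0 [set g : Linf0 w | \forall x \ae leb `[(0 : R), +oo[,
    g x = cintegral (fun y => f (x + y) * phi y)].

(* n f, determined by \int_0^oo (n f) phi = <n, f phi> for all phi in L1 w *)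
Definition dual_act (n : Linf0_dual) (f : Linf0 w) : Linf0 w :=
  xget 0 [set g : Linf0 w | forall phi, L1 w phi ->
    cintegral (fun x => g x * phi x) = n (transl_conv f phi)].

(* first Arens product, <m n, f> = <m, n f> *)
Definition arens (m n : Linf0_dual) : Linf0_dual :=
  xget 0 [set p : Linf0_dual | forall f, p f = m (dual_act n f)].

Definition right_annihilator : set Linf0_dual := [set r | forall a, arens a r = 0].

Definition unit_right_identities : set Linf0_dual :=
  [set u | (forall m, arens m u = m) /\ dual_norm u = 1].

Definition homomorphism (theta : {linear Linf0_dual -> Linf0_dual}) :=
  forall m n, theta (arens m n) = arens (theta m) (theta n).

Definition derivation (theta D : {linear Linf0_dual -> Linf0_dual}) :=
  forall m n, D (arens m n) = arens (D m) (theta n) + arens (theta m) (D n).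

End dual.

(* Main.v *)
(** Every functional e_k : a |-> <a, exp(-(k+1)x)> is a character of A, since
    n f = <n, f> f for exponentials f.  By Weierstrass approximation in the
    variable exp(-x), a functional killed by all the exponentials kills all
    f phi with f of compact support, so ran(A) is the common kernel of these
    characters; in particular mn - nm lies in ran(A).  A right identity u exists
    (an ultrafilter limit of averages at 0).

    (i) If r is in ran(A) then r = r u and u r = 0, so chi(D r) = chi(D(u r)) = 0
    for each character chi; if u u = u, then d = chi(D u) and the idempotent
    t = chi(theta u) satisfy d = 2 d t, hence d = 0.

    (ii) Delta = D o theta^-1 is a derivation of A.  It is bounded: point masses
    shift supports, and a gliding hump along the multiples of s shows that
    a |-> <Delta a, f> is bounded for f supported in [0, s], after which
    Banach-Steinhaus applies.  If chi(a) = 0, then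
    chi(Delta^n(a^n)) = n! chi(Delta a)^n is bounded geometrically, which forces
    chi(Delta a) = 0; the case chi(a) <> 0 follows from a^2 - chi(a) a. *)

Require Import Defs.
From HB Require Import structures.
From mathcomp Require Import all_boot all_order all_algebra.
From mathcomp Require Import all_classical all_reals all_analysis.
From mathcomp Require Import measurable_realfun ess_sup_inf generic_quotient ring_quotient.
From mathcomp Require Import ring lra.
From mathcomp.real_closed Require Import complex.

Set Implicit Arguments.
Unset Strict Implicit.
Unset Printing Implicit Defensive.

Import Order.TTheory GRing.Theory Num.Theory.
Import numFieldNormedType.Exports HBNNSimple.
Import ComplexField.Normc Quotient.

Local Open Scope classical_set_scope.
Local Open Scope ring_scope.
Local Open Scope complex_scope.

Local Notation "'mu' R" := (@lebesgue_measure R) (at level 10, R at level 8).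

(** * Almost everywhere statements and translations *)

(** The product rests on n f, which exists only if phi |-> <n, f phi> on L^1(w) is given by a
    function. So the dual of L^1(w) has to be represented (Radon-Nikodym), with enough localisation
    to see that the representing function is small relative to w at infinity when f is. Real and
    imaginary parts are bounded separately throughout, hence the product is submultiplicative up to
    a factor 4; geometric growth is all that the factorial argument asks for. The obstacle in (ii)
    is that nothing is known about the continuity of Delta. A point mass d at n s helps because in
    Delta (b d) = (Delta b) d + b (Delta d) the second term is bounded in b (Delta d is one fixed
    functional), while the first is steered by d: evaluated at f translated to the right by n s it
    returns (Delta b)(f) when d sits at n s, and 0 when d sits at (n + 1) s. Thus each hump sees its
    own term and is blind to the uncontrolled part of everything added later. *)

Section normc_facts.
Context {R : realType}.
Implicit Types z : R[i].

Lemma normc_ge0 z : 0 <= normc z.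
Proof. by case: z => a b /=; exact: sqrtr_ge0. Qed.

Lemma normc_ge_absRe z : `|complex.Re z| <= normc z.
Proof.
by case: z => a b /=; rewrite -sqrtr_sqr ler_wsqrtr// lerDl sqr_ge0.
Qed.

Lemma normc_ge_absIm z : `|complex.Im z| <= normc z.
Proof.
by case: z => a b /=; rewrite -sqrtr_sqr ler_wsqrtr// lerDr sqr_ge0.
Qed.

Lemma normc_real (x : R) : normc x%:C = `|x|.
Proof. by rewrite /= expr0n addr0 sqrtr_sqr. Qed.

Lemma normc_i (x : R) : normc (x *i) = `|x|.
Proof. by rewrite /= expr0n add0r sqrtr_sqr. Qed.

Lemma complex_split z : z = (complex.Re z)%:C + (complex.Im z) *i.
Proof. by case: z => a b; apply/eqP; rewrite eq_complex/= addr0 add0r !eqxx. Qed.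

Lemma normc_le z : normc z <= `|complex.Re z| + `|complex.Im z|.
Proof.
rewrite {1}(complex_split z); apply: le_trans (le_normcD _ _) _.
by rewrite normc_real normc_i.
Qed.

Lemma normcX z n : normc (z ^+ n) = normc z ^+ n.
Proof. by elim: n => [|n IH]; rewrite ?expr0 ?normc1// !exprS normcM IH. Qed.

Lemma normc_eq0 z : (normc z == 0) = (z == 0).
Proof. by apply/eqP/eqP => [/eq0_normc//|->]; rewrite normc0. Qed.

Lemma normcB z z' : normc z - normc z' <= normc (z + z').
Proof.
by rewrite lerBlDr -(normcN z'); apply: le_trans (le_normcD _ _); rewrite addrK.
Qed.

Lemma complex_ReZD (a : R) z z' :
  complex.Re (a%:C * z + z') = a * complex.Re z + complex.Re z'.
Proof. by case: z z' => ? ? [] ? ? /=; rewrite mul0r subr0. Qed.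

Lemma complex_ImZD (a : R) z z' :
  complex.Im (a%:C * z + z') = a * complex.Im z + complex.Im z'.
Proof. by case: z z' => ? ? [] ? ? /=; rewrite mul0r addr0. Qed.

Lemma normc_natr n : normc (n%:R : R[i]) = n%:R.
Proof. by rewrite -(rmorph_nat (real_complex R)) normc_real ger0_norm. Qed.

End normc_facts.

#[export] Instance ae_lebesgue_filter (R : realType) :
  Filter (nbhs (almost_everywhere (@lebesgue_measure R))).
Proof. exact: (@ae_filter_ringOfSetsType _ (measurableTypeR R)). Qed.

Section halfline_ae.
Context {R : realType}.
Implicit Types (i : interval R) (P Q : R -> Prop).

Lemma ae_lebP i P : (\forall x \ae leb i, P x) <-> \forall x \ae mu R, x \in i -> P x.
Proof.
split=> -[A [mA A0 PA]].
  exists (A `&` [set` i]); split.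
  - by apply: measurableI => //; exact: measurable_itv.
  - by rewrite -lebE.
  - by move=> x /= /not_implyP[xi nP]; split => //; exact: PA.
exists (A `|` ~` [set` i]); split.
- by apply: measurableU => //; apply: measurableC; exact: measurable_itv.
- rewrite lebE setIUl setICl setU0; apply/eqP; rewrite -measure_le0 -A0.
  by apply: le_measure; rewrite ?inE//; apply: measurableI => //; exact: measurable_itv.
- move=> x /= nP; have [xi|xi] := boolP (x \in i); last by right; exact/negP.
  by left; apply: PA => /= /(_ xi).
Qed.

(** Stated for Lebesgue measure on the whole line with 0 <= x as a premise: translations preserve
    that measure, but not its restriction to the half-line. *)
Definition aeH P := \forall x \ae mu R, 0 <= x -> P x.

Lemma aeHP P : (\forall x \ae leb `[0, +oo[, P x) <-> aeH P.
Proof. by rewrite ae_lebP /aeH; split; apply: filterS => x; rewrite in_itv/= andbT. Qed.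

Lemma aeT P : (forall x, P x) -> \forall x \ae mu R, P x.
Proof. by move=> h; exact: nearW. Qed.

Lemma aeHT P : (forall x, 0 <= x -> P x) -> aeH P.
Proof. exact: aeT. Qed.

Lemma aeHS P Q : (forall x, 0 <= x -> P x -> Q x) -> aeH P -> aeH Q.
Proof. by rewrite /aeH => PQ; apply: filterS => x h x0; exact: PQ (h x0). Qed.

Lemma aeHI P Q : aeH P -> aeH Q -> aeH (fun x => P x /\ Q x).
Proof. by rewrite /aeH; apply: filterS2 => x p q x0; split; [exact: p|exact: q]. Qed.

Lemma measurable_halfline : measurable (halfline R : set (measurableTypeR R)).
Proof. exact: measurable_itv. Qed.

Lemma halflineE x : halfline R x = (0 <= x) :> Prop.
Proof. by rewrite /halfline/= in_itv/= andbT. Qed.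

End halfline_ae.
#[global] Hint Resolve measurable_halfline : core.

Section translation.
Context {R : realType}.
Implicit Types (t : R).

Lemma measurable_shift t : measurable_fun [set: measurableTypeR R] (fun x : measurableTypeR R => (x + t : measurableTypeR R)).
Proof. by apply: measurable_funD. Qed.

(** Lebesgue measure is the only measure with the right values on half-open intervals, and its
    pushforward under a translation has those values. *)
Lemma lebesgue_measure_shift t (A : set (measurableTypeR R)) : measurable A ->
  mu R ((fun x => x + t) @^-1` A) = mu R A.
Proof.
move=> mA.
pose sh : {mfun measurableTypeR R >-> measurableTypeR R} :=
  HB.pack (fun x : measurableTypeR R => x + t)
    (@isMeasurableFun.Build _ _ _ _ _ (measurable_shift t)).
rewrite -[LHS]/(pushforward (mu R) sh A).
apply/esym/(@lebesgue_measure_unique R (pushforward (mu R) sh)) => //= _ [[a b] _ <-].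
rewrite /pushforward/=.
rewrite (_ : _ @^-1` _ = `](a - t), (b - t)]%classic); last first.
  by apply/seteqP; split=> x/=; rewrite !in_itv/= ltrBlDr lerBrDr.
by rewrite !lebesgue_measure_itv/= !lte_fin ltrD2r; case: ifP => // _;
  rewrite -!EFinB; congr EFin; ring.
Qed.

Lemma ae_shift t (P : R -> Prop) :
  (\forall x \ae mu R, P x) -> \forall x \ae mu R, P (x + t).
Proof.
move=> [A [mA A0 PA]]; exists ((fun x => x + t) @^-1` A); split.
- by rewrite -[X in measurable X]setTI; exact: measurable_shift.
- by rewrite lebesgue_measure_shift.
- by move=> x /= nP; exact: PA.
Qed.

Lemma integral_shift t (D : set (measurableTypeR R)) (f : R -> \bar R) : measurable D ->
  measurable_fun D f -> (forall x, 0 <= f x)%E ->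
  (\int[mu R]_(x in D) f x = \int[mu R]_(x in [set x | D (x + t)%R]) f (x + t)%R)%E.
Proof.
move=> mD mf f0.
rewrite [RHS](_ : _ = \int[mu R]_(x in (fun x => x + t)%R @^-1` D) (f \o (fun x => x + t)%R) x)%E//.
rewrite -(ge0_integral_pushforward (measurable_shift t) (mu R))//.
apply: eq_measure_integral => [|mt A mA _]; first exact: measurable_shift.
by apply: esym; exact: lebesgue_measure_shift.
Qed.

Lemma Rintegral_shift t (D : set (measurableTypeR R)) (f : R -> R) : measurable D ->
  measurable_fun D f ->
  \int[mu R]_(x in D) f x = \int[mu R]_(x in [set x | D (x + t)]) f (x + t).
Proof.
move=> mD mf; rewrite /Rintegral; congr fine; rewrite integralE [RHS]integralE.
congr (_ - _)%E.
  rewrite (integral_shift t)//; first by apply: eq_integral => x _; rewrite ?funeposE ?funenegE.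
  by apply: measurable_funepos; exact/measurable_EFinP.
rewrite (integral_shift t)//; first by apply: eq_integral => x _; rewrite ?funeposE ?funenegE.
by apply: measurable_funeneg; exact/measurable_EFinP.
Qed.

End translation.

(** * The space L_0^oo(w) through its representatives *)

Section L0.
Context {R : realType} (w : weight R).
Implicit Types (F G : R -> R[i]).

Lemma weight_gt0 x : 0 <= x -> 0 < w x.
Proof. by move=> x0; exact: lt_le_trans ltr01 (weight_ge1 w x0). Qed.

Lemma weight_ge0 x : 0 <= x -> 0 <= w x.
Proof. by move=> /weight_gt0/ltW. Qed.

Lemma ess_sup_on_le i F (K : R) : {subset i <= `[0, +oo[} ->
  (ess_sup_on i w F <= K%:E)%E <-> aeH (fun x => x \in i -> normc (F x) <= K * w x).
Proof.
move=> si; rewrite /aeH.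
have E : (ess_sup_on i w F <= K%:E)%E <->
    \forall x \ae leb i, ((normc (F x) / w x)%:E <= K%:E)%E.
  by split=> h; [exact/ess_supP | exact/ess_supP].
rewrite E ae_lebP; split; apply: filterS => x h.
  by move=> x0 xi; rewrite -ler_pdivrMr ?weight_gt0// -lee_fin; exact: h.
move=> xi; have x0 : 0 <= x by have := si _ xi; rewrite in_itv/= andbT.
by rewrite lee_fin ler_pdivrMr ?weight_gt0//; exact: h.
Qed.

(** Essential suprema are traded for almost-everywhere bounds, which pass through translations and
    pointwise algebra; later membership proofs use this form. *)
Lemma L0P F : F \in L0 w <->
  [/\ cmeasurable F, exists M, aeH (fun x => normc (F x) <= M * w x) &
   forall e, 0 < e -> exists2 X, 0 <= X & aeH (fun x => X < x -> normc (F x) <= e * w x)].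
Proof.
have si : {subset `[0, +oo[ <= `[(0 : R), +oo[} by [].
rewrite inE/=; split.
  move=> [mF bF lF]; split => //.
    exists (fine (ess_sup_on `[0%R, +oo[ w F)).
    have := (ess_sup_on_le F (fine (ess_sup_on `[0%R, +oo[ w F)) si).1.
    rewrite fineK; last first.
      by rewrite ge0_fin_numE// ess_sup_on_ge0// leb_gt0.
    by move=> /(_ (lexx _)); apply: aeHS => x x0; apply; rewrite in_itv/= x0.
  move=> e e0; move/fine_cvgP : lF => [fin /cvgr0Pnorm_lt/(_ e e0)].
  move=> cv.
  have : \forall x \near +oo%R, 0 <= x /\ (ess_sup_on `]x, +oo[ w F <= e%:E)%E.
    near=> x; split; first by near: x; exact: nbhs_pinfty_ge.
    rewrite -[leLHS]fineK; last by near: x.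
    rewrite lee_fin; apply: le_trans (ler_norm _) _; apply: ltW.
    by near: x.
  move=> /pinfty_ex_gt0[X X0 [_ h]]; exists X; first exact: ltW.
  have := (ess_sup_on_le F e (sub_tail (ltW X0))).1 h.
  by apply: aeHS => x x0 + Xx; apply; rewrite in_itv/= Xx.
move=> [mF [M bF] lF]; split => //.
  apply: (@le_lt_trans _ _ M%:E); last exact: ltry.
  apply/ess_sup_on_le => //; apply: aeHS bF => x x0 + _; exact.
have key e : 0 < e -> \forall x \near +oo%R, (0 <= ess_sup_on `]x, +oo[ w F <= e%:E)%E.
  move=> e0; have [X X0 h] := lF _ e0.
  near=> x; have x0 : 0 <= x by near: x; exact: nbhs_pinfty_ge.
  rewrite ess_sup_on_ge0 ?leb_tail_gt0//=; last exact: sub_tail.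
  apply/ess_sup_on_le; first exact: sub_tail.
  apply: aeHS h => y y0 + xy; apply; move: xy; rewrite in_itv/= andbT; apply: le_lt_trans.
  by near: x; apply: nbhs_pinfty_ge; rewrite num_real.
apply/fine_cvgP; split.
  near=> x; rewrite ge0_fin_numE.
    by apply: (@le_lt_trans _ _ 1%:E); [near: x; apply: filterS (key _ ltr01) => x /andP[] | exact: ltry].
  by near: x; apply: filterS (key _ ltr01) => x /andP[].
apply/cvgr0Pnorm_le => e e0; apply: filterS (key _ e0) => x /andP[h1 h2] /=.
have fn : ess_sup_on `]x, +oo[ w F \is a fin_num.
  by rewrite ge0_fin_numE//; exact: le_lt_trans h2 (ltry _).
by rewrite ger0_norm ?fine_ge0// -lee_fin fineK.
Unshelve. all: by end_near. Qed.

Local Open Scope quotient_scope.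

(** Made total by a default: a function outside [L0 w] is sent to the class of 0. *)
Definition cl F : Linf0 w := \pi_(Linf0 w) (insubd (0 : L0fun w) F).

Lemma repr_piE (f : L0fun w) : aeH (fun x => (repr (\pi_(Linf0 w) f) : L0fun w) x = f x).
Proof.
have := reprK (\pi_(Linf0 w) f) => /eqP; rewrite -idealrBE => /set_mem/aeHP.
by apply: aeHS => x x0 /eqP; rewrite subr_eq0 => /eqP.
Qed.

Lemma clE F : F \in L0 w -> aeH (fun x => cl F x = F x).
Proof.
move=> FL; apply: aeHS (repr_piE (insubd (0 : L0fun w) F)) => x x0.
by rewrite -[LHS]/(cl F x) => ->; rewrite /insubd insubT.
Qed.

Lemma eq_Linf0 (f g : Linf0 w) : aeH (fun x => f x = g x) -> f = g.
Proof.
move=> fg; rewrite -[f]reprK -[g]reprK; apply/eqP; rewrite -idealrBE.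
apply/mem_set/aeHP; apply: aeHS fg => x x0 h.
by rewrite -[LHS]/(f x - g x) h subrr.
Qed.

Lemma Linf0_in (f : Linf0 w) : (f : R -> R[i]) \in L0 w.
Proof. exact: L0fun_valP. Qed.

Lemma Linf0_cmeas (f : Linf0 w) : cmeasurable f.
Proof. by have /L0P[] := Linf0_in f. Qed.

Lemma Linf0DE (f g : Linf0 w) : aeH (fun x => (f + g : Linf0 w) x = f x + g x).
Proof.
have -> : f + g = \pi_(Linf0 w) (repr f + repr g) by rewrite raddfD/= !reprK.
exact: repr_piE.
Qed.

Lemma Linf0ZE a (f : Linf0 w) : aeH (fun x => (a *: f : Linf0 w) x = a * f x).
Proof. exact: (@repr_piE (a *: repr f)). Qed.

Lemma Linf00E : aeH (fun x => (0 : Linf0 w) x = 0).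
Proof.
have -> : (0 : Linf0 w) = \pi_(Linf0 w) 0 by rewrite raddf0.
exact: repr_piE.
Qed.

Lemma Linf0_norm_fin (f : Linf0 w) : (Linf0_norm f)%:E = ess_sup_on `[0%R, +oo[ w f.
Proof.
rewrite /Linf0_norm fineK//; have := Linf0_in f; rewrite inE/= => -[_ fb _].
by rewrite ge0_fin_numE// ess_sup_on_ge0// leb_gt0.
Qed.

Lemma Linf0_norm_ge0 (f : Linf0 w) : 0 <= Linf0_norm f.
Proof. by rewrite -lee_fin Linf0_norm_fin ess_sup_on_ge0// leb_gt0. Qed.

Lemma Linf0_norm_ae (f : Linf0 w) : aeH (fun x => normc (f x) <= Linf0_norm f * w x).
Proof.
have := (@ess_sup_on_le `[0, +oo[ f (Linf0_norm f) _).1.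
rewrite -Linf0_norm_fin => /(_ (fun _ => id) (lexx _)).
by apply: aeHS => x x0; apply; rewrite in_itv/= x0.
Qed.

Lemma Linf0_norm_le (f : Linf0 w) K : aeH (fun x => normc (f x) <= K * w x) -> Linf0_norm f <= K.
Proof.
move=> h; rewrite -lee_fin Linf0_norm_fin; apply/ess_sup_on_le => //.
by apply: aeHS h => x x0 + _; exact.
Qed.

Lemma Linf0_norm_eq0 (f : Linf0 w) : Linf0_norm f <= 0 -> f = 0.
Proof.
move=> f0; apply: eq_Linf0.
have := aeHI (Linf0_norm_ae f) Linf00E; apply: aeHS => x x0 [h ->].
apply: eq0_normc; apply/eqP; rewrite eq_le normc_ge0 andbT; apply: le_trans h _.
by rewrite mulr_le0_ge0// weight_ge0.
Qed.

Lemma Linf0_normZ a (f : Linf0 w) : Linf0_norm (a *: f) <= normc a * Linf0_norm f.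
Proof.
apply: Linf0_norm_le; have := aeHI (Linf0ZE a f) (Linf0_norm_ae f).
by apply: aeHS => x x0 [-> h]; rewrite normcM -mulrA ler_wpM2l ?normc_ge0.
Qed.

Lemma Linf0_tail (f : Linf0 w) e : 0 < e ->
  exists2 X, 0 <= X & aeH (fun x => X < x -> normc (f x) <= e * w x).
Proof. by move=> e0; have /L0P[_ _ /(_ _ e0)] := Linf0_in f. Qed.

End L0.

(** * Domination and linearity of complex integrals on the half-line *)

Section integrability.
Context {R : realType}.
Implicit Types (f g p : R -> R) (F G : R -> R[i]).
Local Notation H := (halfline R).
Local Notation integrableH f := ((mu R).-integrable H (EFin \o (f : R -> R))).

Lemma integrable_dom f g : measurable_fun H f -> integrableH g ->
  (forall x, 0 <= x -> 0 <= g x) -> aeH (fun x => `|f x| <= g x) ->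
  integrableH f /\ `|\int[mu R]_(x in H) f x| <= \int[mu R]_(x in H) g x.
Proof.
move=> mf ig g0 fg.
have le : (\int[mu R]_(x in H) `|f x|%:E <= \int[mu R]_(x in H) (g x)%:E)%E.
  apply: ae_ge0_le_integral => //.
  - by do 2 apply: measurableT_comp => //.
  - by move=> x; rewrite halflineE => x0; rewrite lee_fin g0.
  - exact: measurable_int ig.
  - by move: fg; rewrite /aeH; apply: filterS => x + xH; rewrite lee_fin; apply; rewrite -halflineE.
have fin : (\int[mu R]_(x in H) (g x)%:E < +oo)%E.
  by rewrite ltey_eq (integrable_fin_num measurable_halfline ig).
have jf : integrableH f.
  apply/integrableP; split; first exact/measurable_EFinP.
  exact: le_lt_trans le fin.
split => //; apply: le_trans (le_normr_Rintegral measurable_halfline jf) _.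
apply: fine_le => //.
  apply: (integrable_fin_num measurable_halfline).
  exact: (integrable_abse jf).
exact: integrable_fin_num.
Qed.

Lemma integrableHZ a f : integrableH f -> integrableH (fun x => a * f x).
Proof. by move=> jf; exact: (integrableZl measurable_halfline a jf). Qed.

Lemma integrableHD f g : integrableH f -> integrableH g -> integrableH (fun x => f x + g x).
Proof. by move=> jf jg; exact: (integrableD measurable_halfline jf jg). Qed.

Lemma integrableHB f g : integrableH f -> integrableH g -> integrableH (fun x => f x - g x).
Proof. by move=> jf jg; exact: (integrableB measurable_halfline jf jg). Qed.

Definition cintegrable F :=
  integrableH (fun x => complex.Re (F x)) /\ integrableH (fun x => complex.Im (F x)).

Lemma cintegralZD a F G : cintegrable F -> cintegrable G ->
  cintegral (fun x => a * F x + G x) = a * cintegral F + cintegral G.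
Proof.
case: a => a b [rF iF] [rG iG]; rewrite /cintegral.
have E1 : \int[mu R]_(x in H) complex.Re ((a +i* b) * F x + G x) =
   a * \int[mu R]_(x in H) complex.Re (F x) - b * \int[mu R]_(x in H) complex.Im (F x)
   + \int[mu R]_(x in H) complex.Re (G x).
  rewrite -(RintegralZl a _ rF)// -(RintegralZl b _ iF)//.
  rewrite -RintegralB//; [|exact: integrableHZ|exact: integrableHZ].
  rewrite -RintegralD//; last by apply: integrableHB; exact: integrableHZ.
  by apply: eq_Rintegral => x _; case: (F x) (G x) => ? ? [].
have E2 : \int[mu R]_(x in H) complex.Im ((a +i* b) * F x + G x) =
   a * \int[mu R]_(x in H) complex.Im (F x) + b * \int[mu R]_(x in H) complex.Re (F x)
   + \int[mu R]_(x in H) complex.Im (G x).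
  rewrite -(RintegralZl a _ iF)// -(RintegralZl b _ rF)//.
  rewrite -RintegralD//; [|exact: integrableHZ|exact: integrableHZ].
  rewrite -RintegralD//; last by apply: integrableHD; exact: integrableHZ.
  by apply: eq_Rintegral => x _; case: (F x) (G x) => ? ? [].
by rewrite E1 E2; apply/eqP; rewrite eq_complex/= !eqxx.
Qed.

Lemma cintegralZ a F : cintegrable F -> cintegral (fun x => a * F x) = a * cintegral F.
Proof.
(* Writing a F as (a - 1) F + F reduces the one-term formula to the two-term one. *)
move=> iF; have := cintegralZD (a - 1) iF iF; rewrite mulrBl mul1r subrK => <-.
by congr cintegral; apply/funext => x; rewrite mulrBl mul1r subrK.
Qed.

Lemma eq_cintegral F G : (forall x, 0 <= x -> F x = G x) -> cintegral F = cintegral G.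
Proof.
by move=> FG; rewrite /cintegral; congr Complex; apply: eq_Rintegral => x;
  rewrite inE halflineE => /FG ->.
Qed.

Lemma ae_eq_Rintegral f g : measurable_fun H f -> measurable_fun H g ->
  aeH (fun x => f x = g x) -> \int[mu R]_(x in H) f x = \int[mu R]_(x in H) g x.
Proof.
move=> mf mg fg; congr fine; apply: ae_eq_integral => //.
- exact/measurable_EFinP.
- exact/measurable_EFinP.
- by move: fg; rewrite /aeH; apply: filterS => x + xH => ->//; rewrite -halflineE.
Qed.

Lemma ae_eq_cintegral F G : cmeasurable F -> cmeasurable G ->
  aeH (fun x => F x = G x) -> cintegral F = cintegral G.
Proof.
move=> [mF1 mF2] [mG1 mG2] FG; rewrite /cintegral; congr Complex; apply: ae_eq_Rintegral => //;
  by apply: aeHS FG => x x0 ->.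
Qed.

Lemma cmeasurableM F G : cmeasurable F -> cmeasurable G -> cmeasurable (fun x => F x * G x).
Proof.
move=> [F1 F2] [G1 G2]; split.
- rewrite (_ : (fun _ => _) = (fun x =>
    complex.Re (F x) * complex.Re (G x) - complex.Im (F x) * complex.Im (G x))).
    by apply: measurable_funB; apply: measurable_funM.
  by apply/funext => x; case: (F x) (G x) => ? ? [].
- rewrite (_ : (fun _ => _) = (fun x =>
    complex.Re (F x) * complex.Im (G x) + complex.Im (F x) * complex.Re (G x))).
    by apply: measurable_funD; apply: measurable_funM.
  by apply/funext => x; case: (F x) (G x) => ? ? [].
Qed.

Lemma cmeasurable_real p : measurable_fun H p -> cmeasurable (fun x => (p x)%:C).
Proof. by split => //=; exact: measurable_cst. Qed.

Lemma measurable_shiftH f x : 0 <= x -> measurable_fun H f ->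
  measurable_fun H (fun y => f (x + y)).
Proof.
move=> x0 mf; apply: (measurable_comp measurable_halfline _ mf).
  by move=> _ [y + <-]; rewrite !halflineE => y0; rewrite addr_ge0.
by apply: measurable_funTS; apply: measurable_funD.
Qed.

Lemma cmeasurable_shift F x : 0 <= x -> cmeasurable F -> cmeasurable (fun y => F (x + y)).
Proof.
by move=> x0 [mR mI]; split;
  [exact: (measurable_shiftH x0 mR) | exact: (measurable_shiftH x0 mI)].
Qed.

Lemma measurable_normc F : cmeasurable F -> measurable_fun H (fun x => normc (F x)).
Proof.
move=> [m1 m2]; rewrite (_ : (fun _ => _) = (fun x =>
   Num.sqrt (complex.Re (F x) ^+ 2 + complex.Im (F x) ^+ 2))); last first.
  by apply/funext => x; case: (F x).
apply: (measurableT_comp (f := @Num.sqrt R)) => //.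
  by apply: continuous_measurable_fun; exact: sqrt_continuous.
by apply: measurable_funD; apply: measurable_funX.
Qed.

(** The factor 2 comes from bounding real and imaginary parts separately; it is one of the two
    factors in the 4 of the product estimates. *)
Lemma cintegrable_dom F g : cmeasurable F -> integrableH g ->
  (forall x, 0 <= x -> 0 <= g x) -> aeH (fun x => normc (F x) <= g x) ->
  cintegrable F /\ normc (cintegral F) <= 2 * \int[mu R]_(x in H) g x.
Proof.
move=> [mR mI] ig g0 Fg.
have [|iR lR] := integrable_dom mR ig g0.
  by apply: aeHS Fg => x x0; apply: le_trans; exact: normc_ge_absRe.
have [|iI lI] := integrable_dom mI ig g0.
  by apply: aeHS Fg => x x0; apply: le_trans; exact: normc_ge_absIm.
split => //; apply: le_trans (normc_le _) _.
by rewrite mulr2n mulrDl mul1r lerD.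
Qed.

(* Splitting the integrand into positive and negative parts makes Tonelli
   applicable without any joint integrability. *)
Lemma measurable_conv f p g q : measurable_fun H f -> measurable_fun H p ->
  measurable_fun H g -> measurable_fun H q ->
  measurable_fun H (fun x => \int[mu R]_(y in H) (f (x + y) * p y + g (x + y) * q y)).
Proof.
move=> mf mp mg mq.
pose f' := f \_ H; pose p' := p \_ H; pose g' := g \_ H; pose q' := q \_ H.
have mf' : measurable_fun [set: measurableTypeR R] f' by apply/measurable_restrict => //; rewrite setTI.
have mp' : measurable_fun [set: measurableTypeR R] p' by apply/measurable_restrict => //; rewrite setTI.
have mg' : measurable_fun [set: measurableTypeR R] g' by apply/measurable_restrict => //; rewrite setTI.
have mq' : measurable_fun [set: measurableTypeR R] q' by apply/measurable_restrict => //; rewrite setTI.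
pose K (z : measurableTypeR R * measurableTypeR R) : \bar R := (f' (z.1 + z.2) * p' z.2 + g' (z.1 + z.2) * q' z.2)%:E.
have mK : measurable_fun setT K.
  apply/measurable_EFinP; apply: measurable_funD; apply: measurable_funM.
  - by apply: measurableT_comp => //; apply: measurable_funD.
  - exact: measurableT_comp.
  - by apply: measurableT_comp => //; apply: measurable_funD.
  - exact: measurableT_comp.
have mKp : measurable_fun setT (fun x => \int[mu R]_y (K^\+ (x, y)))%E.
  apply: (@measurable_fun_fubini_tonelli_F _ _ _ _ _ (mu R) (K^\+)%E) => //.
  exact: measurable_funepos.
have mKn : measurable_fun setT (fun x => \int[mu R]_y (K^\- (x, y)))%E.
  apply: (@measurable_fun_fubini_tonelli_F _ _ _ _ _ (mu R) (K^\-)%E) => //.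
  exact: measurable_funeneg.
apply: (@eq_measurable_fun _ _ _ _ H (fun x => fine (\int[mu R]_y (K^\+ (x, y)) - \int[mu R]_y (K^\- (x, y)))%E)).
  move=> x; rewrite inE halflineE => x0; rewrite /Rintegral; congr fine.
  have KE y : K (x, y) = ((fun y => (f (x + y) * p y + g (x + y) * q y)%:E) \_ H) y.
    rewrite /K /f' /p' /g' /q' !patchE/=; case: (boolP (y \in H)) => yH; last by rewrite !mulr0 addr0.
    rewrite mem_set// halflineE; move: yH; rewrite inE halflineE; exact: addr_ge0.
  rewrite [RHS]integral_mkcond [RHS]integralE; congr (_ - _)%E.
    by apply: eq_integral => y _; rewrite !funeposE KE.
  by apply: eq_integral => y _; rewrite !funenegE KE.
apply: measurable_funTS; apply: (measurableT_comp (f := fine)) => //.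
exact: emeasurable_funB.
Qed.

End integrability.

(** * The convolution f phi *)

Section convolution.
Context {R : realType} (w : weight R).
Implicit Types (F : R -> R[i]) (phi psi : R -> R[i]) (f g : Linf0 w).
Local Notation H := (halfline R).
Local Notation integrableH f := ((mu R).-integrable H (EFin \o (f : R -> R))).

Lemma measurable_weight : measurable_fun H w.
Proof.
apply: subspace_continuous_measurable_fun; first exact: measurable_itv.
exact: weight_continuous.
Qed.

Definition wnorm phi := \int[mu R]_(x in H) (w x * normc (phi x)).

Lemma wnorm_ge0 phi : 0 <= wnorm phi.
Proof.
by apply: Rintegral_ge0 => x; rewrite halflineE => x0; rewrite mulr_ge0 ?weight_ge0 ?normc_ge0.
Qed.

Lemma L1P phi : L1 w phi <-> cmeasurable phi /\ integrableH (fun x => w x * normc (phi x)).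
Proof.
have E : (\int[mu R]_(x in H) `|(w x * normc (phi x))%:E| =
    \int[mu R]_(x in H) (w x * normc (phi x))%:E)%E.
  apply: eq_integral => x; rewrite inE halflineE => x0.
  by rewrite gee0_abs// lee_fin mulr_ge0 ?weight_ge0 ?normc_ge0.
split=> -[mp ip]; split => //; last by move/integrableP: ip => [_]; rewrite E.
apply/integrableP; rewrite E; split => //; apply/measurable_EFinP.
by apply: measurable_funM; [exact: measurable_weight|exact: measurable_normc].
Qed.

Lemma L1_dom phi (g : R -> R) : cmeasurable phi -> integrableH g ->
  (forall x, 0 <= x -> w x * normc (phi x) <= g x) ->
  L1 w phi /\ wnorm phi <= \int[mu R]_(x in H) g x.
Proof.
move=> mp ig pg.
have g0 x : 0 <= x -> 0 <= g x.
  by move=> x0; apply: le_trans (pg _ x0); rewrite mulr_ge0 ?weight_ge0 ?normc_ge0.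
have [||i1 i2] := @integrable_dom R (fun x => w x * normc (phi x)) g _ ig g0.
- by apply: measurable_funM; [exact: measurable_weight|exact: measurable_normc].
- apply: aeHT => x x0; rewrite ger0_norm ?pg//.
  by rewrite mulr_ge0 ?weight_ge0 ?normc_ge0.
by split; [exact/L1P | apply: le_trans i2; exact: ler_norm].
Qed.

Lemma L1ZD a phi psi : L1 w phi -> L1 w psi ->
  L1 w (fun x => a * phi x + psi x).
Proof.
move=> /L1P[mp ip] /L1P[mq iq].
have [] // := @L1_dom (fun x => a * phi x + psi x)
  (fun x => normc a * (w x * normc (phi x)) + w x * normc (psi x)).
- exact: cmeasurableZD.
- by apply: integrableHD => //; exact: integrableHZ.
- move=> x x0; rewrite mulrCA -mulrDr ler_wpM2l ?weight_ge0//.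
  by rewrite -normcM le_normcD.
Qed.

(** The actual function behind the class [transl_conv]; regularity statements need its pointwise
    values. *)
Definition tconv F phi (x : R) := cintegral (fun y => F (x + y) * phi y).

Lemma conv_bound F phi x K : cmeasurable F -> L1 w phi -> 0 <= x -> 0 <= K ->
  aeH (fun y => phi y <> 0 -> normc (F (x + y)) <= K * w (x + y)) ->
  cintegrable (fun y => F (x + y) * phi y) /\
  normc (tconv F phi x) <= 2 * (K * w x * wnorm phi).
Proof.
move=> mF /L1P[mp ip] x0 K0 h.
have [|||i1 i2] := @cintegrable_dom R (fun y => F (x + y) * phi y)
    (fun y => K * w x * (w y * normc (phi y))) _ (integrableHZ _ ip).
- by apply: cmeasurableM => //; exact: cmeasurable_shift.
- by move=> y y0; rewrite !mulr_ge0 ?weight_ge0 ?normc_ge0.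
- apply: aeHS h => y y0 h; have [->|/eqP/h{}h] := eqVneq (phi y) 0.
    by rewrite mulr0 normc0 !mulr0.
  rewrite normcM mulrA ler_wpM2r ?normc_ge0//; apply: le_trans h _.
  by rewrite -mulrA ler_wpM2l// weightD.
- split => //; apply: le_trans i2 _; rewrite ler_wpM2l//.
  by rewrite RintegralZl.
Qed.

Lemma aeH_shift (P : R -> Prop) x : 0 <= x -> aeH P -> aeH (fun y => P (x + y)).
Proof.
rewrite /aeH => x0 /(ae_shift x); apply: filterS => y h y0.
by rewrite addrC; apply: h; rewrite addr_ge0.
Qed.

Lemma conv_boundf f phi x : L1 w phi -> 0 <= x ->
  cintegrable (fun y => f (x + y) * phi y) /\
  normc (tconv f phi x) <= 2 * (Linf0_norm f * w x * wnorm phi).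
Proof.
move=> Lp x0; apply: conv_bound => //; first exact: Linf0_cmeas.
  exact: Linf0_norm_ge0.
by apply: aeHS (aeH_shift x0 (Linf0_norm_ae f)) => y y0.
Qed.

Lemma cmeasurable_conv F phi : cmeasurable F -> cmeasurable phi -> cmeasurable (tconv F phi).
Proof.
move=> [F1 F2] [p1 p2]; split.
- rewrite (_ : (fun _ => _) = fun x => \int[mu R]_(y in H)
    (complex.Re (F (x + y)) * complex.Re (phi y) + complex.Im (F (x + y)) * (- complex.Im (phi y)))).
    by apply: (@measurable_conv R (fun x => complex.Re (F x)) _ (fun x => complex.Im (F x))) => //;
      exact: measurableT_comp.
  apply/funext => x; rewrite /tconv/=; apply: eq_Rintegral => y _.
  by case: (F (x + y)) (phi y) => ? ? [] ? ? /=; rewrite mulrN.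
- rewrite (_ : (fun _ => _) = fun x => \int[mu R]_(y in H)
    (complex.Re (F (x + y)) * complex.Im (phi y) + complex.Im (F (x + y)) * complex.Re (phi y))).
    by apply: (@measurable_conv R (fun x => complex.Re (F x)) _ (fun x => complex.Im (F x))).
  apply/funext => x; rewrite /tconv/=; apply: eq_Rintegral => y _.
  by case: (F (x + y)) (phi y) => ? ? [].
Qed.

Lemma conv_L0 f phi : L1 w phi -> tconv f phi \in L0 w.
Proof.
move=> Lp; apply/L0P; split.
- apply: cmeasurable_conv; first exact: Linf0_cmeas.
  by case: Lp.
- exists (2 * (Linf0_norm f * wnorm phi)); apply: aeHT => x x0.
  have [_ h] := conv_boundf f Lp x0; apply: le_trans h _.
  by rewrite -!mulrA (mulrC (w x)).
- move=> e e0; have d0 : 0 < 2 * wnorm phi + 1 by have := wnorm_ge0 phi; lra.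
  have [X X0 h] := Linf0_tail f (divr_gt0 e0 d0).
  exists X => //; apply: aeHT => x x0 Xx.
  have [|||_ b] := @conv_bound f phi x (e / (2 * wnorm phi + 1)) _ Lp x0.
  - exact: Linf0_cmeas.
  - by rewrite ltW// divr_gt0.
  - apply: aeHS (aeH_shift x0 h) => y y0 + _; apply.
    by rewrite (lt_le_trans Xx)// lerDl.
  apply: le_trans b _; rewrite (_ : 2 * _ = e * w x * (2 * wnorm phi / (2 * wnorm phi + 1))); last by ring.
  rewrite ler_piMr ?mulr_ge0 ?weight_ge0 ?(ltW e0)//.
  by rewrite ler_pdivrMr// mul1r lerDl.
Qed.

Lemma transl_convE f phi : L1 w phi ->
  aeH (fun x => transl_conv f phi x = tconv f phi x).
Proof.
move=> Lp; apply/aeHP; rewrite /transl_conv.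
set P := (X in xget 0 X); have : P (xget 0 P); last by [].
by apply: (@xgetPex _ 0 P); exists (cl w (tconv f phi)); apply/aeHP/clE/conv_L0.
Qed.

Lemma transl_conv_eq f phi g : L1 w phi ->
  aeH (fun x => g x = tconv f phi x) -> transl_conv f phi = g.
Proof.
move=> Lp h; apply: eq_Linf0; apply: aeHS (aeHI h (transl_convE f Lp)).
by move=> x x0 [-> ->].
Qed.

Lemma transl_convZDl a f g phi : L1 w phi ->
  transl_conv (a *: f + g) phi = a *: transl_conv f phi + transl_conv g phi.
Proof.
move=> Lp; apply: transl_conv_eq => //.
have := aeHI (Linf0DE (a *: transl_conv f phi) (transl_conv g phi))
  (aeHI (Linf0ZE a (transl_conv f phi)) (aeHI (transl_convE f Lp) (transl_convE g Lp))).
apply: aeHS => x x0 [-> [-> [-> ->]]].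
have [i1 _] := conv_boundf f Lp x0; have [i2 _] := conv_boundf g Lp x0.
rewrite -cintegralZD//; apply: ae_eq_cintegral.
- apply: cmeasurableZD; (apply: cmeasurableM; [apply: cmeasurable_shift => //; exact: Linf0_cmeas|by case: Lp]).
- apply: cmeasurableM; [apply: cmeasurable_shift => //; exact: Linf0_cmeas|by case: Lp].
- apply: aeHS (aeH_shift x0 (aeHI (Linf0DE (a *: f) g) (Linf0ZE a f))).
  by move=> y y0 [-> ->]; rewrite mulrDl mulrA.
Qed.

Lemma transl_convZDr a f phi psi : L1 w phi -> L1 w psi ->
  transl_conv f (fun x => a * phi x + psi x) = a *: transl_conv f phi + transl_conv f psi.
Proof.
move=> Lp Lq; apply: transl_conv_eq; first exact: L1ZD.
have := aeHI (Linf0DE (a *: transl_conv f phi) (transl_conv f psi))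
  (aeHI (Linf0ZE a (transl_conv f phi)) (aeHI (transl_convE f Lp) (transl_convE f Lq))).
apply: aeHS => x x0 [-> [-> [-> ->]]].
have [i1 _] := conv_boundf f Lp x0; have [i2 _] := conv_boundf f Lq x0.
rewrite -cintegralZD//; apply: eq_cintegral => y y0.
by rewrite mulrDr mulrCA.
Qed.

(** A phi vanishing on [0, X] sees only the part of f beyond X. This is how smallness of f at
    infinity is passed on to n f. *)
Lemma transl_conv_norm f phi K X : L1 w phi -> 0 <= K ->
  aeH (fun x => X < x -> normc (f x) <= K * w x) ->
  (forall y, 0 <= y -> y <= X -> phi y = 0) ->
  Linf0_norm (transl_conv f phi) <= 2 * (K * wnorm phi).
Proof.
move=> Lp K0 fX pX; apply: Linf0_norm_le; apply: aeHS (transl_convE f Lp) => x x0 ->.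
have [||_ h] := @conv_bound f phi x K _ Lp x0 K0.
- exact: Linf0_cmeas.
- apply: aeHS (aeH_shift x0 fX) => y y0 h py; apply: h.
  rewrite ltNge; apply/negP => xy; apply: py; apply: pX => //.
  by apply: le_trans xy; rewrite lerDr.
by apply: le_trans h _; rewrite -!mulrA (mulrC (w x)).
Qed.

End convolution.

(** * Representation of bounded functionals on L^1(w) *)

Section real_dual.
Context {R : realType} (w : weight R).
Implicit Types (p q f g : R -> R) (E S : set (measurableTypeR R)).
Local Notation H := (halfline R).
Local Notation integrableH f := ((mu R).-integrable H (EFin \o (f : R -> R))).
Local Notation toC p := (fun x => ((p : R -> R) x)%:C).

Lemma integrable_expN : integrableH (fun x => expR (- x)).
Proof.
have h : (mu R).-integrable setT (EFin \o exponential_pdf (1 : R)).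
  exact: integrable_exponential_pdf.
have : (mu R).-integrable H ((EFin \o (fun x => expR (- x)))); last by [].
apply/(integrable_mkcond _ measurable_halfline).2.
apply: eq_integrable h => // x _; rewrite /exponential_pdf [RHS]patchE/= [in LHS]patchE/=.
by rewrite -[`[0, +oo[%classic]/H; case: ifP => //= _; rewrite mul1r mulN1r.
Qed.

Lemma ae_le_of_integral f g S : measurable S -> S `<=` H -> integrableH f -> integrableH g ->
  (forall E, measurable E -> E `<=` S -> \int[mu R]_(x in E) f x <= \int[mu R]_(x in E) g x) ->
  \forall x \ae mu R, S x -> f x <= g x.
Proof.
move=> mS SH jf jg h.
pose E : set (measurableTypeR R) := S `&` [set x | g x < f x].
have mf := measurable_int _ jf; have mg := measurable_int _ jg.
have mE : measurable E.
  rewrite /E (_ : S `&` _ = S `&` (H `&` [set x | (EFin (g x) < EFin (f x))%E])).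
    by apply: measurableI => //; exact: (emeasurable_fun_lt measurable_halfline mg mf).
  apply/seteqP; split => x [Sx/=]; rewrite lte_fin; first by move=> h'; split => //; split => //; exact: SH.
  by move=> [].
have ES : E `<=` S by move=> x [].
have EH : E `<=` H by exact: subset_trans ES SH.
have jfE : (mu R).-integrable E (EFin \o f) by exact: integrableS jf.
have jgE : (mu R).-integrable E (EFin \o g) by exact: integrableS jg.
have jE : (mu R).-integrable E (EFin \o (fun x => f x - g x)).
  exact: (integrableB mE jfE jgE).
have I0 : (\int[mu R]_(x in E) `|(f x - g x)%:E| = 0)%E.
  have : \int[mu R]_(x in E) (f x - g x) <= 0.
    by rewrite RintegralB// subr_le0; exact: h.
  have -> : (\int[mu R]_(x in E) `|(f x - g x)%:E| = \int[mu R]_(x in E) (f x - g x)%:E)%E.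
    by apply: eq_integral => x; rewrite inE => -[_ gf]; rewrite gee0_abs// lee_fin subr_ge0 ltW.
  rewrite -lee_fin /Rintegral fineK; last exact: (integrable_fin_num mE jE).
  move=> h0; apply/eqP; rewrite eq_le h0/=; apply: integral_ge0 => x [_ /= gf].
  by rewrite lee_fin subr_ge0 ltW.
have /(ae_eq_integral_abs _ mE) h2 := I0.
have := h2 (measurable_int _ jE); rewrite /ae_eq; apply: filterS => x hx Sx.
rewrite leNgt; apply/negP => gf; have /= := hx (conj Sx gf).
by move=> [] /eqP; rewrite subr_eq0 => /eqP fg; move: gf; rewrite fg ltxx.
Qed.

Let mH : measurable (H : set (measurableTypeR R)) := measurable_halfline.

(** G stands for the real or the imaginary part of p |-> <n, f p> on real p; linearity and the bound
    are available only for p in L^1(w). *)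
Variables (G : (R -> R) -> R) (K : R).
Hypothesis K0 : 0 <= K.
Hypothesis GL : forall a p q, L1 w (toC p) -> L1 w (toC q) ->
  G (fun x => a * p x + q x) = a * G p + G q.
Hypothesis GK : forall p, L1 w (toC p) -> `|G p| <= K * wnorm w (toC p).

Lemma L1r_dom p q : measurable_fun H p -> L1 w (toC q) ->
  (forall x, 0 <= x -> `|p x| <= q x) -> L1 w (toC p) /\ wnorm w (toC p) <= wnorm w (toC q).
Proof.
move=> mp /L1P[mq iq] pq.
have := @L1_dom R w (toC p) _ (cmeasurable_real mp) iq; apply => x x0; rewrite !normc_real ler_wpM2l ?weight_ge0//.
by apply: le_trans (pq _ x0) _; exact: ler_norm.
Qed.

Lemma L1r0 : L1 w (toC (fun _ => 0)).
Proof.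
apply/L1P; split; first by apply: cmeasurable_real; exact: measurable_cst.
rewrite (_ : (fun _ => _) = cst 0); first exact: integrable0.
by apply/funext => x; rewrite normc_real normr0 mulr0.
Qed.

Lemma GB p q : L1 w (toC p) -> L1 w (toC q) -> G (fun x => p x - q x) = G p - G q.
Proof.
move=> Lp Lq; rewrite (_ : (fun _ => _) = (fun x => (-1) * q x + p x)).
  by rewrite GL// mulN1r addrC.
by apply/funext => x; rewrite mulN1r addrC.
Qed.

(** Dominated convergence sends the weighted norm of p_n - p to 0, and that norm controls G. Both
    the countable additivity of the charge below and the passage from simple to general functions
    rest on this. *)
Lemma Gdominated (p_ : nat -> R -> R) p q :
  (forall n, measurable_fun H (p_ n)) -> measurable_fun H p -> L1 w (toC q) ->
  (forall n x, 0 <= x -> `|p_ n x| <= q x) -> (forall x, 0 <= x -> `|p x| <= q x) ->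
  (forall x, 0 <= x -> p_ n x @[n --> \oo] --> p x) ->
  G (p_ n) @[n --> \oo] --> G p.
Proof.
move=> mp_ mp Lq pq pq' cp.
have Lp := (L1r_dom mp Lq pq').1.
have Lp_ n := (L1r_dom (mp_ n) Lq (pq n)).1.
have mw := measurable_weight w.
have q0 x : 0 <= x -> 0 <= q x by move=> x0; apply: le_trans (pq' _ x0).
have [] := @dominated_convergence _ _ _ (mu R) H measurable_halfline
  (fun n x => (w x * p_ n x)%:E) (fun x => (w x * p x)%:E) (fun x => (w x * normc (q x)%:C)%:E).
- by move=> n; apply/measurable_EFinP; apply: measurable_funM; [exact: mw|exact: mp_].
- by apply/measurable_EFinP; apply: measurable_funM; [exact: mw|exact: mp].
- apply: aeT => x; rewrite halflineE => x0; apply/fine_cvgP; split; first exact: nearW.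
  by apply: cvgM; [exact: cvg_cst | exact: cp].
- by have /L1P[] := Lq.
- apply: aeT => x n; rewrite halflineE => x0; rewrite abse_EFin lee_fin normrM normc_real.
  rewrite ger0_norm ?weight_ge0// ler_wpM2l ?weight_ge0//.
  by apply: le_trans (pq _ _ x0) _; exact: ler_norm.
move=> _ c0 _.
have EI n : (\int[mu R]_(x in H) `|(w x * p_ n x)%:E - (w x * p x)%:E| =
    (wnorm w (toC (fun x => (p_ n x - p x)%R)))%:E)%E.
  have Lpp : L1 w (toC (fun x => p_ n x - p x)).
    rewrite (_ : (fun _ => _) = (fun x => (-1) * (p x)%:C + (p_ n x)%:C)); first exact: L1ZD.
    by apply/funext => x; rewrite mulN1r rmorphB/= addrC.
  rewrite /wnorm /Rintegral fineK; last first.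
    by apply: (integrable_fin_num measurable_halfline); have /L1P[] := Lpp.
  apply: eq_integral => x; rewrite inE halflineE => x0.
  by rewrite -EFinB abse_EFin -mulrBr normrM normc_real (ger0_norm (weight_ge0 w x0)).
move: c0; rewrite /mkset => c0.
have {}c0 : wnorm w (toC (fun x => (p_ n x - p x)%R)) @[n --> \oo] --> 0.
  suff cE : (wnorm w (toC (fun x => (p_ n x - p x)%R)))%:E @[n --> \oo] --> 0%:E by exact: (fine_cvg cE).
  rewrite (_ : (fun n => _) = (fun n => \int[mu R]_(x in H) `|(w x * p_ n x)%:E - (w x * p x)%:E|)%E) //.
  by apply/funext => n; rewrite EI.
apply/cvgrPdist_le => e e0.
have d0 : 0 < e / (K + 1) by rewrite divr_gt0// ltr_wpDl.
move/cvgr0Pnorm_le: c0 => /(_ _ d0); apply: filterS => n h.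
rewrite distrC -GB//.
have Lpp : L1 w (toC (fun x => p_ n x - p x)).
  rewrite (_ : (fun _ => _) = (fun x => (-1) * (p x)%:C + (p_ n x)%:C)); first exact: L1ZD.
  by apply/funext => x; rewrite mulN1r rmorphB/= addrC.
apply: le_trans (GK Lpp) _.
apply: (@le_trans _ _ (K * (e / (K + 1)))).
  by rewrite ler_wpM2l//; apply: le_trans h; exact: ler_norm.
rewrite mulrCA ler_piMr ?(ltW e0)// ler_pdivrMr ?ltr_wpDl// mul1r lerDl//.
Qed.

(** A strictly positive element of L^1(w) with w psi = exp(-x). Indicators of unbounded sets need
    not be in L^1(w), but psi times an indicator always is, so E |-> G (psi 1_E) is a finite charge
    on all measurable sets; the representing function is its density divided by psi. *)
Let psi x := expR (- x) / w x.

Let psi_ge0 x : 0 <= x -> 0 <= psi x.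
Proof. by move=> x0; rewrite divr_ge0 ?expR_ge0 ?weight_ge0. Qed.

Let psi_gt0 x : 0 <= x -> 0 < psi x.
Proof. by move=> x0; rewrite divr_gt0 ?expR_gt0 ?weight_gt0. Qed.

Let wpsi x : 0 <= x -> w x * psi x = expR (- x).
Proof. by move=> x0; rewrite /psi mulrC divfK// gt_eqF ?weight_gt0. Qed.

Let mpsi : measurable_fun H psi.
Proof.
apply: measurable_funM.
  apply: measurable_funTS; apply: continuous_measurable_fun => x.
  by apply: continuous_comp; [exact: continuousN|exact: continuous_expR].
apply: (@measurable_comp _ _ _ (measurableTypeR R) (measurableTypeR R) (measurableTypeR R) [set x : R | x != 0] (fun x : R => x^-1) H w) => //.
- rewrite (_ : [set x : R | x != 0] = ~` [set 0]); first by apply: measurableC; exact: measurable_set1.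
  by apply/seteqP; split => x /= /eqP.
- by move=> _ [x + <-] /=; rewrite halflineE => x0; rewrite gt_eqF ?weight_gt0.
- apply: open_continuous_measurable_fun; first exact: open_neq.
  by move=> x; rewrite inE/= => x0; exact: inv_continuous.
- exact: measurable_weight.
Qed.

Let L1psi : L1 w (toC psi) .
Proof.
have [] // := @L1_dom R w (toC psi) _ (cmeasurable_real mpsi) integrable_expN.
by move=> x x0; rewrite normc_real ger0_norm ?psi_ge0// wpsi.
Qed.

Let psi1 (E : set (measurableTypeR R)) x := psi x * \1_E x.

Let mpsi1 E : measurable E -> measurable_fun H (psi1 E).
Proof.
move=> mE; apply: measurable_funM; first exact: mpsi.
by apply: measurable_funTS; exact: measurable_indic.
Qed.

Let psi1_le E x : 0 <= x -> `|psi1 E x| <= psi x.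
Proof.
move=> x0; rewrite /psi1 normrM ger0_norm ?psi_ge0// indicE.
by case: (_ \in _); rewrite ?normr1 ?mulr1// normr0 mulr0 psi_ge0.
Qed.

Let L1psi1 E : measurable E -> L1 w (toC (psi1 E)).
Proof. by move=> mE; exact: (L1r_dom (mpsi1 mE) L1psi (psi1_le E)).1. Qed.

Let eqG p q : L1 w (toC p) -> L1 w (toC q) -> (forall x, 0 <= x -> p x = q x) -> G p = G q.
Proof.
move=> Lp Lq pq; apply/eqP; rewrite -subr_eq0 -normr_le0 -GB//.
have Lpq : L1 w (toC (fun x => p x - q x)).
  rewrite (_ : (fun _ => _) = (fun x => (-1) * (q x)%:C + (p x)%:C)); first exact: L1ZD.
  by apply/funext => x; rewrite mulN1r rmorphB/= addrC.
apply: le_trans (GK Lpq) _; rewrite /wnorm.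
rewrite (_ : \int[mu R]_(x in H) _ = 0) ?mulr0//.
rewrite (@eq_Rintegral _ _ _ _ _ (cst 0)).
  by rewrite Rintegral_cst// mul0r.
by move=> x; rewrite inE halflineE => x0; rewrite pq// subrr normc_real normr0 mulr0.
Qed.

Let G0 : G (fun _ => 0) = 0.
Proof.
rewrite -[RHS](subrr (G (fun _ => 0))) -GB; [|exact: L1r0|exact: L1r0].
by congr G; apply/funext => x; rewrite subr0.
Qed.

Let nu (E : set (measurableTypeR R)) : \bar R := (G (psi1 E))%:E.

Let nu0 : nu set0 = 0%E.
Proof. by rewrite /nu (_ : psi1 set0 = fun _ => 0) ?G0//; apply/funext => x; rewrite /psi1 indic0 mulr0. Qed.

Let nuF E : measurable E -> nu E \is a fin_num.
Proof. by []. Qed.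

Let nuS : semi_sigma_additive nu.
Proof.
move=> F mF tF mUF.
pose U n : set (measurableTypeR R) := \big[setU/set0]_(0 <= i < n) F i.
have mU n : measurable (U n) by exact: bigsetU_measurable.
have UE n x : U n x <-> exists2 i, (i < n)%N & F i x.
  rewrite /U; elim: n => [|n IH]; first by rewrite big_geq//; split; case.
  rewrite big_nat_recr//=; split.
    by case => [/IH [i lin Fi]|Fn]; [exists i => //; exact: ltnW|exists n].
  case=> i; rewrite ltnS leq_eqVlt => /orP[/eqP ->|lin Fi]; first by right.
  by left; apply/IH; exists i.
have sumE n : (\sum_(0 <= i < n) nu (F i) = (G (psi1 (U n)))%:E)%E.
  elim: n => [|n IH]; first by rewrite /U !big_geq// -[RHS]/(nu set0) nu0.
  rewrite big_nat_recr//= IH /nu -EFinD; congr EFin.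
  rewrite -[G (psi1 (U n))]mul1r -GL; [|exact: L1psi1|exact: L1psi1].
  congr G; apply/funext => x; rewrite /psi1 mul1r -mulrDr; congr (_ * _).
  have : U n.+1 = U n `|` F n by rewrite /U big_nat_recr.
  move=> ->; rewrite !indicE in_setU.
  have [xU|xU] := boolP (x \in U n); have [xF|xF] := boolP (x \in F n);
    rewrite ?addr0 ?add0r//.
  move: xU xF; rewrite !inE => /UE[i lin Fi] Fn.
  have ein : i = n by apply: tF => //; exists x.
  by move: lin; rewrite ein ltnn.
rewrite (_ : (fun n => _) = fun n => (G (psi1 (U n)))%:E); last exact/funext.
apply/fine_cvgP; split; first exact: nearW.
(* At each point the indicators of the partial unions are eventually constant, and psi dominates all
   of them. *)
apply: (@Gdominated (fun n => psi1 (U n)) _ psi) => //.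
- by move=> n; exact: mpsi1.
- exact: mpsi1.
- by move=> n x; exact: psi1_le.
- by move=> x; exact: psi1_le.
- move=> x x0; apply: cvgM; first exact: cvg_cst.
  have [[i _ Fi]|nF] := pselect ((\bigcup_i F i) x).
    apply: cvg_near_cst; exists i.+1 => // n /= lin.
    by rewrite !indicE !mem_set//; [exists i|apply/UE; exists i].
  apply: cvg_near_cst; apply: nearW => n.
  rewrite !indicE !memNset//; move/UE => [i _ Fi]; apply: nF; by exists i.
Qed.

Let NU : {charge set (measurableTypeR R) -> \bar R} :=
  HB.pack nu (isCharge.Build _ _ _ nu nu0 nuF nuS).

Let wnorm_psi1 E : measurable E -> E `<=` H ->
  wnorm w (toC (psi1 E)) = \int[mu R]_(x in E) expR (- x).
Proof.
move=> mE EH; have -> : E = H `&` E by apply/esym/setIidPr.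
rewrite Rintegral_mkcondr; apply: eq_Rintegral => x; rewrite inE halflineE => x0.
rewrite normc_real /psi1 patchE indicE setIidr//.
have [xE|xE] := boolP (x \in E); last by rewrite mulr0 normr0 mulr0.
by rewrite mulr1 ger0_norm ?psi_ge0// wpsi.
Qed.

Let nu_mu : NU `<< mu R.
Proof.
move=> A A0 E mE EA; have E0 : mu R E = 0%E by exact: (A0 E).
rewrite -[LHS]/(nu E) /nu; congr EFin.
have mEH : measurable (E `&` H) by exact: measurableI.
rewrite (@eqG _ (psi1 (E `&` H))); [|exact: L1psi1|exact: L1psi1|].
  apply/eqP; rewrite -normr_le0; apply: le_trans (GK (L1psi1 mEH)) _.
  have EH0 : mu R (E `&` H) = 0%E.
    by apply/eqP; rewrite -measure_le0 -E0; apply: le_measure; rewrite ?inE.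
  rewrite wnorm_psi1// /Rintegral null_set_integral ?mulr0//.
  apply: (@measurable_int _ _ _ (mu R)).
  by apply: (integrableS measurable_halfline mEH _ integrable_expN) => x [].
move=> x x0; rewrite /psi1 !indicE in_setI [x \in H]mem_set ?andbT//.
by rewrite halflineE.
Qed.

Let h x := fine (Radon_Nikodym NU (mu R) x).

Let ih : (mu R).-integrable setT (EFin \o h).
Proof.
apply: eq_integrable (Radon_Nikodym_integrable nu_mu) => // x _ /=.
by rewrite fineK// Radon_Nikodym_fin_num//; exact: nu_mu.
Qed.

Let ihH : integrableH h.
Proof. exact: integrableS ih. Qed.

Let hE E : measurable E -> E `<=` H -> \int[mu R]_(x in E) h x = G (psi1 E).
Proof.
move=> mE EH; apply: EFin_inj; rewrite /Rintegral fineK; last first.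
  by apply: integrable_fin_num => //; exact: integrableS ih.
rewrite -[RHS]/(NU E) (Radon_Nikodym_integral nu_mu mE).
by apply: eq_integral => x _; rewrite fineK// Radon_Nikodym_fin_num//; exact: nu_mu.
Qed.

(** For every measurable E beyond X the hypothesis, applied to psi 1_E and its weighted norm,
    compares the integral of h over E with that of c exp(-x); comparison on all such E gives the
    pointwise bound. *)
Let h_bound X c : 0 <= c ->
  (forall p, L1 w (toC p) -> (forall y, 0 <= y -> y <= X -> p y = 0) ->
    `|G p| <= c * wnorm w (toC p)) ->
  aeH (fun x => X < x -> `|h x| <= c * expR (- x)).
Proof.
move=> c0 hG.
pose S : set (measurableTypeR R) := H `&` `]X, +oo[%classic.
have mS : measurable S by apply: measurableI => //; exact: measurable_itv.
have SH : S `<=` H by move=> x [].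
have ic : integrableH (fun x => c * expR (- x)) by apply: integrableHZ; exact: integrable_expN.
have key E : measurable E -> E `<=` S ->
    `|\int[mu R]_(x in E) h x| <= \int[mu R]_(x in E) (c * expR (- x)).
  move=> mE ES; have EH := subset_trans ES SH.
  rewrite hE// RintegralZl//; last by apply: integrableS integrable_expN.
  rewrite -wnorm_psi1//; apply: hG; first exact: L1psi1.
  move=> y y0 yX; rewrite /psi1 indicE memNset ?mulr0// => /ES[_] /=.
  by rewrite in_itv/= andbT ltNge yX.
have h1 := ae_le_of_integral mS SH ihH ic (fun E mE ES => le_trans (ler_norm _) (key E mE ES)).
have h2 : \forall x \ae mu R, S x -> - h x <= c * expR (- x).
  apply: ae_le_of_integral => //.
    by have := integrableHZ (-1) ihH; apply: eq_integrable => // x _; rewrite /= mulN1r.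
  move=> E mE ES; apply: le_trans (key E mE ES); rewrite -normrN; apply: le_trans (ler_norm _).
  rewrite -mulN1r -RintegralZl//; last by apply: integrableS ih.
  by under [in leRHS]eq_Rintegral do rewrite mulN1r.
rewrite /aeH; move: h1 h2; apply: filterS2 => x a1 a2 x0 Xx.
have Sx : S x by split; rewrite ?halflineE//= in_itv/= Xx.
by rewrite ler_norml lerNl a2// a1.
Qed.

Let h_bound0 : aeH (fun x => `|h x| <= K * expR (- x)).
Proof.
(* For X = -1 the vanishing condition on [0, X] is void and the tail is the whole half-line. *)
have := @h_bound (-1) K K0 (fun p Lp _ => GK Lp).
by apply: aeHS => x x0; apply; apply: lt_le_trans x0; rewrite ltrN10.
Qed.

(** An arbitrary list of values with an arbitrary family of sets, in place of a simple function,
    makes the statement inductive. *)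
Let h_simple (s : seq R) (A : R -> set (measurableTypeR R)) : (forall y, measurable (A y)) ->
  let q x := \sum_(y <- s) y * \1_(A y) x in
  [/\ L1 w (toC (fun x => psi x * q x)), integrableH (fun x => h x * q x) &
    G (fun x => psi x * q x) = \int[mu R]_(x in H) (h x * q x)].
Proof.
move=> mA; elim: s => [|y s [L1s js Gs]] /=.
  split.
  - rewrite (_ : (fun x => _) = toC (fun _ => 0)); first exact: L1r0.
    by apply/funext => x; rewrite big_nil mulr0.
  - rewrite (_ : (EFin \o _) = cst 0%E); first exact: integrable0.
    by apply/funext => x /=; rewrite big_nil mulr0.
  - rewrite (_ : (fun x => _) = (fun _ => 0)) ?G0; last first.
      by apply/funext => x; rewrite big_nil mulr0.
    rewrite (@eq_Rintegral _ _ _ _ _ (cst 0)); last by move=> x _; rewrite big_nil mulr0.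
    by rewrite Rintegral_cst; [rewrite mul0r|exact: measurable_halfline].
have mAH : measurable (A y `&` H : set (measurableTypeR R)) by exact: measurableI.
have L1y := L1psi1 (mA y).
have E1 : (fun x => psi x * (\sum_(j <- y :: s) j * \1_(A j) x)) =
    (fun x => y * psi1 (A y) x + psi x * (\sum_(j <- s) j * \1_(A j) x)).
  by apply/funext => x; rewrite big_cons mulrDr mulrCA.
have E2 : (fun x => h x * (\sum_(j <- y :: s) j * \1_(A j) x)) =
    (fun x => y * (h x * \1_(A y) x) + h x * (\sum_(j <- s) j * \1_(A j) x)).
  by apply/funext => x; rewrite big_cons mulrDr mulrCA.
have iy : integrableH (fun x => h x * \1_(A y) x).
  apply: le_integrable ihH => //.
    apply/measurable_EFinP; apply: measurable_funM.
      by apply/measurable_EFinP; exact: (measurable_int (mu R) ihH).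
    by apply: measurable_funTS; exact: measurable_indic.
  move=> x _ /=; rewrite lee_fin normrM indicE.
  by case: (_ \in _); rewrite ?normr1 ?mulr1// normr0 mulr0.
have Gy : G (psi1 (A y)) = \int[mu R]_(x in H) (h x * \1_(A y) x).
  rewrite (@eqG _ (psi1 (A y `&` H))); [|exact: L1psi1|exact: L1psi1|]; last first.
    move=> x x0; rewrite /psi1 !indicE in_setI [x \in H]mem_set ?andbT//.
    by rewrite halflineE.
  rewrite -hE; [|exact: mAH|by move=> x []].
  rewrite setIC Rintegral_mkcondr; apply: eq_Rintegral => x _.
  by rewrite patchE indicE; case: (_ \in _); rewrite ?mulr1// mulr0.
split.
- rewrite (_ : (fun x => _) = (fun x => y%:C * (psi1 (A y) x)%:C + (psi x * (\sum_(j <- s) j * \1_(A j) x))%:C)).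
    exact: L1ZD.
  by apply/funext => x; rewrite big_cons mulrDr mulrCA rmorphD rmorphM.
- by rewrite E2; apply: integrableHD => //; exact: integrableHZ.
- rewrite E1 E2 GL// Gs Gy RintegralD//; last exact: integrableHZ.
  by rewrite RintegralZl//.
Qed.

Let g x := h x / psi x.

Let mg : measurable_fun H g.
Proof.
apply: (@eq_measurable_fun _ _ _ _ _ (fun x => h x * (w x * expR x))).
  move=> x; rewrite inE halflineE => x0; rewrite /g /psi invfM invrK expRN invrK.
  by rewrite (mulrC (expR x)).
apply: measurable_funM; first by apply/measurable_EFinP; exact: (measurable_int (mu R) ihH).
apply: measurable_funM; first exact: measurable_weight.
by apply: measurable_funTS; apply: continuous_measurable_fun; exact: continuous_expR.
Qed.

(** Write p = psi k and let simple functions increase to k. On the side of G the approximants are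
    dominated by p; on the side of the integral by K exp(-x) k = K w p, thanks to the bound on h. *)
Let repr_ge0 p : L1 w (toC p) -> (forall x, 0 <= x -> 0 <= p x) ->
  integrableH (fun x => g x * p x) /\ G p = \int[mu R]_(x in H) (g x * p x).
Proof.
move=> Lp p0; have [[mp _] ip] := (L1P w (toC p)).1 Lp.
pose k x := p x * (w x * expR x).
have kE x : 0 <= x -> psi x * k x = p x.
  by move=> x0; rewrite /psi /k expRN; field; rewrite !gt_eqF ?expR_gt0 ?weight_gt0.
have k0 x : H x -> (0 <= (k x)%:E)%E.
  rewrite halflineE => x0; rewrite lee_fin /k mulr_ge0 ?p0//.
  by rewrite mulr_ge0 ?weight_ge0 ?expR_ge0.
have mk : measurable_fun H (EFin \o k).
  apply/measurable_EFinP; apply: measurable_funM; first exact: mp.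
  apply: measurable_funM; first exact: measurable_weight.
  by apply: measurable_funTS; apply: continuous_measurable_fun; exact: continuous_expR.
pose S_ := nnsfun_approx measurable_halfline mk.
pose s_ n : R -> R := (S_ n : measurableTypeR R -> R).
have s_cvg x : 0 <= x -> s_ n x @[n --> \oo] --> k x.
  move=> x0; have Hx : H x by rewrite halflineE.
  exact: (fine_cvg (cvg_nnsfun_approx measurable_halfline mk k0 Hx)).
have s_le n x : 0 <= x -> s_ n x <= k x.
  move=> x0; have -> : k x = limn (fun n => s_ n x) by apply/esym/cvg_lim => //; exact: s_cvg.
  apply: (@nondecreasing_cvgn_le _ (fun n => s_ n x)).
    by move=> m m' mm'; have := nd_nnsfun_approx measurable_halfline mk mm' => /asboolP/(_ x).
  by apply/cvg_ex; exists (k x); exact: s_cvg.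
pose p_ n x := psi x * s_ n x.
have p_le n x : 0 <= x -> `|p_ n x| <= p x.
  move=> x0; rewrite ger0_norm; last by rewrite mulr_ge0 ?psi_ge0.
  by rewrite -(kE _ x0) ler_wpM2l ?psi_ge0// s_le.
have simple n : integrableH (fun x => h x * s_ n x) /\
    G (p_ n) = \int[mu R]_(x in H) (h x * s_ n x).
  have [|_ j1 j2] := @h_simple (finmap.enum_fset (fset_set (range (S_ n)))) (fun y => S_ n @^-1` [set y]).
    by move=> y; exact: measurable_funPTI.
  have e : s_ n = fun x => \sum_(y <- finmap.enum_fset (fset_set (range (S_ n)))) y * \1_(S_ n @^-1` [set y]) x.
    by apply/funext => x; rewrite /s_ fimfunE fsbig_finite.
  by rewrite /p_ e.
have cG : G (p_ n) @[n --> \oo] --> G p.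
  apply: (@Gdominated p_ p p) => //.
  - by move=> n; apply: measurable_funM; [exact: mpsi|apply: measurable_funTS; exact: (measurable_funP (S_ n))].
  - by move=> x x0; rewrite ger0_norm ?p0.
  - by move=> x x0; rewrite -(kE _ x0); apply: cvgM; [exact: cvg_cst|exact: s_cvg].
have iq : integrableH (fun x => K * (w x * normc (p x)%:C)) by exact: integrableHZ.
have [] := @dominated_convergence _ _ _ (mu R) H measurable_halfline
  (fun n x => (h x * s_ n x)%:E) (fun x => (h x * k x)%:E)
  (fun x => (K * (w x * normc (p x)%:C))%:E).
- by move=> n; exact: measurable_int (simple n).1.
- apply/measurable_EFinP; apply: measurable_funM; last exact/measurable_EFinP.
  by apply/measurable_EFinP; exact: (measurable_int (mu R) ihH).
- apply: aeT => x; rewrite halflineE => x0; apply/fine_cvgP; split; first exact: nearW.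
  by apply: cvgM; [exact: cvg_cst | exact: s_cvg].
- exact: iq.
- move: h_bound0; rewrite /aeH; apply: filterS => x hx n; rewrite halflineE => x0.
  rewrite abse_EFin lee_fin normrM (@ger0_norm _ (s_ n x))//.
  apply: (@le_trans _ _ (K * expR (- x) * k x)).
    by apply: ler_pM => //; [exact: hx|exact: s_le].
  by rewrite normc_real ger0_norm ?p0// -(kE _ x0) [w x * _]mulrA wpsi// mulrA.
move=> ihk _ ch.
have E : {in H, (fun x => (h x * k x)%:E) =1 EFin \o (fun x => g x * p x)}.
  move=> x; rewrite inE halflineE => x0; rewrite /= /g -[in RHS](kE _ x0).
  by rewrite -mulrA mulKf// gt_eqF ?psi_gt0.
split; first exact: eq_integrable ihk.
have -> : \int[mu R]_(x in H) (g x * p x) = \int[mu R]_(x in H) (h x * k x).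
  by congr fine; apply: eq_integral => x xH; rewrite E.
apply: (@cvg_unique _ _ _ _ _ _ cG).
  exact: norm_hausdorff.
rewrite (_ : (fun n => _) = fun n => \int[mu R]_(x in H) (h x * s_ n x)); last first.
  by apply/funext => n; rewrite (simple n).2.
have fin : (\int[mu R]_(x in H) (h x * k x)%:E)%E \is a fin_num.
  exact: (integrable_fin_num measurable_halfline ihk).
by rewrite -(fineK fin) in ch; exact: (fine_cvg ch).
Qed.

(** The duality between L^1(w) and the functions bounded relative to w. The last clause keeps one
    estimate for each tail, because a global norm bound alone could not show that g is small
    relative to w at infinity. *)
Lemma real_dual_repr : exists g : R -> R, [/\ measurable_fun H g,
  forall p, L1 w (toC p) ->
    integrableH (fun x => g x * p x) /\ G p = \int[mu R]_(x in H) (g x * p x) &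
  forall X c, 0 <= c ->
    (forall p, L1 w (toC p) -> (forall y, 0 <= y -> y <= X -> p y = 0) ->
      `|G p| <= c * wnorm w (toC p)) ->
    aeH (fun x => X < x -> `|g x| <= c * w x)].
Proof.
exists g; split; first exact: mg.
- move=> p Lp; have [[mp _] ip] := (L1P w (toC p)).1 Lp.
  pose pp x := Num.max (p x) 0; pose pn x := Num.max (- p x) 0.
  have ppn x : p x = pp x - pn x.
    by rewrite /pp /pn; case: (leP (p x) 0); case: (leP (- p x) 0); lra.
  have Labs : L1 w (toC (fun x => `|p x|)).
    apply/L1P; split; first by apply: cmeasurable_real; exact: measurableT_comp.
    by apply: eq_integrable ip => // x _; rewrite /comp !normc_real normr_id.
  have Lpp : L1 w (toC pp).
    apply: (L1r_dom _ Labs _).1; first by apply: measurable_maxr.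
    by move=> x x0; rewrite /pp; case: (leP (p x) 0); rewrite ?normr0.
  have Lpn : L1 w (toC pn).
    apply: (L1r_dom _ Labs _).1; first by apply: measurable_maxr => //; exact: measurableT_comp.
    by move=> x x0; rewrite /pn; case: (leP (- p x) 0); rewrite ?normr0// normrN.
  have [|i1 e1] := repr_ge0 Lpp; first by move=> x x0; rewrite /pp le_max lexx orbT.
  have [|i2 e2] := repr_ge0 Lpn; first by move=> x x0; rewrite /pn le_max lexx orbT.
  have E : (fun x => g x * p x) = (fun x => g x * pp x - g x * pn x).
    by apply/funext => x; rewrite ppn mulrBr.
  split; first by rewrite E; exact: integrableHB.
  rewrite E RintegralB// -e1 -e2 -GB//; congr G.
  by apply/funext => x; rewrite ppn.
- move=> X c c0 hc; apply: aeHS (h_bound c0 hc) => x x0 hx Xx.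
  rewrite /g normrM normfV (gtr0_norm (psi_gt0 x0)) ler_pdivrMr ?psi_gt0//.
  by rewrite -mulrA wpsi// hx.
Qed.

End real_dual.

(** * The action of the dual *)

Section indicator.
Context {R : realType} (w : weight R).
Local Notation H := (halfline R).
Local Notation integrableH f := ((mu R).-integrable H (EFin \o (f : R -> R))).

Definition ind (c x : R) : R[i] := (\1_`[0, c]%classic x)%:C.

Let mI (c : R) : measurable (`[0, c]%classic : set (measurableTypeR R)).
Proof. exact: measurable_itv. Qed.

Let IH (c : R) : `[0, c]%classic `<=` H.
Proof. by move=> x /=; rewrite halflineE in_itv/= => /andP[]. Qed.

Lemma L1_ind c : L1 w (ind c).
Proof.
have icw : (mu R).-integrable `[0, c] (EFin \o w).
  apply: continuous_compact_integrable; first exact: segment_compact.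
  exact: continuous_subspaceW (IH (c := c)) (@weight_continuous _ w).
have : integrableH (fun x => w x * \1_`[0, c]%classic x).
  have := (integrable_mkcond _ (mI c)).1 icw.
  move=> /(integrableS measurableT measurable_halfline (@subsetT _ _)).
  apply: eq_integrable => // x _; rewrite /= patchE indicE.
  by case: (_ \in _); rewrite ?mulr1// mulr0.
move=> iw; apply/L1P; split.
  apply: cmeasurable_real; apply: measurable_funTS; exact: measurable_indic.
apply: eq_integrable iw => // x _; rewrite /comp /ind normc_real ger0_norm//.
Qed.

(** By Lebesgue differentiation f is almost everywhere the derivative of its primitive, which is
    identically 0; the intervals [0, N] exhaust the half-line. *)
Lemma ae_eq0_of_integrals (f : R -> R) : measurable_fun H f ->
  (forall c, 0 <= c -> (mu R).-integrable `[0, c] (EFin \o f)) ->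
  (forall c, 0 <= c -> \int[mu R]_(x in `[0, c]) f x = 0) -> aeH (fun x => f x = 0).
Proof.
move=> mf jf f0.
have key (N : nat) : \forall x \ae mu R, 0 < x -> x < N%:R -> f x = 0.
  have jN := jf N%:R (ler0n _ N).
  have lN := integrable_locally (mI N%:R) jN.
  have iN := (integrable_mkcond _ (mI N%:R)).1 jN; rewrite restrict_EFin in iN.
  have := FTC1 (a := BLeft 0) _ lN.
  have F0 y : \int[mu R]_(t in [set` Interval (BLeft 0) (BRight y)]) ((f \_ `[0, N%:R]) t) = 0.
    rewrite -Rintegral_mkcondr.
    have [y0|y0] := ltP y 0.
      rewrite (_ : _ `&` _ = set0) ?Rintegral_set0//.
      apply/seteqP; split => // x [] /=; rewrite in_itv/= => /andP[x0 xy] _.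
      by have := le_lt_trans (le_trans x0 xy) y0; rewrite ltxx.
    rewrite (_ : _ `&` _ = `[0, Num.min y N%:R]%classic); last first.
      apply/seteqP; split => x /=; rewrite !in_itv/= le_min.
        by move=> [/andP[-> ->] /andP[_ ->]].
      by move=> /andP[-> /andP[-> ->]].
    by apply: f0; rewrite le_min y0 ler0n.
  have iNy y : (mu R).-integrable [set` Interval (BLeft 0) (BRight y)] (EFin \o (f \_ `[0, N%:R])).
    by apply: (integrableS measurableT _ (@subsetT _ _)) => //; exact: measurable_itv.
  move=> /(_ iNy); apply: filterS => x hx x0 xN.
  have [|_] := hx; first by rewrite lte_fin.
  rewrite (_ : (fun y => _) = cst 0); last exact/funext.
  by rewrite derive1_cst patchE mem_set//= in_itv/= !ltW.
have n0 : \forall x \ae mu R, x != 0.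
  exists [set 0]; split; [exact: measurable_set1|exact: lebesgue_measure_set1|].
  by move=> x /= /negP; rewrite negbK => /eqP.
have := ae_foralln key; rewrite /aeH; move: n0; apply: filterS2 => x xn0 hx x0.
by apply: (hx (Num.truncn x).+1); [rewrite lt_def xn0|rewrite truncnS_gt].
Qed.

(** Indicators of intervals [0, c] already separate points, so identities about n f need be tested
    only on them. *)
Lemma Linf0_ext (g g' : Linf0 w) : (forall c, 0 <= c ->
  cintegral (fun x => g x * ind c x) = cintegral (fun x => g' x * ind c x)) -> g = g'.
Proof.
move=> gg'; apply/eqP; rewrite -subr_eq0; apply/eqP/eq_Linf0.
pose d : Linf0 w := g - g'; rewrite -[g - g']/d.
have dint c : cintegrable (fun x => d x * ind c x).
  have := (conv_boundf d (L1_ind c) (lexx 0)).1.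
  by rewrite (_ : (fun y => _) = (fun x => d x * ind c x))//; apply/funext => x; rewrite add0r.
have d0 c : 0 <= c -> cintegral (fun x => d x * ind c x) = 0.
  move=> c0.
  have int f : cintegrable (fun x => (f : Linf0 w) x * ind c x).
    have := (conv_boundf f (L1_ind c) (lexx 0)).1.
    by rewrite (_ : (fun y => _) = (fun x => f x * ind c x))//; apply/funext => x; rewrite add0r.
  have : cintegral (fun x => d x * ind c x) = (-1) * cintegral (fun x => g' x * ind c x) + cintegral (fun x => g x * ind c x).
    rewrite -cintegralZD//; have [mi _] := L1_ind c; apply: ae_eq_cintegral.
    - by apply: cmeasurableM => //; exact: Linf0_cmeas.
    - by apply: cmeasurableZD; apply: cmeasurableM => //; exact: Linf0_cmeas.
    - have := aeHI (Linf0DE (- g') g) (Linf0ZE (-1) g'); rewrite scaleN1r addrC.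
      by apply: aeHS => x x0 [-> ->]; rewrite mulrDl mulrA.
  by rewrite gg'// mulN1r addNr.
have dRe c x : complex.Re (d x * ind c x) = ((fun x => complex.Re (d x)) \_ `[0, c]) x.
  by rewrite /ind patchE indicE; case: (d x) => a b; case: (_ \in _); rewrite /= !(mulr1, mulr0) ?subr0.
have dIm c x : complex.Im (d x * ind c x) = ((fun x => complex.Im (d x)) \_ `[0, c]) x.
  by rewrite /ind patchE indicE; case: (d x) => a b; case: (_ \in _); rewrite /= !(mulr1, mulr0) ?add0r.
have [mR mIm] := Linf0_cmeas d.
have HI c : H `&` `[0, c] = `[0, c]%classic by apply/setIidPr.
have R0 : aeH (fun x => complex.Re (d x) = 0).
  apply: ae_eq0_of_integrals => // c c0.
    have [j1 _] := dint c.
    apply: eq_integrable (integrableS measurable_halfline (mI c) (IH (c := c)) j1) => // x xc.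
    by rewrite /comp dRe patchE xc.
  have [j1 _] := d0 c c0; rewrite -(HI c) Rintegral_mkcondr -[RHS]j1.
  by apply: eq_Rintegral => x _; rewrite dRe.
have I0 : aeH (fun x => complex.Im (d x) = 0).
  apply: ae_eq0_of_integrals => // c c0.
    have [_ j1] := dint c.
    apply: eq_integrable (integrableS measurable_halfline (mI c) (IH (c := c)) j1) => // x xc.
    by rewrite /comp dIm patchE xc.
  have [_ j1] := d0 c c0; rewrite -(HI c) Rintegral_mkcondr -[RHS]j1.
  by apply: eq_Rintegral => x _; rewrite dIm.
have := aeHI (aeHI R0 I0) (Linf00E w); apply: aeHS => x x0 [[r0 i0] ->].
by rewrite (complex_split (d x)) r0 i0 addr0.
Qed.

End indicator.

Section dual_action.
Context {R : realType} (w : weight R).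
Implicit Types (f g : Linf0 w) (n m : Linf0_dual w) (phi : R -> R[i]).
Local Notation H := (halfline R).
Local Notation toC p := (fun x => ((p : R -> R) x)%:C).

(** An explicit bound is carried along instead of the supremum [dual_norm]. *)
Definition bounded_by n (K : R) := forall f, normc (n f) <= K * Linf0_norm f.

Lemma dual_linear n a f g : n (a *: f + g) = a * n f + n g.
Proof. by have := dual_funP n; rewrite inE/= => -[lin _]; exact: lin. Qed.

Lemma dualD n f g : n (f + g) = n f + n g.
Proof. by have := dual_linear n 1 f g; rewrite scale1r mul1r. Qed.

Lemma dual0 n : n 0 = 0.
Proof. by have := dualD n 0 0; rewrite addr0 => /eqP; rewrite -subr_eq0 opprD addrA subrr sub0r oppr_eq0 => /eqP. Qed.

Lemma dualZ n a f : n (a *: f) = a * n f.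
Proof. by have := dual_linear n a f 0; rewrite !addr0 dual0 addr0. Qed.

Lemma dual_bounded n : exists2 K, 0 <= K & bounded_by n K.
Proof.
have := dual_funP n; rewrite inE/= => -[_ [M nM]].
exists (Num.max M 0); first by rewrite le_max lexx orbT.
move=> f; apply: le_trans (nM f) _; rewrite ler_wpM2r ?Linf0_norm_ge0//.
by rewrite le_max lexx.
Qed.

Lemma mk_dual (F : Linf0 w -> R[i]) (K : R) :
  (forall a f g, F (a *: f + g) = a * F f + F g) ->
  (forall f, normc (F f) <= K * Linf0_norm f) ->
  exists n : Linf0_dual w, forall f, n f = F f.
Proof.
move=> Fl FK; have FP : F \in @bounded_functional R w.
  by rewrite inE/=; split; [exact: Fl|exists K].
by exists (MkDual FP).
Qed.

Lemma eq_dual m n : (forall f, m f = n f) -> m = n.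
Proof. by move=> mn; apply: val_inj; exact/funext. Qed.

(** On real p, the real and imaginary parts of <n, f p> are represented by two real functions, which
    together form g. Tail estimates for f become tail estimates for g, so g stays in L_0^oo(w). In 4
    K, one factor 2 comes from [transl_conv_norm] and the other from adding the two parts. *)
Lemma dual_act_exists n f K : 0 <= K -> bounded_by n K ->
  exists2 g : Linf0 w, (forall phi, L1 w phi -> cintegral (fun x => g x * phi x) = n (transl_conv f phi)) &
    Linf0_norm g <= 4 * K * Linf0_norm f.
Proof.
move=> K0 nK.
pose Gr (p : R -> R) := complex.Re (n (transl_conv f (toC p))).
pose Gi (p : R -> R) := complex.Im (n (transl_conv f (toC p))).
have lin a p q : L1 w (toC p) -> L1 w (toC q) ->
   n (transl_conv f (toC (fun x => a * p x + q x))) =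
   a%:C * n (transl_conv f (toC p)) + n (transl_conv f (toC q)).
  move=> Lp Lq; rewrite -dual_linear -(transl_convZDr a%:C f Lp Lq); congr (n (transl_conv f _)).
  by apply/funext => x; rewrite rmorphD rmorphM.
have bd X c p : 0 <= c -> aeH (fun x => X < x -> normc (f x) <= c * w x) -> L1 w (toC p) ->
    (forall y, 0 <= y -> y <= X -> p y = 0) ->
    normc (n (transl_conv f (toC p))) <= 2 * K * c * wnorm w (toC p).
  move=> c0 hc Lp pX; apply: le_trans (nK _) _.
  rewrite (mulrC 2) -!mulrA ler_wpM2l//.
  by apply: (transl_conv_norm Lp c0 hc) => y y0 yX; rewrite pX.
have bd0 p : L1 w (toC p) -> normc (n (transl_conv f (toC p))) <= 2 * K * Linf0_norm f * wnorm w (toC p).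
  move=> Lp; apply: (bd (-1)) => //; first exact: Linf0_norm_ge0.
    by apply: aeHS (Linf0_norm_ae f) => x x0 + _.
  by move=> y y0 y1; have := le_trans y0 y1; rewrite ler0N1.
have KK : 0 <= 2 * K * Linf0_norm f by rewrite !mulr_ge0 ?Linf0_norm_ge0.
have [|p Lp|gr [mgr rgr bgr]] := @real_dual_repr R w Gr _ KK.
- by move=> a p q Lp Lq; rewrite /Gr (lin a p q Lp Lq) complex_ReZD.
- by apply: le_trans (bd0 _ Lp); exact: normc_ge_absRe.
have [|p Lp|gi [mgi rgi bgi]] := @real_dual_repr R w Gi _ KK.
- by move=> a p q Lp Lq; rewrite /Gi (lin a p q Lp Lq) complex_ImZD.
- by apply: le_trans (bd0 _ Lp); exact: normc_ge_absIm.
pose g x : R[i] := gr x +i* gi x.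
have gbound X c : 0 <= c -> aeH (fun x => X < x -> normc (f x) <= c * w x) ->
    aeH (fun x => X < x -> normc (g x) <= 4 * K * c * w x).
  move=> c0 hc; have c0' : 0 <= 2 * K * c by rewrite !mulr_ge0.
  have h1 := bgr X _ c0' (fun p Lp pX => le_trans (normc_ge_absRe _) (bd X c p c0 hc Lp pX)).
  have h2 := bgi X _ c0' (fun p Lp pX => le_trans (normc_ge_absIm _) (bd X c p c0 hc Lp pX)).
  apply: aeHS (aeHI h1 h2) => x x0 [b1 b2] Xx; have a1 := b1 Xx; have a2 := b2 Xx.
  apply: le_trans (normc_le _) _; apply: le_trans (lerD a1 a2) _.
  by rewrite le_eqVlt; apply/orP; left; apply/eqP; ring.
have gbound0 : aeH (fun x => normc (g x) <= 4 * K * Linf0_norm f * w x).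
  have := @gbound (-1) _ (Linf0_norm_ge0 f).
  move=> /(_ (aeHS (fun x x0 h _ => h) (Linf0_norm_ae f))).
  by apply: aeHS => x x0; apply; apply: lt_le_trans x0; rewrite ltrN10.
have gL0 : g \in L0 w.
  apply/L0P; split; [by split|by exists (4 * K * Linf0_norm f)|].
  move=> e e0; have d0 : 0 < 4 * K + 1 by lra.
  have [X X0 hX] := Linf0_tail f (divr_gt0 e0 d0).
  exists X => //; have := gbound X _ (ltW (divr_gt0 e0 d0)) hX.
  apply: aeHS => x x0 /[apply] h; apply: le_trans h _; rewrite ler_wpM2r ?weight_ge0//.
  by rewrite mulrCA ler_piMr ?(ltW e0)// ler_pdivrMr// mul1r lerDl.
exists (cl w g); last first.
  by apply: Linf0_norm_le; apply: aeHS (aeHI (clE gL0) gbound0) => x x0 [->].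
move=> phi Lphi.
have [mphi iphi] := (L1P w phi).1 Lphi.
have Lre : L1 w (toC (fun x => complex.Re (phi x))).
  have [||] // := @L1_dom R w (toC (fun x => complex.Re (phi x))) _ _ iphi.
    by apply: cmeasurable_real; case: mphi.
  by move=> x x0; rewrite normc_real ler_wpM2l ?weight_ge0 ?normc_ge_absRe.
have Lim : L1 w (toC (fun x => complex.Im (phi x))).
  have [||] // := @L1_dom R w (toC (fun x => complex.Im (phi x))) _ _ iphi.
    by apply: cmeasurable_real; case: mphi.
  by move=> x x0; rewrite normc_real ler_wpM2l ?weight_ge0 ?normc_ge_absIm.
(* The shape a p + q matches [transl_convZDr], which reduces complex phi to the two real cases. *)
have -> : phi = fun x => 'i%C * (complex.Im (phi x))%:C + (complex.Re (phi x))%:C.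
  by apply/funext => x; case: (phi x) => a b; apply/eqP; rewrite eq_complex/=; apply/andP; split; apply/eqP; ring.
have [i1 e1] := rgr _ Lre; have [i2 e2] := rgr _ Lim.
have [i3 e3] := rgi _ Lre; have [i4 e4] := rgi _ Lim.
have Er : n (transl_conv f (toC (fun x => complex.Re (phi x)))) =
    (\int[mu R]_(x in H) (gr x * complex.Re (phi x))) +i* (\int[mu R]_(x in H) (gi x * complex.Re (phi x))).
  by rewrite -e1 -e3 /Gr /Gi; case: (n _).
have Ei : n (transl_conv f (toC (fun x => complex.Im (phi x)))) =
    (\int[mu R]_(x in H) (gr x * complex.Im (phi x))) +i* (\int[mu R]_(x in H) (gi x * complex.Im (phi x))).
  by rewrite -e2 -e4 /Gr /Gi; case: (n _).
rewrite (transl_convZDr 'i%C f Lim Lre) dual_linear Er Ei.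
transitivity (cintegral (fun x => g x * ('i%C * (complex.Im (phi x))%:C + (complex.Re (phi x))%:C))).
  apply: ae_eq_cintegral; last by apply: aeHS (clE gL0) => x x0 ->.
  - by apply: cmeasurableM; [exact: Linf0_cmeas|have [] := L1ZD 'i%C Lim Lre].
  - by apply: cmeasurableM; [split|have [] := L1ZD 'i%C Lim Lre].
rewrite /cintegral.
have -> : \int[mu R]_(x in H) complex.Re (g x * ('i%C * (complex.Im (phi x))%:C + (complex.Re (phi x))%:C)) =
  \int[mu R]_(x in H) (gr x * complex.Re (phi x)) - \int[mu R]_(x in H) (gi x * complex.Im (phi x)).
  by rewrite -RintegralB//; apply: eq_Rintegral => x _ /=; ring.
have -> : \int[mu R]_(x in H) complex.Im (g x * ('i%C * (complex.Im (phi x))%:C + (complex.Re (phi x))%:C)) =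
  \int[mu R]_(x in H) (gr x * complex.Im (phi x)) + \int[mu R]_(x in H) (gi x * complex.Re (phi x)).
  by rewrite -RintegralD//; apply: eq_Rintegral => x _ /=; ring.
by apply/eqP; rewrite eq_complex/=; apply/andP; split; apply/eqP; ring.
Qed.

Lemma dual_actP n f phi : L1 w phi ->
  cintegral (fun x => dual_act n f x * phi x) = n (transl_conv f phi).
Proof.
move=> Lp; rewrite /dual_act; set P := (X in xget 0 X).
suff : P (xget 0 P) by apply.
apply: xgetPex; have [K K0 nK] := dual_bounded n.
by have [g hg _] := dual_act_exists f K0 nK; exists g.
Qed.

Lemma dual_act_eq n f g :
  (forall c, 0 <= c -> cintegral (fun x => g x * ind c x) = n (transl_conv f (ind c))) ->
  dual_act n f = g.
Proof.
move=> hg; apply: Linf0_ext => c c0.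
by rewrite hg// dual_actP//; exact: L1_ind.
Qed.

Lemma dual_act_norm n f K : 0 <= K -> bounded_by n K ->
  Linf0_norm (dual_act n f) <= 4 * K * Linf0_norm f.
Proof.
move=> K0 nK; have [g hg gn] := dual_act_exists f K0 nK.
rewrite (@dual_act_eq n f g)// => c c0; apply: hg; exact: L1_ind.
Qed.

End dual_action.

(** * The product and translations *)

(* Otherwise unification unfolds the quotients behind these definitions. *)
Local Opaque dual_act transl_conv.

Section arens_algebra.
Context {R : realType} (w : weight R).
Implicit Types (f g : Linf0 w) (m n : Linf0_dual w).

Lemma pairing_int f phi : L1 w phi -> cintegrable (fun x => f x * phi x).
Proof.
move=> Lp; have := (conv_boundf f Lp (lexx 0)).1.
by rewrite (_ : (fun y => _) = (fun x => f x * phi x))//; apply/funext => x; rewrite add0r.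
Qed.

Lemma pairingZD a f g phi : L1 w phi -> cintegral (fun x => (a *: f + g : Linf0 w) x * phi x) =
  a * cintegral (fun x => f x * phi x) + cintegral (fun x => g x * phi x).
Proof.
move=> Lp; have [mp _] := Lp.
rewrite -cintegralZD; [|exact: pairing_int|exact: pairing_int].
apply: ae_eq_cintegral.
- by apply: cmeasurableM => //; exact: Linf0_cmeas.
- by apply: cmeasurableZD; apply: cmeasurableM => //; exact: Linf0_cmeas.
- have := aeHI (Linf0DE (a *: f) g) (Linf0ZE a f).
  by apply: aeHS => x x0 [-> ->]; rewrite mulrDl mulrA.
Qed.

Lemma pairing0 phi : L1 w phi -> cintegral (fun x => (0 : Linf0 w) x * phi x) = 0.
Proof.
by move=> Lp; have := pairingZD (-1) 0 0 Lp; rewrite addr0 scaler0 => ->; rewrite mulN1r addNr.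
Qed.

Lemma pairingZ a f phi : L1 w phi ->
  cintegral (fun x => (a *: f : Linf0 w) x * phi x) = a * cintegral (fun x => f x * phi x).
Proof. by move=> Lp; have := pairingZD a f 0 Lp; rewrite addr0 (pairing0 Lp) addr0. Qed.

Lemma dual_actZDr n a f g : dual_act n (a *: f + g) = a *: dual_act n f + dual_act n g.
Proof.
apply: dual_act_eq => c c0; have L := L1_ind w c.
have E1 := pairingZD a (dual_act n f) (dual_act n g) L.
have E2 := dual_linear n a (transl_conv f (ind c)) (transl_conv g (ind c)).
have E3 := transl_convZDl a f g L.
by apply: (etrans E1); rewrite E3 E2; congr (_ * _ + _); exact: dual_actP.
Qed.

(** Meant for g a truncation of f on which n acts as 0, so that only the small remainder h
    counts. *)
Lemma dual_act_mod n f g h : f = h + g -> dual_act n g = 0 -> dual_act n f = dual_act n h.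
Proof.
move=> -> g0; have := dual_actZDr n 1 h g.
by rewrite !scale1r => E; apply: (etrans E); rewrite g0 addr0.
Qed.

Lemma arensE m n f : arens m n f = m (dual_act n f).
Proof.
have [M M0 mM] := dual_bounded m; have [N N0 nN] := dual_bounded n.
have [||p hp] := @mk_dual R w (fun f => m (dual_act n f)) (M * (4 * N)).
- by move=> a g h; rewrite dual_actZDr dual_linear.
- move=> h; apply: le_trans (mM _) _; rewrite -mulrA ler_wpM2l//.
  exact: dual_act_norm.
rewrite /arens; set P := (X in xget 0 X).
suff : P (xget 0 P) by apply.
by apply: xgetPex; exists p.
Qed.

Lemma arens_bounded m n M N : 0 <= M -> 0 <= N -> bounded_by m M -> bounded_by n N ->
  bounded_by (arens m n) (4 * M * N).
Proof.
move=> M0 N0 mM nN f; rewrite arensE; apply: le_trans (mM _) _.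
rewrite (_ : 4 * M * N * _ = M * (4 * N * Linf0_norm f)); last by ring.
by rewrite ler_wpM2l// dual_act_norm.
Qed.

End arens_algebra.

Section weight_bound.
Context {R : realType} (w : weight R).

Lemma weight_bounded (L : R) : exists2 W, 1 <= W & forall x, 0 <= x -> x <= L -> w x <= W.
Proof.
have [L0|L0] := ltP L 0.
  by exists 1 => // x x0 xL; have := le_lt_trans (le_trans x0 xL) L0; rewrite ltxx.
have [] := @EVT_max R w 0 L L0.
  apply: continuous_subspaceW (@weight_continuous _ w).
  by move=> x /=; rewrite halflineE in_itv/= => /andP[].
move=> c; rewrite in_itv/= => /andP[c0 _] h; exists (w c); first exact: weight_ge1.
by move=> x x0 xL; apply: h; rewrite in_itv/= x0.
Qed.

End weight_bound.

Section shifts.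
Context {R : realType} (w : weight R).
Implicit Types (f g : Linf0 w) (t s : R).

Definition shiftl t f : Linf0 w := cl w (fun x => f (t + x)).

Lemma shiftl_L0 t f : 0 <= t -> (fun x => f (t + x)) \in L0 w.
Proof.
move=> t0; apply/L0P; split.
- exact: cmeasurable_shift t0 (Linf0_cmeas f).
- exists (Linf0_norm f * w t).
  apply: aeHS (aeH_shift t0 (Linf0_norm_ae f)) => x x0 h; apply: le_trans h _.
  by rewrite -mulrA ler_wpM2l ?Linf0_norm_ge0 ?weightD.
- move=> e e0; have wt := weight_gt0 w t0.
  have [X X0 hX] := Linf0_tail f (divr_gt0 e0 wt).
  exists X => //; apply: aeHS (aeH_shift t0 hX) => x x0 h Xx.
  apply: le_trans (h _) _; first by rewrite (lt_le_trans Xx)// lerDr.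
  rewrite mulrAC ler_pdivrMr// -mulrA ler_wpM2l ?(ltW e0)// (mulrC (w x)).
  exact: weightD.
Qed.

Lemma shiftlE t f : 0 <= t -> aeH (fun x => shiftl t f x = f (t + x)).
Proof. by move=> t0; apply: clE; exact: shiftl_L0. Qed.

Lemma shiftl_norm t f : 0 <= t -> Linf0_norm (shiftl t f) <= w t * Linf0_norm f.
Proof.
move=> t0; apply: Linf0_norm_le.
apply: aeHS (aeHI (shiftlE f t0) (aeH_shift t0 (Linf0_norm_ae f))) => x x0 [-> h].
by apply: le_trans h _; rewrite (mulrC (w t)) -mulrA ler_wpM2l ?Linf0_norm_ge0 ?weightD.
Qed.

Lemma shiftlZD t a f g : 0 <= t -> shiftl t (a *: f + g) = a *: shiftl t f + shiftl t g.
Proof.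
move=> t0; apply: eq_Linf0.
have := aeHI (aeHI (shiftlE (a *: f + g) t0) (aeHI (shiftlE f t0) (shiftlE g t0)))
  (aeHI (aeHI (Linf0DE (a *: shiftl t f) (shiftl t g)) (Linf0ZE a (shiftl t f)))
   (aeH_shift t0 (aeHI (Linf0DE (a *: f) g) (Linf0ZE a f)))).
by apply: aeHS => x x0 [[-> [e1 e2]] [[-> ->] [-> ->]]]; rewrite e1 e2.
Qed.

Lemma shiftlZ t a f : 0 <= t -> shiftl t (a *: f) = a *: shiftl t f.
Proof.
move=> t0; have z : shiftl t 0 = 0 :> Linf0 w.
  by have := shiftlZD (-1) 0 0 t0; rewrite scaler0 addr0 => ->; rewrite scaleN1r addNr.
by have := shiftlZD a f 0 t0; rewrite z !addr0.
Qed.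

Lemma shiftl_add t s f : 0 <= t -> 0 <= s -> shiftl t (shiftl s f) = shiftl (t + s) f.
Proof.
move=> t0 s0; apply: eq_Linf0.
have := aeHI (shiftlE (shiftl s f) t0) (aeHI (shiftlE f (addr_ge0 t0 s0))
  (aeH_shift t0 (shiftlE f s0))).
by apply: aeHS => x x0 [-> [-> ->]]; rewrite addrA (addrC s).
Qed.

Lemma shiftl0 f : shiftl 0 f = f.
Proof. by apply: eq_Linf0; apply: aeHS (shiftlE f (lexx 0)) => x x0 ->; rewrite add0r. Qed.

Definition supported s f := aeH (fun x => s < x -> f x = 0).

Definition shiftr t f : Linf0 w := cl w (fun x => if t <= x then f (x - t) else 0).

(** Submultiplicativity bounds w (t + x) from above by w t w x but gives no bound of w (x - t) by w
    x, so translation to the right may leave the space. For f supported in [0, s], the maximum of w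
    on [0, s] together with w >= 1 replaces the missing bound. *)
Lemma shiftrE t s f : 0 <= t -> 0 <= s -> supported s f ->
  aeH (fun x => shiftr t f x = if t <= x then f (x - t) else 0).
Proof.
move=> t0 s0 sf; apply: clE; apply/L0P.
have ae_back P : aeH P -> aeH (fun x => t <= x -> P (x - t)).
  rewrite /aeH => /(ae_shift (- t)); apply: filterS => x h x0 tx.
  by apply: h; rewrite subr_ge0.
have [mR mI] := Linf0_cmeas f.
have mt (k : R -> R) : measurable_fun (halfline R) k ->
    measurable_fun (halfline R) (fun x => if t <= x then k (x - t) else 0).
  move=> mk; have mk' : measurable_fun [set: measurableTypeR R] (k \_ (halfline R)).
    by apply/measurable_restrict => //; rewrite setTI.
  rewrite (_ : (fun x => _) = (k \_ (halfline R)) \o (fun x : R => x + - t)).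
    by apply: measurable_funTS; apply: (measurableT_comp mk'); exact: measurable_shift.
  apply/funext => x; rewrite /= patchE; case: ifPn => tx.
    by rewrite mem_set// halflineE subr_ge0.
  by rewrite memNset// halflineE subr_ge0 => tx'; rewrite tx' in tx.
have [W W1 hW] := weight_bounded w s.
split.
- split.
    rewrite (_ : (fun x => _) = (fun x => if t <= x then complex.Re (f (x - t)) else 0)); first exact: (mt _ mR).
    by apply/funext => x; case: ifP.
  rewrite (_ : (fun x => _) = (fun x => if t <= x then complex.Im (f (x - t)) else 0)); first exact: (mt _ mI).
  by apply/funext => x; case: ifP.
- exists (Linf0_norm f * W).
  apply: aeHS (ae_back _ (aeHI (Linf0_norm_ae f) sf)) => x x0 h.
  case: ifPn => tx; last by rewrite normc0 !mulr_ge0 ?Linf0_norm_ge0 ?weight_ge0// (le_trans ler01).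
  have [h1 h2] := h tx; have [sx|xs] := ltP s (x - t).
    by rewrite h2// normc0 !mulr_ge0 ?Linf0_norm_ge0 ?weight_ge0// (le_trans ler01).
  apply: le_trans h1 _; rewrite -mulrA ler_wpM2l ?Linf0_norm_ge0//.
  apply: (@le_trans _ _ W); first by apply: hW => //; rewrite subr_ge0.
  by rewrite ler_peMr ?weight_ge1// (le_trans ler01).
- move=> e e0; exists (s + t); first by rewrite addr_ge0.
  apply: aeHS (ae_back _ sf) => x x0 h stx.
  have tx : t <= x by apply: le_trans (ltW stx); rewrite lerDr.
  rewrite tx h// ?normc0 ?mulr_ge0 ?weight_ge0 ?(ltW e0)//.
  by rewrite ltrBrDr.
Qed.

Lemma shiftl_shiftr t s f : 0 <= t -> 0 <= s -> supported s f -> shiftl t (shiftr t f) = f.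
Proof.
move=> t0 s0 sf; apply: eq_Linf0.
have := aeHI (shiftlE (shiftr t f) t0) (aeH_shift t0 (shiftrE t0 s0 sf)).
by apply: aeHS => x x0 [-> ->]; rewrite lerDl x0 addrAC subrr add0r.
Qed.

Lemma shiftl_supported s f : 0 <= s -> supported s f -> shiftl s f = 0.
Proof.
move=> s0 sf; apply: eq_Linf0.
(* At x = 0 the translate reads f at s itself, about which the support condition says nothing; that
   point is discarded as a null set. *)
have x0n : aeH (fun x : R => x != 0).
  exists [set 0]; split; [exact: measurable_set1|exact: lebesgue_measure_set1|].
  by move=> x /= /not_implyP[_ /negP]; rewrite negbK => /eqP.
have := aeHI x0n (aeHI (Linf00E w) (aeHI (shiftlE f s0) (aeH_shift s0 sf))).
apply: aeHS => x x0 [xn0 [-> [-> ->]]] //.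
by rewrite ltrDl lt_def xn0.
Qed.

Definition trunc s f : Linf0 w := cl w (fun x => if x <= s then f x else 0).

Lemma truncE s f : aeH (fun x => trunc s f x = if x <= s then f x else 0).
Proof.
apply: clE; apply/L0P; have [mR mI] := Linf0_cmeas f.
have mt (k : R -> R) : measurable_fun (halfline R) k ->
    measurable_fun (halfline R) (fun x => if x <= s then k x else 0).
  move=> mk; rewrite (_ : (fun x => _) = (fun x => k x * \1_`]-oo, s]%classic x)).
    apply: measurable_funM; first exact: mk.
    by apply: measurable_funTS; apply: measurable_indic; exact: measurable_itv.
  apply/funext => x; rewrite indicE; case: ifPn => xs.
    by rewrite mem_set ?mulr1//= in_itv.
  by rewrite memNset ?mulr0//= in_itv/= => xs'; rewrite xs' in xs.
split.
- split.
    rewrite (_ : (fun x => _) = (fun x => if x <= s then complex.Re (f x) else 0)); first exact: (mt _ mR).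
    by apply/funext => x; case: ifP.
  rewrite (_ : (fun x => _) = (fun x => if x <= s then complex.Im (f x) else 0)); first exact: (mt _ mI).
  by apply/funext => x; case: ifP.
- exists (Linf0_norm f); apply: aeHS (Linf0_norm_ae f) => x x0 h.
  by case: ifP => // _; rewrite normc0 mulr_ge0 ?weight_ge0 ?Linf0_norm_ge0.
- move=> e e0; have [X X0 hX] := Linf0_tail f e0; exists X => //.
  apply: aeHS hX => x x0 h Xx; case: ifP => _; first exact: h.
  by rewrite normc0 mulr_ge0 ?weight_ge0 ?(ltW e0).
Qed.

Lemma trunc_supported s f : supported s (trunc s f).
Proof. by apply: aeHS (truncE s f) => x x0 -> sx; rewrite leNgt sx. Qed.

Lemma trunc_norm s f : Linf0_norm (trunc s f) <= Linf0_norm f.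
Proof.
apply: Linf0_norm_le; apply: aeHS (aeHI (truncE s f) (Linf0_norm_ae f)) => x x0 [-> h].
by case: ifP => // _; rewrite normc0 mulr_ge0 ?weight_ge0 ?Linf0_norm_ge0.
Qed.

Lemma trunc_approx f e : 0 < e -> exists2 s, 0 <= s & Linf0_norm (f - trunc s f) <= e.
Proof.
move=> e0; have [s s0 hs] := Linf0_tail f e0; exists s => //.
apply: Linf0_norm_le.
have := aeHI hs (aeHI (truncE s f) (aeHI (Linf0DE f (- trunc s f)) (Linf0ZE (-1) (trunc s f)))).
rewrite scaleN1r; apply: aeHS => x x0 [h [t [-> ->]]]; rewrite t mulN1r.
case: (leP x s) => xs; first by rewrite subrr normc0 mulr_ge0 ?weight_ge0 ?(ltW e0).
by rewrite subr0 h.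
Qed.

End shifts.

(** * Right identities *)

Local Opaque arens.

Section interval_averages.
Context {R : realType} (w : weight R).
Implicit Types (f g : Linf0 w).
Local Notation H := (halfline R).
Local Notation integrableH f := ((mu R).-integrable H (EFin \o (f : R -> R))).

Let mI (a b : R) : measurable (`[a, b]%classic : set (measurableTypeR R)).
Proof. exact: measurable_itv. Qed.

Let subH (a b : R) : 0 <= a -> `[a, b]%classic `<=` H.
Proof. by move=> a0 x /=; rewrite halflineE in_itv/= => /andP[/(le_trans a0)]. Qed.

Lemma Rintegral_itvH (k : R -> R) (a b : R) : 0 <= a ->
  \int[mu R]_(x in H) (k x * \1_`[a, b]%classic x) = \int[mu R]_(x in `[a, b]) k x.
Proof.
move=> a0; have -> : `[a, b]%classic = H `&` `[a, b]%classic by apply/esym/setIidPr/subH.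
rewrite Rintegral_mkcondr; apply: eq_Rintegral => x; rewrite inE => xH.
rewrite patchE indicE setIidr; last exact: subH.
by case: (_ \in _); rewrite ?mulr1// mulr0.
Qed.

Lemma integrable_indicH (a b : R) : 0 <= a -> a <= b ->
  integrableH (fun x => \1_`[a, b]%classic x) /\
  \int[mu R]_(x in H) \1_`[a, b]%classic x = b - a.
Proof.
move=> a0 ab; split.
  exact: (integrableS measurableT measurable_halfline (@subsetT _ _) (@integrable_indic_itv R a b true false)).
transitivity (\int[mu R]_(x in H) (cst 1 x * \1_`[a, b]%classic x)).
  by apply: eq_Rintegral => x _; rewrite mul1r.
rewrite Rintegral_itvH// (Rintegral_cst (mu R) (mI a b)).
rewrite mul1r [X in fine X](@lebesgue_measure_itv R `[a, b])/= lte_fin.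
by case: ltP => //= ba; apply/eqP; rewrite eq_sym subr_eq0 eq_le ab ba.
Qed.

Lemma Rintegral_ind_shift (k : R -> R) (x c : R) : 0 <= x -> measurable_fun H k ->
  \int[mu R]_(y in H) (k (x + y) * \1_`[0, c]%classic y) =
  \int[mu R]_(y in H) (k y * \1_`[x, (x + c)]%classic y).
Proof.
move=> x0 mk; rewrite Rintegral_itvH// Rintegral_itvH//.
have mk' := measurable_funS measurable_halfline (subH (b := x + c) x0) mk.
rewrite (Rintegral_shift x (mI x (x + c)) mk').
rewrite (_ : [set y | `[x, (x + c)]%classic (y + x)] = `[0, c]%classic).
  by apply: eq_Rintegral => y _; rewrite addrC.
by apply/seteqP; split => y /=; rewrite !in_itv/= [y + x]addrC lerDl lerD2l.
Qed.

Definition indI (a b : R) (x : R) : R[i] := (\1_`[a, b]%classic x)%:C.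

Lemma L1_indI a b : 0 <= a -> L1 w (indI a b).
Proof.
move=> a0; have m1 : measurable_fun H (\1_`[a, b]%classic : R -> R).
  by apply: measurable_funTS; exact: measurable_indic.
apply: (@L1r_dom R w (\1_`[a, b]%classic : R -> R) _ m1 (L1_ind w b) _).1 => x x0.
rewrite ger0_norm// !indicE.
have [xab|_] := boolP (x \in `[a, b]%classic); last by rewrite ler0n.
rewrite mem_set//=; move: xab; rewrite inE/= !in_itv/= => /andP[_ ->].
by rewrite x0.
Qed.

(** The dependence on x is moved from f, which is merely measurable, to a sliding window
    [x, x + c]. *)
Lemma conv_indE f (c x : R) : 0 <= x ->
  tconv f (ind c) x = cintegral (fun y => f y * indI x (x + c) y).
Proof.
move=> x0; have [mR mI'] := Linf0_cmeas f; rewrite /tconv /cintegral; congr Complex.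
  transitivity (\int[mu R]_(y in H) (complex.Re (f (x + y)) * \1_`[0, c]%classic y)).
    by apply: eq_Rintegral => y _; rewrite /ind; case: (f _) => a b /=; rewrite mulr0 subr0.
  rewrite (Rintegral_ind_shift c x0 mR).
  by apply: eq_Rintegral => y _; rewrite /indI; case: (f _) => a b /=; rewrite mulr0 subr0.
transitivity (\int[mu R]_(y in H) (complex.Im (f (x + y)) * \1_`[0, c]%classic y)).
  by apply: eq_Rintegral => y _; rewrite /ind; case: (f _) => a b /=; rewrite mulr0 add0r.
rewrite (Rintegral_ind_shift c x0 mI').
by apply: eq_Rintegral => y _; rewrite /indI; case: (f _) => a b /=; rewrite mulr0 add0r.
Qed.

Let indic_diff (x x' c y : R) : x <= x' ->
  `|\1_`[x', (x' + c)]%classic y - \1_`[x, (x + c)]%classic y| <=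
  \1_`[x, x']%classic y + \1_`[(x + c), (x' + c)]%classic y :> R.
Proof.
move=> xx'; rewrite !indicE !mem_setE !in_itv/=.
case: (leP x y) => h1; case: (leP x' y) => h2; case: (leP y (x + c)) => h3;
  case: (leP y (x' + c)) => h4; case: (leP (x + c) y) => h5; case: (leP y x') => h6;
  rewrite /= ?subrr ?normr0 ?subr0 ?sub0r ?normrN ?normr1 ?addr0 ?add0r ?ler0n//; lra.
Qed.

(** Sliding the window from x to x' alters it only on two intervals of length x' - x, where f is
    bounded. So f 1_[0,c] is locally Lipschitz whatever the regularity of f. *)
Lemma conv_ind_lipschitz f (c L : R) : 0 <= c -> exists2 C, 0 <= C &
  forall x x', 0 <= x -> x <= x' -> x' <= L ->
    normc (tconv f (ind c) x' - tconv f (ind c) x) <= C * (x' - x).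
Proof.
(* For x' <= L all windows lie in [0, L + c]. *)
move=> c0; have [W W1 hW] := weight_bounded w (L + c).
have W0 : 0 <= W by exact: le_trans ler01 W1.
exists (4 * (Linf0_norm f * W)); first by rewrite !mulr_ge0 ?Linf0_norm_ge0.
move=> x x' x0 xx' x'L; have x'0 := le_trans x0 xx'.
rewrite !conv_indE//.
have i1 := pairing_int f (L1_indI (x' + c) x'0).
have i2 := pairing_int f (L1_indI (x + c) x0).
rewrite addrC -mulN1r -cintegralZD//.
pose d y : R := \1_`[x', (x' + c)]%classic y - \1_`[x, (x + c)]%classic y.
have [j1 e1] := integrable_indicH x0 xx'.
have [|j2 e2] := @integrable_indicH (x + c) (x' + c) (addr_ge0 x0 c0); first by rewrite lerD2r.
have jj := integrableHD j1 j2.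
have [||||_] := @cintegrable_dom R (fun y => -1 * (f y * indI x (x + c) y) + f y * indI x' (x' + c) y)
  (fun y => (Linf0_norm f * W) * (\1_`[x, x']%classic y + \1_`[(x + c), (x' + c)]%classic y)).
- have [m1 _] := L1_indI (x + c) x0; have [m2 _] := L1_indI (x' + c) x'0.
  by apply: cmeasurableZD; apply: cmeasurableM => //; exact: Linf0_cmeas.
- exact: integrableHZ.
- by move=> y y0; rewrite !mulr_ge0 ?Linf0_norm_ge0// addr_ge0.
- apply: aeHS (Linf0_norm_ae f) => y y0 hf.
  rewrite (_ : _ + _ = f y * (d y)%:C); last by rewrite /d rmorphB/= /indI; ring.
  rewrite normcM normc_real; have hd := @indic_diff x x' c y xx'.
  have [yL|Ly] := leP y (L + c).
    apply: ler_pM => //; first exact: normc_ge0.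
    by apply: le_trans hf _; rewrite ler_wpM2l ?Linf0_norm_ge0// hW.
  rewrite (_ : d y = 0); first by rewrite normr0 mulr0 !mulr_ge0 ?Linf0_norm_ge0// addr_ge0.
  rewrite /d !indicE !memNset ?subrr//= in_itv/= => /andP[_ yy].
    by have := lt_le_trans Ly (le_trans yy (lerD (le_trans xx' x'L) (lexx c))); rewrite ltxx.
  by have := lt_le_trans Ly (le_trans yy (lerD x'L (lexx c))); rewrite ltxx.
move=> h; apply: le_trans h _.
rewrite RintegralZl// RintegralD// e1 e2.
by rewrite le_eqVlt; apply/orP; left; apply/eqP; ring.
Qed.

Lemma ultra_cvg (U : set_system nat) (v : nat -> R) (M : R) : UltraFilter U ->
  (forall j, `|v j| <= M) -> exists l : R, v j @[j --> U] --> l.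
Proof.
move=> UU vM; have PU : ProperFilter U := ultra_proper.
have cM : compact (`[- M, M]%classic : set R) by exact: segment_compact.
have [|l [_ cl]] := cM (v @ U) _.
  by apply: nearW => j /=; rewrite in_itv/= -ler_norml.
exists l => A Al; have [//|nA] := in_ultra_setVsetC (v @^-1` A) UU.
have [y [h1 h2]] := cl (~` A) A nA Al.
by case: (h1 h2).
Qed.

Let avg j f : R[i] := (j.+1%:R : R)%:C * cintegral (fun x => f x * ind ((j.+1%:R : R)^-1) x).

Let inv0 j : 0 <= (j.+1%:R : R)^-1. Proof. by rewrite invr_ge0. Qed.

Let avgZD j a f g : avg j (a *: f + g) = a * avg j f + avg j g.
Proof. by rewrite /avg (pairingZD a f g (L1_ind w _)) mulrDr mulrCA. Qed.

Let avg_dist j f (c0 : R[i]) e : 0 <= e ->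
  aeH (fun x : R => x <= (j.+1%:R : R)^-1 -> normc (f x - c0) <= e) ->
  normc (avg j f - c0) <= 2 * e.
Proof.
move=> e0 h; set c : R := (j.+1%:R : R)^-1.
have [i1 e1] := integrable_indicH (lexx 0) (inv0 j).
have ii : cintegrable (fun x => ind c x).
  by split => //=; rewrite (_ : EFin \o _ = cst 0%E)//; exact: integrable0.
have intE : cintegral (fun x => ind c x) = c%:C.
  rewrite /cintegral; congr Complex; first by rewrite e1 subr0.
  by rewrite /= (Rintegral_cst (mu R) measurable_halfline) mul0r.
have jf := pairing_int f (L1_ind w c).
have E : avg j f - c0 = (j.+1%:R : R)%:C * cintegral (fun x => (- c0) * ind c x + f x * ind c x).
  rewrite cintegralZD// intE mulrDr /avg addrC; congr (_ + _).
  rewrite mulNr mulrN mulrCA -rmorphM/= divff ?pnatr_eq0//.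
  by rewrite rmorph1 mulr1.
rewrite E normcM normc_real ger0_norm//.
have [||||_ h2] := @cintegrable_dom R (fun x => (- c0) * ind c x + f x * ind c x)
  (fun x => e * \1_`[0, c]%classic x).
- have [m1 _] := L1_ind w c; apply: cmeasurableZD => //.
  by apply: cmeasurableM => //; exact: Linf0_cmeas.
- exact: integrableHZ.
- by move=> y y0; rewrite mulr_ge0.
- apply: aeHS h => x x0 hx; rewrite -mulrDl normcM normc_real (addrC (- c0)).
  rewrite indicE; have [xc|_] := boolP (x \in `[0, c]%classic); last by rewrite normr0 !mulr0.
  rewrite normr1 !mulr1 hx//; move: xc; rewrite inE/= in_itv/= => /andP[_ ->] //.
have := ler_wpM2l (ler0n R j.+1) h2; rewrite RintegralZl// e1 subr0 => h3.
apply: le_trans h3 _; rewrite /c le_eqVlt; apply/orP; left; apply/eqP.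
have k0 : (j.+1%:R : R) != 0 by rewrite pnatr_eq0.
by move: (j.+1%:R : R) k0 => k k0; field.
Qed.

(* An ultrafilter limit of averages over [0, 1/j] is defined on the whole space
   and recovers the value at 0 wherever that value makes sense. *)
Lemma ex_value_at0 : exists u : Linf0_dual w, forall f (c0 : R[i]),
  (forall e, 0 < e -> exists2 d, 0 < d & aeH (fun x => x <= d -> normc (f x - c0) <= e)) ->
  u f = c0.
Proof.
have [U [UU oU]] := @ultraFilterLemma nat \oo _.
have PU : ProperFilter U := ultra_proper.
have [W W1 hW] := weight_bounded w 1.
have W0 : 0 <= W by exact: le_trans ler01 W1.
have bd f j : normc (avg j f) <= 2 * (Linf0_norm f * W).
  rewrite -[avg j f]subr0; apply: avg_dist; first by rewrite mulr_ge0 ?Linf0_norm_ge0.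
  apply: aeHS (Linf0_norm_ae f) => x x0 hf xj; rewrite subr0; apply: le_trans hf _.
  rewrite ler_wpM2l ?Linf0_norm_ge0// hW//; apply: le_trans xj _.
  by rewrite invf_le1// ler1n.
have cR f : exists l : R, complex.Re (avg j f) @[j --> U] --> l.
  by apply: (ultra_cvg UU) => j; apply: le_trans (bd f j); exact: normc_ge_absRe.
have cI f : exists l : R, complex.Im (avg j f) @[j --> U] --> l.
  by apply: (ultra_cvg UU) => j; apply: le_trans (bd f j); exact: normc_ge_absIm.
pose lR f := xget 0 [set l : R | complex.Re (avg j f) @[j --> U] --> l].
pose lI f := xget 0 [set l : R | complex.Im (avg j f) @[j --> U] --> l].
have hR f : complex.Re (avg j f) @[j --> U] --> lR f by exact: (xgetPex 0 (cR f)).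
have hI f : complex.Im (avg j f) @[j --> U] --> lI f by exact: (xgetPex 0 (cI f)).
have uniq (v : nat -> R) (l l' : R) : v j @[j --> U] --> l -> v j @[j --> U] --> l' -> l = l'.
  by move=> h1 h2; apply: (cvg_unique _ h1 h2); exact: norm_hausdorff.
have [||u hu] := @mk_dual R w (fun f => lR f +i* lI f) (4 * W).
- move=> [a b] f g.
  have eR : lR ((a +i* b) *: f + g) = complex.Re ((a +i* b) * (lR f +i* lI f) + (lR g +i* lI g)).
    apply: (uniq (fun j => complex.Re (avg j ((a +i* b) *: f + g)))) => //.
    rewrite (_ : (fun j => _) = fun j => a * complex.Re (avg j f) -
      b * complex.Im (avg j f) + complex.Re (avg j g)); last first.
      by apply/funext => j; rewrite avgZD; case: (avg j f) (avg j g) => ? ? [].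
    rewrite [X in _ --> X](_ : _ = a * lR f - b * lI f + lR g); last by [].
    by apply: cvgD => //; apply: cvgB; (apply: cvgM; [exact: cvg_cst|]).
  have eI : lI ((a +i* b) *: f + g) = complex.Im ((a +i* b) * (lR f +i* lI f) + (lR g +i* lI g)).
    apply: (uniq (fun j => complex.Im (avg j ((a +i* b) *: f + g)))) => //.
    rewrite (_ : (fun j => _) = fun j => a * complex.Im (avg j f) +
      b * complex.Re (avg j f) + complex.Im (avg j g)); last first.
      by apply/funext => j; rewrite avgZD; case: (avg j f) (avg j g) => ? ? [].
    rewrite [X in _ --> X](_ : _ = a * lI f + b * lR f + lI g); last by [].
    by apply: cvgD => //; apply: cvgD; (apply: cvgM; [exact: cvg_cst|]).
  by rewrite eR eI; case: (_ + _).
- move=> f; apply: le_trans (normc_le _) _ => /=.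
  have lb (v : nat -> R) (l M : R) : v j @[j --> U] --> l -> (forall j, `|v j| <= M) -> `|l| <= M.
    move=> vl vM; rewrite leNgt; apply/negP => lM.
    have e0 : 0 < `|l| - M by rewrite subr_gt0.
    move/cvgrPdist_lt : vl => /(_ _ e0)/filter_ex[j hj].
    by have := vM j; have := ler_normD (l - v j) (v j); rewrite subrK; lra.
  have b1 := lb _ _ _ (hR f) (fun j => le_trans (normc_ge_absRe _) (bd f j)).
  have b2 := lb _ _ _ (hI f) (fun j => le_trans (normc_ge_absIm _) (bd f j)).
  apply: le_trans (lerD b1 b2) _; rewrite le_eqVlt; apply/orP; left; apply/eqP; ring.
exists u => f c0 h; rewrite hu.
have near_avg e : 0 < e -> \forall j \near U, normc (avg j f - c0) <= e.
  move=> e0; have e20 : 0 < e / 2 by rewrite divr_gt0.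
  have [d d0 hd] := h _ e20.
  apply: oU; exists (Num.truncn d^-1) => // j /= dj.
  have jd : (j.+1%:R : R)^-1 <= d.
    rewrite -[leRHS]invrK lef_pV2 ?posrE ?invr_gt0// ltW//.
    by apply: lt_le_trans (truncnS_gt _) _; rewrite ler_nat ltnS.
  apply: le_trans (@avg_dist j f c0 (e / 2) (ltW e20) _) _.
    by apply: aeHS hd => x x0 hx xj; apply: hx; exact: le_trans jd.
  by rewrite mulrC divfK.
have -> : lR f = complex.Re c0.
  apply: (uniq _ _ _ (hR f)); apply/cvgrPdist_le => e e0.
  apply: filterS (near_avg e e0) => j; apply: le_trans.
  rewrite distrC; apply: le_trans (normc_ge_absRe _).
  by case: (avg j f) (c0) => ? ? [].
have -> : lI f = complex.Im c0.
  apply: (uniq _ _ _ (hI f)); apply/cvgrPdist_le => e e0.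
  apply: filterS (near_avg e e0) => j; apply: le_trans.
  rewrite distrC; apply: le_trans (normc_ge_absIm _).
  by case: (avg j f) (c0) => ? ? [].
by case: (c0).
Qed.

(** The continuous function f 1_[0,c] takes at 0 the value of the integral of f over [0, c]. A
    functional evaluating at 0 therefore pairs with f 1_[0,c] exactly as f does with 1_[0,c], which
    says that it fixes f. *)
Lemma ex_right_unit : exists u : Linf0_dual w, forall f, dual_act u f = f.
Proof.
have [u hu] := ex_value_at0; exists u => f; apply: dual_act_eq => c c0.
apply/esym/hu => e e0.
have [C C0 hC] := @conv_ind_lipschitz f c 1 c0.
have C1 : 0 < C + 1 by rewrite ltr_wpDl.
exists (Num.min 1 (e / (C + 1))); first by rewrite lt_min ltr01 divr_gt0.
have E0 : cintegral (fun x => f x * ind c x) = tconv f (ind c) 0.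
  by rewrite conv_indE// add0r.
apply: aeHS (transl_convE f (L1_ind w c)) => x x0 -> ; rewrite le_min => /andP[x1 xe].
rewrite E0; apply: le_trans (hC 0 x (lexx 0) x0 x1) _; rewrite subr0.
apply: le_trans (ler_wpM2l C0 xe) _; rewrite mulrCA ler_piMr ?(ltW e0)//.
by rewrite ler_pdivrMr// mul1r lerDl.
Qed.

End interval_averages.

(** * Characters and the right annihilator *)

Section bernstein.
Context {R : realType}.
Implicit Types (f q : nat -> R) (t : R).

(* The expectation of f under the binomial law B(n, t), by conditioning on the
   first trial; as a function of t it is a Bernstein polynomial. *)
Fixpoint bernstein n f t : R :=
  if n is n'.+1 then (1 - t) * bernstein n' f t + t * bernstein n' (fun j => f j.+1) t else f 0%N.

(** The constant term is split off because only positive powers of exp(-x) are at hand; in the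
    application f 0 = 0. *)
Lemma bernstein_poly n f : exists p : {poly R}, forall t, bernstein n f t = f 0%N + t * p.[t].
Proof.
elim: n f => [|n IH] f /=; first by exists 0 => t; rewrite horner0 mulr0 addr0.
have [p hp] := IH f; have [p' hp'] := IH (fun j => f j.+1).
exists (- (f 0%N)%:P + (1 - 'X) * p + (f 1%N)%:P + 'X * p') => t.
by rewrite hp hp' !hornerE; ring.
Qed.

Lemma bernstein_le n f q t : 0 <= t -> t <= 1 -> (forall j, (j <= n)%N -> f j <= q j) ->
  bernstein n f t <= bernstein n q t.
Proof.
move=> t0 t1; elim: n f q => [|n IH] f q fq /=; first exact: fq.
by apply: lerD; apply: ler_wpM2l => //; rewrite ?subr_ge0//; apply: IH => j jn; apply: fq => //; exact: leqW.
Qed.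

Lemma bernsteinZD n a f q t : bernstein n (fun j => a * f j + q j) t = a * bernstein n f t + bernstein n q t.
Proof. by elim: n f q => [|n IH] f q //=; rewrite !IH; ring. Qed.

Lemma bernstein_cst n (a t : R) : bernstein n (fun _ => a) t = a.
Proof. by elim: n => [|n IH] //=; rewrite !IH; ring. Qed.

(** Squared bias plus the variance n t (1 - t). The centre c is free because a success in the first
    trial replaces c by c - 1 in the induction. *)
Lemma bernstein_sqr n (c t : R) :
  bernstein n (fun j => (j%:R - c) ^+ 2) t = (n%:R * t - c) ^+ 2 + n%:R * t * (1 - t).
Proof.
elim: n c => [|n IH] c /=; first by ring.
rewrite IH (_ : (fun j : nat => _) = fun j : nat => (j%:R - (c - 1)) ^+ 2).
  by rewrite IH -natr1; ring.
by apply/funext => j; rewrite -natr1; ring.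
Qed.

(* Young's inequality |s| <= eta + s^2 / (4 eta) reduces the error to the
   variance of the binomial law. *)
Lemma bernstein_approx (q : R -> R) (L e : R) : 0 <= L -> 0 < e ->
  (forall s t, 0 <= s -> s <= t -> t <= 1 -> `|q t - q s| <= L * (t - s)) ->
  exists n, forall t, 0 <= t -> t <= 1 ->
    `|bernstein n.+1 (fun j => q (j%:R / n.+1%:R)) t - q t| <= e.
Proof.
move=> L0 e0 qL.
(* With N >= eta^-2 the variance part is at most L eta, and the constant part equals L eta; they add
   up to e L / (L + 1). Adding 1 to L covers L = 0. *)
pose eta := e / (2 * (L + 1)).
have L1 : 0 < L + 1 by lra.
have eta0 : 0 < eta by rewrite divr_gt0// mulr_gt0.
pose n := Num.truncn (eta ^- 2); exists n => t t0 t1.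
have qL' s : 0 <= s -> s <= 1 -> `|q s - q t| <= L * `|s - t|.
  move=> s0 s1; have [st|ts] := leP s t.
    have -> : `|s - t| = t - s by rewrite distrC ger0_norm ?subr_ge0.
    by rewrite distrC; exact: qL.
  have -> : `|s - t| = s - t by rewrite ger0_norm ?subr_ge0// ltW.
  by apply: qL => //; exact: ltW.
set N : R := n.+1%:R; have N0 : 0 < N by rewrite ltr0n.
pose g (j : nat) := L * (eta + (j%:R / N - t) ^+ 2 / (4 * eta)).
have gE : bernstein n.+1 g t <= e.
  have -> : g = fun j => (L / (4 * eta * N ^+ 2)) * ((j%:R - N * t) ^+ 2) + L * eta.
    by apply/funext => j; rewrite /g; field; rewrite !gt_eqF.
  rewrite (bernsteinZD n.+1 _ (fun j => (j%:R - N * t) ^+ 2) (fun _ => L * eta)).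
  rewrite bernstein_cst bernstein_sqr subrr expr0n add0r -/N.
  have tt : t * (1 - t) <= 1 by nra.
  have Ne : 1 <= N * eta ^+ 2.
    rewrite -ler_pdivrMr ?exprn_gt0// mul1r; apply: ltW; exact: truncnS_gt.
  have h1 : L / (4 * eta * N ^+ 2) * (N * t * (1 - t)) <= L * eta.
    rewrite (_ : _ * _ = (L * (t * (1 - t))) / (4 * eta * N)); last by field; rewrite !gt_eqF.
    have d0 : 0 < 4 * eta * N by apply: mulr_gt0 N0; apply: mulr_gt0 eta0; rewrite ltr0n.
    rewrite ler_pdivrMr// -[leRHS]mulrA ler_wpM2l//; apply: le_trans tt _.
    rewrite (_ : eta * _ = 4 * (N * eta ^+ 2)); last by ring.
    lra.
  apply: le_trans (lerD h1 (lexx _)) _.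
  rewrite -mulrDr (_ : eta + eta = e / (L + 1)); last by rewrite /eta; field; rewrite gt_eqF.
  by rewrite mulrCA ler_piMr ?(ltW e0)// ler_pdivrMr// mul1r lerDl.
have key j : (j <= n.+1)%N -> `|q (j%:R / N) - q t| <= g j.
  move=> jn; apply: le_trans (qL' _ _ _) _.
  - by rewrite divr_ge0// ltW.
  - by rewrite ler_pdivrMr// mul1r ler_nat.
  - rewrite /g ler_wpM2l//; set s := _ - t.
    rewrite -[s ^+ 2]real_normK ?num_real//; set a := `|s|.
    have : 0 <= (a - 2 * eta) ^+ 2 / (4 * eta) by rewrite divr_ge0 ?sqr_ge0// mulr_ge0// ltW.
    have -> : (a - 2 * eta) ^+ 2 / (4 * eta) = a ^+ 2 / (4 * eta) - a + eta by field; rewrite gt_eqF.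
    lra.
have E : bernstein n.+1 (fun j => q (j%:R / N)) t - q t =
    bernstein n.+1 (fun j => 1 * q (j%:R / N) + - q t) t.
  by rewrite bernsteinZD bernstein_cst mul1r.
rewrite E ler_norml; apply/andP; split.
  have -> : - e = - 1 * e + 0 by ring.
  apply: (@le_trans _ _ (- 1 * bernstein n.+1 g t + bernstein n.+1 (fun _ => 0) t)).
    by rewrite bernstein_cst lerD2r !mulN1r lerN2.
  rewrite -bernsteinZD; apply: bernstein_le => // j jn.
  by have := key j jn; rewrite ler_norml => /andP[+ _]; rewrite mulN1r addr0 mul1r.
apply: le_trans gE; apply: bernstein_le => // j jn.
by have := key j jn; rewrite ler_norml => /andP[_]; rewrite mul1r.
Qed.

End bernstein.

(** * Exponentials as characters, and their common kernel *)

Section exponentials.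
Context {R : realType} (w : weight R).
Implicit Types (f g : Linf0 w) (a b m n : Linf0_dual w).
Local Notation H := (halfline R).

Let expc (k : nat) (x : R) : R[i] := (expR (- x) ^+ k.+1)%:C.

Let expc_meas k : cmeasurable (expc k).
Proof.
apply: cmeasurable_real; apply: measurable_funX.
apply: measurable_funTS; apply: continuous_measurable_fun => x.
by apply: continuous_comp; [exact: continuousN|exact: continuous_expR].
Qed.

Let exp_le1 (x : R) : 0 <= x -> expR (- x) <= 1.
Proof. by move=> x0; rewrite -expR0 ler_expR oppr_le0. Qed.

Let expc_L0 k : expc k \in L0 w.
Proof.
have ex x : 0 <= x -> normc (expc k x) <= expR (- x).
  move=> x0; rewrite normc_real ger0_norm ?exprn_ge0 ?expR_ge0// exprS ler_piMr ?expR_ge0//.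
  by rewrite exprn_ile1 ?expR_ge0 ?exp_le1.
apply/L0P; split => //.
  exists 1; apply: aeHT => x x0; rewrite mul1r; apply: le_trans (ex _ x0) _.
  by apply: le_trans (exp_le1 x0) _; exact: weight_ge1.
move=> e e0; exists e^-1; first by rewrite invr_ge0 ltW.
apply: aeHT => x x0 ex0; apply: le_trans (ex _ x0) _.
apply: (@le_trans _ _ e); last by rewrite ler_peMr ?(ltW e0)// weight_ge1.
rewrite expRN -[leRHS]invrK lef_pV2 ?posrE ?expR_gt0 ?invr_gt0//.
by apply: le_trans (expR_ge1Dx x); apply: le_trans (ltW ex0) _; rewrite lerDr.
Qed.

(** Exponents start at 1, since the constant 1 is not in L_0^oo(w) when, for example, w = 1. *)
Definition expk (k : nat) : Linf0 w := cl w (fun x => (expR (- x) ^+ k.+1)%:C).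

Lemma expkE k : aeH (fun x => expk k x = (expR (- x) ^+ k.+1)%:C).
Proof. exact: (clE (expc_L0 k)). Qed.

(** An exponential e satisfies e (x + y) = e x e y, so e phi is the scalar multiple of e by the
    integral of e phi; the action of b inherits this. *)
Lemma dual_act_expk b k : dual_act b (expk k) = b (expk k) *: expk k.
Proof.
apply: dual_act_eq => c c0; have L := L1_ind w c.
set I := cintegral (fun x => expk k x * ind c x).
have -> : transl_conv (expk k) (ind c) = I *: expk k.
  apply: (transl_conv_eq L).
  apply: aeHS (aeHI (Linf0ZE I (expk k)) (expkE k)) => x x0 [-> ->].
  have ip := pairing_int (expk k) L.
  transitivity (cintegral (fun y => (expR (- x) ^+ k.+1)%:C * (expk k y * ind c y))).
    by rewrite (cintegralZ _ ip) mulrC.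
  have [mi _] := L; have me := Linf0_cmeas (expk k).
  apply: ae_eq_cintegral.
  - apply: cmeasurableM; last exact: cmeasurableM.
    by apply: cmeasurable_real; exact: measurable_cst.
  - by apply: cmeasurableM => //; exact: cmeasurable_shift.
  - apply: aeHS (aeHI (expkE k) (aeH_shift x0 (expkE k))) => y y0 [-> ->].
    by rewrite mulrA -rmorphM/= -exprMn -expRD opprD.
rewrite dualZ mulrC.
exact: (pairingZ _ _ L).
Qed.

Lemma arens_expk a b k : arens a b (expk k) = a (expk k) * b (expk k).
Proof. by rewrite arensE dual_act_expk dualZ mulrC. Qed.

Definition annihilates_exp b := forall k, b (expk k) = 0.

Lemma Linf0_sumE (I : Type) (r : seq I) (F : I -> Linf0 w) (G : I -> R -> R[i]) :
  (forall i, aeH (fun x => F i x = G i x)) ->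
  aeH (fun x => (\sum_(i <- r) F i : Linf0 w) x = \sum_(i <- r) G i x).
Proof.
move=> FG; elim: r => [|i r IH].
  by rewrite big_nil; apply: aeHS (Linf00E w) => x x0 ->; rewrite big_nil.
rewrite big_cons; apply: aeHS (aeHI (Linf0DE (F i) (\sum_(j <- r) F j)) (aeHI (FG i) IH)).
by move=> x x0 [-> [-> ->]]; rewrite big_cons.
Qed.

Lemma dual_sum b (I : Type) (r : seq I) (F : I -> Linf0 w) :
  b (\sum_(i <- r) F i) = \sum_(i <- r) b (F i).
Proof. by elim: r => [|i r IH]; rewrite ?big_nil ?dual0// !big_cons dualD IH. Qed.

Lemma exp_poly_element (p : {poly R}) : exists P : Linf0 w,
  (forall b, annihilates_exp b -> b P = 0) /\
  aeH (fun x => P x = (expR (- x) * p.[expR (- x)])%:C).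
Proof.
exists (\sum_(i < size p) (p`_i)%:C *: expk i); split.
  by move=> b hb; rewrite dual_sum big1// => i _; rewrite dualZ hb mulr0.
have h := @Linf0_sumE 'I_(size p) (index_enum 'I_(size p)) (fun i => (p`_i)%:C *: expk i)
  (fun i x => (p`_i * expR (- x) ^+ i.+1)%:C).
apply: aeHS (h _) => [x x0 ->|i].
  rewrite -rmorph_sum/=; congr (_%:C); rewrite horner_coef mulr_sumr.
  by apply: eq_bigr => i _; rewrite exprS; ring.
by apply: aeHS (aeHI (Linf0ZE (p`_i)%:C (expk i)) (expkE i)) => x x0 [-> ->]; rewrite -rmorphM.
Qed.

(** The substitution t = exp(-x) turns h into q on [0, 1], equal to 0 on [0, exp(-S)]. There the
    Bernstein polynomial has no constant term, and q is Lipschitz with constant C exp(S) because -ln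
    has slope at most exp(S) on [exp(-S), 1]. *)
Lemma exp_dense (h : R -> R) (S C e : R) : 0 <= S -> 0 <= C -> 0 < e ->
  (forall x x', 0 <= x -> x <= x' -> x' <= S -> `|h x' - h x| <= C * (x' - x)) ->
  (forall x, S <= x -> h x = 0) ->
  exists P : Linf0 w, (forall b, annihilates_exp b -> b P = 0) /\
    aeH (fun x => normc (P x - (h x)%:C) <= e).
Proof.
move=> S0 C0 e0 hC hS.
pose q (t : R) := if t <= expR (- S) then 0 else h (- ln t).
have q0 : q 0 = 0 by rewrite /q expR_ge0.
have eS := expR_gt0 (- S).
have qexp x : 0 <= x -> q (expR (- x)) = h x.
  move=> x0; rewrite /q ler_expR lerN2 expRK opprK.
  by case: ifPn => // /hS.
have qL s t : 0 <= s -> s <= t -> t <= 1 -> `|q t - q s| <= (C * expR S) * (t - s).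
  have main s' t' : expR (- S) <= s' -> s' <= t' -> t' <= 1 ->
      `|h (- ln t') - h (- ln s')| <= (C * expR S) * (t' - s').
    move=> Ss st t1; have s0 : 0 < s' := lt_le_trans eS Ss.
    have t0 : 0 < t' := lt_le_trans s0 st.
    rewrite distrC; apply: le_trans (hC _ _ _ _ _) _.
    - by rewrite oppr_ge0 ln_le0.
    - by rewrite lerN2 ler_ln.
    - by rewrite lerNl -[leLHS]expRK ler_ln ?posrE ?expR_gt0.
    - rewrite -mulrA ler_wpM2l// opprK addrC -ln_div ?posrE//.
      have -> : t' / s' = 1 + (t' - s') / s' by field; rewrite gt_eqF.
      apply: (@le_trans _ _ ((t' - s') / s')).
        have d0 : 0 <= (t' - s') / s' by rewrite divr_ge0 ?subr_ge0// ltW.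
        have h1 : 0 < 1 + (t' - s') / s' by rewrite ltr_wpDr.
        rewrite -ler_expR lnK ?posrE//; exact: expR_ge1Dx.
      rewrite mulrC ler_wpM2r ?subr_ge0//.
      by rewrite -[leRHS]invrK -expRN lef_pV2 ?posrE ?expR_gt0.
  move=> s0 st t1; have E0 : h (- ln (expR (- S))) = 0 by rewrite expRK opprK hS.
  rewrite /q; have [tS|St] := leP t (expR (- S)).
    rewrite (le_trans st tS) subrr normr0 !mulr_ge0 ?expR_ge0// subr_ge0//.
  have [sS|Ss] := leP s (expR (- S)).
    rewrite -E0; apply: le_trans (main _ _ (lexx _) (ltW St) t1) _.
    by rewrite ler_wpM2l ?mulr_ge0 ?expR_ge0// lerD2l lerN2.
  by apply: main => //; exact: ltW.
have [n hn] := bernstein_approx (mulr_ge0 C0 (expR_ge0 S)) e0 qL.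
have [p hp] := bernstein_poly n.+1 (fun j => q (j%:R / n.+1%:R)).
have [P [bP PE]] := exp_poly_element p; exists P; split => //.
apply: aeHS PE => x x0 ->.
rewrite -(rmorphB (real_complex R)) normc_real -(qexp _ x0).
have := hn (expR (- x)) (expR_ge0 _) (exp_le1 x0).
by rewrite hp mul0r q0 add0r.
Qed.

(** Only the test functions 1_[0,c] have to be checked. For g supported in [0, s], g 1_[0,c] is
    Lipschitz and vanishes far out, so it is a uniform limit of exponential polynomials, and w >= 1
    makes this a limit in norm. Truncation then reaches a general f. *)
Lemma annihilates_exp_dual_act b f : annihilates_exp b -> dual_act b f = 0.
Proof.
move=> hb; have [K K0 bK] := dual_bounded b.
have smallr (r A : R) : 0 <= A -> (forall e, 0 < e -> r <= A * e) -> r <= 0.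
  move=> A0 h; rewrite leNgt; apply/negP => r0.
  have A1 : 0 < A + 1 by lra.
  have := h _ (divr_gt0 r0 A1); rewrite mulrA ler_pdivlMr// => hh; nra.
have supp s g : 0 <= s -> supported s g -> dual_act b g = 0.
  move=> s0 sg; apply: dual_act_eq => c c0; have L := L1_ind w c.
  rewrite (pairing0 L).
  set T := transl_conv g (ind c); apply/esym.
  (* The margin 1 beyond s makes the convolution vanish at every point of the tail, the endpoint
     included. *)
  have [C C0 hC] := conv_ind_lipschitz g (s + 1) c0.
  have van x : s + 1 <= x -> tconv g (ind c) x = 0.
    move=> sx; have x0 : 0 <= x by apply: le_trans sx; rewrite addr_ge0.
    rewrite conv_indE//.
    have [m1 _] := L1_indI w (x + c) x0.
    rewrite (@ae_eq_cintegral _ _ (fun _ => 0)) //.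
    + by rewrite /cintegral/= !(Rintegral_cst (mu R) measurable_halfline) mul0r.
    + by apply: cmeasurableM => //; exact: Linf0_cmeas.
    + apply: aeHS sg => y y0 hy; have [xy|yx] := leP x y.
        by rewrite hy ?mul0r// (lt_le_trans _ xy)// (lt_le_trans _ sx)// ltrDl.
      rewrite /indI indicE memNset ?mulr0//= in_itv/= => /andP[xy _].
      by have := le_lt_trans xy yx; rewrite ltxx.
  have s10 : 0 <= s + 1 by rewrite addr_ge0.
  apply: eq0_normc; apply/eqP; rewrite eq_le normc_ge0 andbT.
  apply: (@smallr _ (K * 2)) => [|e e0]; first by rewrite mulr_ge0.
  have [|x sx|P1 [bP1 P1E]] := @exp_dense (fun x => complex.Re (tconv g (ind c) x)) (s + 1) C e s10 C0 e0.
  - move=> x x' x0 xx' x's; apply: le_trans (hC _ _ x0 xx' x's).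
    by apply: le_trans (normc_ge_absRe _); case: (tconv _ _ x') (tconv _ _ x) => ? ? [].
  - by rewrite van.
  have [|x sx|P2 [bP2 P2E]] := @exp_dense (fun x => complex.Im (tconv g (ind c) x)) (s + 1) C e s10 C0 e0.
  - move=> x x' x0 xx' x's; apply: le_trans (hC _ _ x0 xx' x's).
    by apply: le_trans (normc_ge_absIm _); case: (tconv _ _ x') (tconv _ _ x) => ? ? [].
  - by rewrite van.
  pose Q : Linf0 w := 'i%C *: P2 + P1.
  have bQ : b Q = 0 by rewrite /Q dual_linear bP1// bP2// mulr0 addr0.
  have -> : b T = b ((-1) *: Q + T) by rewrite dual_linear bQ mulr0 add0r.
  apply: le_trans (bK _) _; rewrite -mulrA ler_wpM2l//.
  apply: Linf0_norm_le.
  have h1 := aeHI (Linf0DE ((-1) *: Q) T) (aeHI (Linf0ZE (-1) Q) (transl_convE g L)).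
  have h2 := aeHI (Linf0DE ('i%C *: P2) P1) (Linf0ZE 'i%C P2).
  apply: aeHS (aeHI (aeHI h1 h2) (aeHI P1E P2E)) => x x0 [[[-> [-> ->]] [-> ->]] [e1 e2]].
  set z := tconv g (ind c) x in e1 e2 *.
  rewrite (_ : _ + _ = - ('i%C * (P2 x - (complex.Im z)%:C) + (P1 x - (complex.Re z)%:C))); last first.
    rewrite [z in LHS]complex_split (_ : (complex.Im z) *i = 'i%C * (complex.Im z)%:C); first by ring.
    by apply/eqP; rewrite eq_complex/=; apply/andP; split; apply/eqP; ring.
  rewrite normcN; apply: le_trans (le_normcD _ _) _; rewrite normcM.
  rewrite (_ : normc 'i%C = 1) ?mul1r; last by rewrite /= expr0n expr1n add0r sqrtr1.
  apply: le_trans (lerD e2 e1) _; rewrite (_ : e + e = 2 * e); last by ring.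
  by rewrite ler_peMr ?weight_ge1// mulr_ge0// ltW.
apply: Linf0_norm_eq0; apply: (@smallr _ (4 * K)) => [|e e0]; first by rewrite mulr_ge0.
have [s s0 hs] := trunc_approx f e0.
have E0 := supp s (trunc s f) s0 (@trunc_supported _ w s f).
have -> := dual_act_mod (esym (subrK (trunc s f) f)) E0.
apply: le_trans (dual_act_norm _ K0 bK) _.
by rewrite ler_wpM2l// mulr_ge0.
Qed.

Lemma arensr_unit : exists u : Linf0_dual w, forall m, arens m u = m.
Proof.
have [u hu] := ex_right_unit w; exists u => m; apply: eq_dual => f.
by rewrite arensE hu.
Qed.

(** With a right identity u and chi multiplicative into a commutative field, chi b = chi (b u) = chi
    (u b) = 0. The converse says that b acts as 0. *)
Lemma right_annihilatorP b : right_annihilator b <-> annihilates_exp b.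
Proof.
split=> [hb k|hb a]; last first.
  by apply: eq_dual => f; rewrite arensE annihilates_exp_dual_act// dual0.
have [u hu] := arensr_unit.
by rewrite -[b]hu arens_expk mulrC -arens_expk hb.
Qed.

End exponentials.

(** * Series and point masses *)

Section dual_series.
Context {R : realType} (w : weight R).
Implicit Types (f g : Linf0 w) (a b m n : Linf0_dual w).

Lemma dualDE m n f : (m + n : Linf0_dual w) f = m f + n f.
Proof. by []. Qed.

Lemma dual0E f : (0 : Linf0_dual w) f = 0.
Proof. by []. Qed.

Lemma dualZE c m f : (c *: m : Linf0_dual w) f = c * m f.
Proof. by []. Qed.

Lemma bounded_by0 m : bounded_by m 0 -> m = 0.
Proof.
move=> m0; apply: eq_dual => f; apply: eq0_normc; apply/eqP.
by rewrite eq_le normc_ge0 andbT; have := m0 f; rewrite mul0r.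
Qed.

Lemma bounded_byZ c m K : bounded_by m K -> bounded_by (c *: m) (normc c * K).
Proof. by move=> mK f; rewrite dualZE normcM -mulrA ler_wpM2l ?normc_ge0. Qed.

Lemma real_series_bound (v : nat -> R) (M : R) : (forall j, `|v j| <= M * 2^-1 ^+ j) ->
  exists2 l, series v j @[j --> \oo] --> l & `|l| <= 2 * M.
Proof.
move=> vM; have M0 : 0 <= M by have := vM 0%N; rewrite expr0 mulr1; exact: le_trans.
have h2 : `|2^-1 : R| < 1 by rewrite ger0_norm ?invr_ge0// invf_lt1// ltr1n.
have cg := @cvg_geometric_series R M 2^-1 h2.
have lim2 : M * (1 - 2^-1)^-1 = 2 * M by field.
have cN : cvgn [normed series v].
  apply: (@series_le_cvg _ (fun j => `|v j|) (geometric M 2^-1)) => //.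
  - by move=> j /=; rewrite mulr_ge0 ?exprn_ge0 ?invr_ge0.
  - by apply/cvg_ex; eexists; exact: cg.
have cv := normed_cvg cN; exists (limn (series v)) => //.
apply: le_trans (lim_series_norm cN) _.
rewrite -lim2 -(cvg_lim _ cg)//.
apply: lim_series_le => //.
by apply/cvg_ex; eexists; exact: cg.
Qed.

(** The sum is formed pointwise on L_0^oo(w). In 4 e, one 2 is the sum of the geometric series and
    the other comes from the two real parts. *)
Lemma dual_series (F : nat -> Linf0_dual w) (e : R) :
  (forall j, bounded_by (F j) (e * 2^-1 ^+ j)) ->
  exists2 S : Linf0_dual w, bounded_by S (4 * e) & forall f,
    series (fun j => complex.Re (F j f)) j @[j --> \oo] --> complex.Re (S f) /\
    series (fun j => complex.Im (F j f)) j @[j --> \oo] --> complex.Im (S f).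
Proof.
move=> FB.
have FB' f j : normc (F j f) <= e * Linf0_norm f * 2^-1 ^+ j by rewrite mulrAC; exact: FB.
have hR f := @real_series_bound (fun j => complex.Re (F j f)) (e * Linf0_norm f)
  (fun j => le_trans (normc_ge_absRe _) (FB' f j)).
have hI f := @real_series_bound (fun j => complex.Im (F j f)) (e * Linf0_norm f)
  (fun j => le_trans (normc_ge_absIm _) (FB' f j)).
pose lR f : R := s2val (cid2 (hR f)); pose lI f : R := s2val (cid2 (hI f)).
have cR f : series (fun j => complex.Re (F j f)) j @[j --> \oo] --> lR f := s2valP (cid2 (hR f)).
have cI f : series (fun j => complex.Im (F j f)) j @[j --> \oo] --> lI f := s2valP (cid2 (hI f)).
have bR f : `|lR f| <= 2 * (e * Linf0_norm f) := s2valP' (cid2 (hR f)).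
have bI f : `|lI f| <= 2 * (e * Linf0_norm f) := s2valP' (cid2 (hI f)).
have uniq (v : nat -> R) (l l' : R) : v j @[j --> \oo] --> l -> v j @[j --> \oo] --> l' -> l = l'.
  by move=> h1 h2; apply: (cvg_unique _ h1 h2); exact: norm_hausdorff.
have [||S hS] := @mk_dual R w (fun f => lR f +i* lI f) (4 * e).
- move=> [a b] f g.
  have eR : lR ((a +i* b) *: f + g) = a * lR f - b * lI f + lR g.
    apply: (uniq (series (fun j => complex.Re (F j ((a +i* b) *: f + g))))) => //.
    rewrite (_ : (fun j => _) = fun j => a * series (fun j => complex.Re (F j f)) j -
      b * series (fun j => complex.Im (F j f)) j + series (fun j => complex.Re (F j g)) j); last first.
      apply/funext => j; rewrite /series/= !mulr_sumr -sumrB -big_split/=; apply: eq_bigr => i _.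
      by rewrite dual_linear; case: (F i f) (F i g) => ? ? [].
    by apply: cvgD => //; apply: cvgB; (apply: cvgM; [exact: cvg_cst|]).
  have eI : lI ((a +i* b) *: f + g) = a * lI f + b * lR f + lI g.
    apply: (uniq (series (fun j => complex.Im (F j ((a +i* b) *: f + g))))) => //.
    rewrite (_ : (fun j => _) = fun j => a * series (fun j => complex.Im (F j f)) j +
      b * series (fun j => complex.Re (F j f)) j + series (fun j => complex.Im (F j g)) j); last first.
      apply/funext => j; rewrite /series/= !mulr_sumr -!big_split/=; apply: eq_bigr => i _.
      by rewrite dual_linear; case: (F i f) (F i g) => ? ? [].
    by apply: cvgD => //; apply: cvgD; (apply: cvgM; [exact: cvg_cst|]).
  by rewrite eR eI.
- move=> f; apply: le_trans (normc_le _) _; apply: le_trans (lerD (bR f) (bI f)) _.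
  by rewrite le_eqVlt; apply/orP; left; apply/eqP; ring.
exists S; first by move=> f; rewrite hS; apply: le_trans (normc_le _) _;
  apply: le_trans (lerD (bR f) (bI f)) _; rewrite le_eqVlt; apply/orP; left; apply/eqP; ring.
by move=> f; rewrite hS.
Qed.

(** The remaining series may be evaluated at a different vector: dropping the first of a series of
    translated terms leaves a series at a translate of f. *)
Lemma dual_series_recl (F F' : nat -> Linf0_dual w) (S S' : Linf0_dual w) f f' :
  (forall j, F j.+1 f = F' j f') ->
  (series (fun j => complex.Re (F j f)) j @[j --> \oo] --> complex.Re (S f) /\
   series (fun j => complex.Im (F j f)) j @[j --> \oo] --> complex.Im (S f)) ->
  (series (fun j => complex.Re (F' j f')) j @[j --> \oo] --> complex.Re (S' f') /\
   series (fun j => complex.Im (F' j f')) j @[j --> \oo] --> complex.Im (S' f')) ->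
  S f = F 0%N f + S' f'.
Proof.
move=> FF' [cR cI] [cR' cI'].
have uniq (v : nat -> R) (l l' : R) : v j @[j --> \oo] --> l -> v j @[j --> \oo] --> l' -> l = l'.
  by move=> h1 h2; apply: (cvg_unique _ h1 h2); exact: norm_hausdorff.
have eR : complex.Re (S f) = complex.Re (F 0%N f) + complex.Re (S' f').
  apply: (uniq (fun j => series (fun j => complex.Re (F j f)) j.+1)); first by rewrite cvg_shiftS.
  rewrite (_ : (fun j => _) = fun j => complex.Re (F 0%N f) + series (fun j => complex.Re (F' j f')) j).
    by apply: cvgD => //; exact: cvg_cst.
  apply/funext => j; rewrite /series/= big_nat_recl//; congr (_ + _).
  by apply: eq_bigr => i _; rewrite FF'.
have eI : complex.Im (S f) = complex.Im (F 0%N f) + complex.Im (S' f').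
  apply: (uniq (fun j => series (fun j => complex.Im (F j f)) j.+1)); first by rewrite cvg_shiftS.
  rewrite (_ : (fun j => _) = fun j => complex.Im (F 0%N f) + series (fun j => complex.Im (F' j f')) j).
    by apply: cvgD => //; exact: cvg_cst.
  apply/funext => j; rewrite /series/= big_nat_recl//; congr (_ + _).
  by apply: eq_bigr => i _; rewrite FF'.
by apply/eqP; rewrite eq_complex raddfD/= !raddfD/= eR eI !eqxx.
Qed.

Lemma shiftl_transl_conv t f phi : 0 <= t -> L1 w phi ->
  transl_conv (shiftl t f) phi = shiftl t (transl_conv f phi).
Proof.
move=> t0 Lp; apply: (transl_conv_eq Lp).
apply: aeHS (aeHI (shiftlE (transl_conv f phi) t0) (aeH_shift t0 (transl_convE f Lp))).
move=> x x0 [-> ->]; have [mp _] := Lp; apply: ae_eq_cintegral.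
- by apply: cmeasurableM => //; apply: cmeasurable_shift; [rewrite addr_ge0|exact: Linf0_cmeas].
- by apply: cmeasurableM => //; apply: cmeasurable_shift => //; exact: Linf0_cmeas.
- by apply: aeHS (aeH_shift x0 (shiftlE f t0)) => y y0 ->; rewrite addrA.
Qed.

(** Evaluation at t makes no sense on classes. Composing a right identity with the translation gives
    a functional that extends it from continuous f phi, and whose action is exactly translation by
    t. *)
Lemma ex_point_mass t : 0 <= t -> exists d : Linf0_dual w, forall f, dual_act d f = shiftl t f.
Proof.
move=> t0; have [u hu] := ex_right_unit w; have [K K0 uK] := dual_bounded u.
have [||d hd] := @mk_dual R w (fun f => u (shiftl t f)) (K * w t).
- by move=> a f g; rewrite (shiftlZD _ _ _ t0) dual_linear.
- move=> f; apply: le_trans (uK _) _; rewrite -mulrA ler_wpM2l//; exact: shiftl_norm.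
exists d => f; apply: dual_act_eq => c c0; have L := L1_ind w c.
rewrite hd -(shiftl_transl_conv _ t0 L) -(dual_actP u _ L).
by congr cintegral; apply/funext => x; rewrite hu.
Qed.

End dual_series.

(** * Derivations *)

Section derivation_continuity.
Context {R : realType} (w : weight R) (Delta : Linf0_dual w -> Linf0_dual w).
Implicit Types (f g : Linf0 w) (a b : Linf0_dual w).
(** Linearity is a hypothesis on a bare function, because the inverse of theta comes as a bare
    function. *)
Hypothesis DeltaL : forall c (m n : Linf0_dual w), Delta (c *: m + n) = c *: Delta m + Delta n.
Hypothesis DeltaM : forall (m n : Linf0_dual w), Delta (arens m n) = arens (Delta m) n + arens m (Delta n).

Lemma DeltaD (m n : Linf0_dual w) : Delta (m + n) = Delta m + Delta n.
Proof. by rewrite -[m]scale1r DeltaL !scale1r. Qed.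

Lemma Delta0 : Delta 0 = 0.
Proof. by apply: (addIr (Delta 0)); rewrite -DeltaD addr0 add0r. Qed.

Lemma DeltaZ c (m : Linf0_dual w) : Delta (c *: m) = c *: Delta m.
Proof. by have := DeltaL c m 0; rewrite !addr0 Delta0 addr0. Qed.

(* If each new term x_n is chosen after the tail constant L of the functional
   picked at the previous step, the sum of the x_n shifted by n s contradicts
   the boundedness of Delta x; s = 0 gives Banach-Steinhaus. *)
Lemma gliding_hump (s : R) (delta : nat -> Linf0_dual w) : 0 <= s ->
  (forall n f, dual_act (delta n) f = shiftl (n%:R * s) f) ->
  (forall n C e, 0 < e -> exists t : Linf0_dual w * Linf0 w,
    [/\ bounded_by t.1 e, Linf0_norm t.2 <= 1,
      C <= normc (Delta (arens t.1 (delta n)) t.2) &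
      exists2 L, 0 <= L & forall b K, 0 <= K -> bounded_by b K ->
        normc (Delta (arens b (delta n.+1)) t.2) <= L * K]) -> False.
Proof.
move=> s0 hdelta H.
have ns0 n : 0 <= n%:R * s by rewrite mulr_ge0.
(* A term bounded by e / W n remains bounded by e after translation by any i s with i <= n. *)
pose W n : R := \sum_(0 <= i < n.+1) w (i%:R * s).
have W_ge n i : (i <= n)%N -> w (i%:R * s) <= W n.
  move=> le_in; rewrite /W (bigD1_seq i) ?iota_uniq//= ?mem_index_iota//=.
  by rewrite lerDl sumr_ge0// => j _; exact: weight_ge0.
have W0 n : 0 < W n by apply: lt_le_trans (W_ge n 0%N (leq0n _)); exact: weight_gt0.
pose good n (p : Linf0_dual w) (e : R) (t : Linf0_dual w * Linf0 w * R) :=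
  [/\ bounded_by t.1.1 (e / W n), Linf0_norm t.1.2 <= 1,
     exists2 K, 0 <= K & bounded_by (Delta p) K /\
       n.+1%:R + K <= normc (Delta (arens t.1.1 (delta n)) t.1.2),
     0 <= t.2 & forall b K, 0 <= K -> bounded_by b K ->
        normc (Delta (arens b (delta n.+1)) t.1.2) <= t.2 * K].
(* Positivity of e is a premise inside the existential, so that the choice is total; (0, 0, 0) is a
   dummy. *)
have pick n p e : exists t, 0 < e -> good n p e t.
  have [e0|e0] := ltP 0 e; last by exists (0, 0, 0).
  have [K K0 pK] := dual_bounded (Delta p).
  have [[a g] /= [h1 h2 h3 [L L0 h4]]] := H n (n.+1%:R + K) _ (divr_gt0 e0 (W0 n)).
  by exists (a, g, L) => _; split => //; exists K.
pose pk n p e := sval (cid (pick n p e)).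
have pkP n p e : 0 < e -> good n p e (pk n p e) by exact: (svalP (cid (pick n p e))).
(* Halving makes the bounds summable. The other entry of the minimum forces L_n * 4 e_(n+1) <= 1,
   where 4 e_(n+1) is the bound that [dual_series] gives for the tail. *)
pose next n (st : Linf0_dual w * R) :=
  let t := pk n st.1 st.2 in
  (st.1 + arens t.1.1 (delta n), Num.min (st.2 / 2) (1 / (4 * (t.2 + 1)))).
pose st := fix st n := if n is n'.+1 then next n' (st n') else (0, 1).
pose p_ n := (st n).1; pose e_ n := (st n).2.
pose t_ n := pk n (p_ n) (e_ n).
pose x_ n := (t_ n).1.1; pose g_ n := (t_ n).1.2; pose L_ n := (t_ n).2.
have pS n : p_ n.+1 = p_ n + arens (x_ n) (delta n) by [].
have eS n : e_ n.+1 = Num.min (e_ n / 2) (1 / (4 * (L_ n + 1))) by [].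
have e0 n : 0 < e_ n.
  elim: n => [|n IH]; first exact: ltr01.
  have [_ _ _ L0 _] := pkP n (p_ n) _ IH.
  rewrite eS lt_min divr_gt0//= divr_gt0// mulr_gt0//.
  by rewrite ltr_wpDl.
have tP n := pkP n (p_ n) _ (e0 n).
have e_half n : e_ n.+1 <= e_ n / 2 by rewrite eS ge_min lexx.
have e_geom n j : e_ (n + j)%N <= e_ n * 2^-1 ^+ j.
  elim: j => [|j IH]; first by rewrite addn0 expr0 mulr1.
  rewrite addnS exprSr mulrA; apply: le_trans (e_half _) _.
  by rewrite ler_wpM2r ?invr_ge0.
have eL n : L_ n * (4 * e_ n.+1) <= 1.
  have [_ _ _ L0 _] := tP n; rewrite -/(L_ n) in L0.
  have L1 : 0 < 4 * (L_ n + 1) by rewrite mulr_gt0// ltr_wpDl.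
  have : e_ n.+1 <= 1 / (4 * (L_ n + 1)) by rewrite eS ge_min lexx orbT.
  rewrite ler_pdivlMr// => h; apply: le_trans h.
  have := e0 n.+1; nra.
(* The tail from n on, with its translations restarted at 0: its sum y_n satisfies y_0 = p_n + y_n
   delta_n, so the whole tail is a single multiple of one point mass. *)
pose F n j := arens (x_ (n + j)%N) (delta j).
have FE n j f : F n j f = x_ (n + j)%N (shiftl (j%:R * s) f) by rewrite /F arensE hdelta.
have FB n j : bounded_by (F n j) (e_ n * 2^-1 ^+ j).
  move=> f; rewrite FE; have [xB _ _ _ _] := tP (n + j)%N.
  apply: le_trans (xB _) _.
  apply: (@le_trans _ _ (e_ (n + j)%N / W (n + j)%N * (W (n + j)%N * Linf0_norm f))).
    rewrite ler_wpM2l//; first by rewrite divr_ge0// ltW.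
    apply: le_trans (shiftl_norm _ (ns0 j)) _.
    by rewrite ler_wpM2r ?Linf0_norm_ge0// W_ge// leq_addl.
  by rewrite mulrA divfK ?gt_eqF// ler_wpM2r ?Linf0_norm_ge0.
pose y_ n := s2val (cid2 (dual_series (FB n))).
have yB n : bounded_by (y_ n) (4 * e_ n) by exact: (s2valP (cid2 (dual_series (FB n)))).
have yC n f := s2valP' (cid2 (dual_series (FB n))) f.
have shE n f : shiftl (n%:R * s) (shiftl s f) = shiftl (n.+1%:R * s) f.
  by rewrite shiftl_add// -natr1 mulrDl mul1r.
have shE' n f : shiftl s (shiftl (n%:R * s) f) = shiftl (n.+1%:R * s) f.
  by rewrite shiftl_add// -natr1 mulrDl mul1r addrC.
have yS n f : y_ n f = x_ n f + y_ n.+1 (shiftl s f).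
  rewrite (@dual_series_recl _ _ (F n) (F n.+1) (y_ n) (y_ n.+1) f (shiftl s f) _ (yC n f) (yC n.+1 _)).
    by rewrite FE mul0r shiftl0 addn0.
  by move=> j; rewrite !FE shE addSnnS.
have xE n : y_ 0%N = p_ n + arens (y_ n) (delta n).
  elim: n => [|n IH].
    by apply: eq_dual => f; rewrite dualDE arensE hdelta mul0r shiftl0 -[p_ 0%N]/0 add0r.
  rewrite IH pS -addrA; congr (_ + _); apply: eq_dual => f.
  by rewrite dualDE !arensE !hdelta yS shE'.
have [K K0 xK] := dual_bounded (Delta (y_ 0%N)).
(* At g_n the new term is at least n + 1 + Kp, the partial sum contributes at most Kp and the tail
   at most 1; what remains is at least n > K. *)
pose n := (Num.truncn K).+1.
have [_ g1 [Kp Kp0 [pB big]] L0 tail] := tP n.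
have E : Delta (y_ 0%N) (g_ n) = (Delta (p_ n) (g_ n) + Delta (arens (y_ n.+1) (delta n.+1)) (g_ n))
    + Delta (arens (x_ n) (delta n)) (g_ n).
  by rewrite (xE n.+1) pS !DeltaD !dualDE addrAC.
have h1 : normc (Delta (y_ 0%N) (g_ n)) <= K.
  by apply: le_trans (xK _) _; rewrite ler_piMr.
have h2 : normc (Delta (p_ n) (g_ n)) <= Kp.
  by apply: le_trans (pB _) _; rewrite ler_piMr.
have h3 : normc (Delta (arens (y_ n.+1) (delta n.+1)) (g_ n)) <= 1.
  apply: le_trans (eL n); apply: tail; last exact: yB.
  by rewrite mulr_ge0// ltW.
have h4 := le_normcD (Delta (p_ n) (g_ n)) (Delta (arens (y_ n.+1) (delta n.+1)) (g_ n)).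
have h5 : normc (Delta (arens (x_ n) (delta n)) (g_ n)) -
    normc (Delta (p_ n) (g_ n) + Delta (arens (y_ n.+1) (delta n.+1)) (g_ n)) <=
    normc (Delta (y_ 0%N) (g_ n)).
  by rewrite E [X in _ <= normc X]addrC; exact: normcB.
have h6 : K < n%:R by exact: truncnS_gt.
rewrite -/(x_ n) -/(g_ n) -natr1 in big.
by lra.
Qed.

Lemma bounded_by_scale a (K e : R) : 0 < K -> 0 < e -> bounded_by a K ->
  bounded_by ((e / K)%:C *: a) e.
Proof.
move=> K0 e0 aK; have := bounded_byZ (e / K)%:C aK.
by rewrite normc_real ger0_norm ?divfK ?gt_eqF// divr_ge0// ltW.
Qed.

Lemma normc_Delta_scale a f (K e : R) : 0 < K -> 0 < e ->
  normc (Delta ((e / K)%:C *: a) f) = e / K * normc (Delta a f).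
Proof.
by move=> K0 e0; rewrite DeltaZ dualZE normcM normc_real ger0_norm// divr_ge0// ltW.
Qed.

Lemma ex_point_masses (s : R) : 0 <= s -> exists delta : nat -> Linf0_dual w,
  forall n f, dual_act (delta n) f = shiftl (n%:R * s) f.
Proof.
move=> s0; have h (n : nat) : exists d : Linf0_dual w, forall f, dual_act d f = shiftl (n%:R * s) f.
  by apply: ex_point_mass; rewrite mulr_ge0.
by have [delta hd] := choice h; exists delta.
Qed.

(** The test vector is f translated to the right by n s and normalised. The mass at n s brings it
    back to f, exposing Delta a at f; the mass at (n + 1) s kills it, leaving b (Delta delta_(n+1)),
    which is bounded in b. *)
Lemma Delta_bounded_at (s : R) f : 0 <= s -> supported s f ->
  exists2 C, 0 <= C & forall a K, 0 <= K -> bounded_by a K -> normc (Delta a f) <= C * K.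
Proof.
move=> s0 sf; apply: contrapT => nC.
have unb C : 0 <= C -> exists a K, [/\ 0 < K, bounded_by a K & C * K < normc (Delta a f)].
  move=> C0; apply: contrapT => h; apply: nC; exists C => // a K K0 aK.
  rewrite leNgt; apply/negP => lt; apply: h; exists a, K; split => //.
  rewrite lt_def K0 andbT; apply/eqP => K00; move: lt; rewrite K00 mulr0.
  have -> : a = 0 by apply: bounded_by0; rewrite -K00.
  by rewrite Delta0 dual0E normc0 ltxx.
have [delta hd] := ex_point_masses s0.
apply: (gliding_hump s0 hd) => n C e e0.
have ns0 : 0 <= n%:R * s by rewrite mulr_ge0.
set g0 := shiftr (n%:R * s) f.
pose c := Linf0_norm g0 + 1; have c0 : 0 < c by rewrite ltr_wpDl ?Linf0_norm_ge0.
pose g : Linf0 w := (c^-1)%:C *: g0.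
have gN : Linf0_norm g <= 1.
  apply: le_trans (Linf0_normZ _ _) _; rewrite normc_real ger0_norm ?invr_ge0 ?(ltW c0)//.
  by rewrite mulrC ler_pdivrMr// mul1r lerDl.
have act b : arens b (delta n) g = (c^-1)%:C * b f.
  by rewrite arensE hd (shiftlZ _ _ ns0) dualZ (shiftl_shiftr ns0 s0 sf).
have act1 b : arens b (delta n.+1) g = 0.
  rewrite arensE hd; have -> : n.+1%:R * s = s + n%:R * s by rewrite -natr1 mulrDl mul1r addrC.
  rewrite -(shiftl_add _ s0 ns0) (shiftlZ _ _ ns0) (shiftl_shiftr ns0 s0 sf).
  by rewrite (shiftlZ _ _ s0) (shiftl_supported s0 sf) scaler0 dual0.
have rest (b d : Linf0_dual w) K M : 0 <= K -> 0 <= M -> bounded_by b K -> bounded_by d M ->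
    normc (arens b d g) <= 4 * M * K.
  move=> K0 M0 bK dM; apply: le_trans (arens_bounded K0 M0 bK dM g) _.
  rewrite (_ : 4 * M * K = 4 * K * M); last by ring.
  by rewrite ler_piMr// !mulr_ge0.
have [M M0 dM] := dual_bounded (Delta (delta n)).
have [M1 M10 dM1] := dual_bounded (Delta (delta n.+1)).
(* The division by e offsets rescaling a to size e, c undoes the normalisation of g, and 4 M e
   absorbs the term a (Delta delta_n). *)
have [|a [K [K0 aK big]]] := unb (c * (`|C| + 4 * M * e) / e).
  by rewrite divr_ge0 ?(ltW e0)// mulr_ge0 ?(ltW c0)// addr_ge0// !mulr_ge0// ltW.
exists ((e / K)%:C *: a, g); split => //=.
- exact: bounded_by_scale.
- have aB := bounded_by_scale K0 e0 aK; set a' := _ *: a in aB *.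
  have h1 := rest _ _ _ _ (ltW e0) M0 aB dM.
  have h2 : `|C| + 4 * M * e <= normc (arens (Delta a') (delta n) g).
    have ci : 0 <= c^-1 by rewrite invr_ge0 ltW.
    rewrite act normcM normc_real (ger0_norm ci) [leRHS]mulrC ler_pdivlMr//.
    rewrite normc_Delta_scale//; apply: ltW.
    rewrite (_ : (`|C| + 4 * M * e) * c = e / K * (c * (`|C| + 4 * M * e) / e * K)); last by field; rewrite !gt_eqF.
    by rewrite ltr_pM2l// divr_gt0.
  rewrite DeltaM dualDE.
  have h3 := normcB (arens (Delta a') (delta n) g) (arens a' (Delta (delta n)) g).
  have h4 := ler_norm C; lra.
- exists (4 * M1) => [|b K' K'0 bK']; first by rewrite mulr_ge0.
  by rewrite DeltaM dualDE act1 add0r; exact: rest.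
Qed.

(** The same scheme with s = 0, where every mass acts as the identity, is uniform boundedness: the
    tail constants are now the pointwise bounds just obtained. As these concern bounded supports,
    the witness f is truncated first. *)
Lemma Delta_bounded : exists2 C, 0 <= C & forall a K, 0 <= K -> bounded_by a K ->
  bounded_by (Delta a) (C * K).
Proof.
apply: contrapT => nC.
have unb C : 0 <= C -> exists a K f, [/\ 0 < K, bounded_by a K, 0 < Linf0_norm f &
    C * K * Linf0_norm f < normc (Delta a f)].
  move=> C0; apply: contrapT => h; apply: nC; exists C => // a K K0 aK f.
  rewrite leNgt; apply/negP => lt; apply: h; exists a, K, f; split => //.
    rewrite lt_def K0 andbT; apply/eqP => K00; move: lt; rewrite K00 mulr0 mul0r.
    have -> : a = 0 by apply: bounded_by0; rewrite -K00.
    by rewrite Delta0 dual0E normc0 ltxx.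
  rewrite lt_def Linf0_norm_ge0 andbT; apply/eqP => f0; move: lt; rewrite f0 mulr0.
  by rewrite (@Linf0_norm_eq0 _ _ f) ?f0// dual0 normc0 ltxx.
have [delta hd] := ex_point_masses (lexx 0).
have dE n a : arens a (delta n) = a.
  by apply: eq_dual => f; rewrite arensE hd mulr0 shiftl0.
apply: (gliding_hump (lexx 0) hd) => n C e e0.
have [|a [K [f [K0 aK f0 big]]]] := unb (`|C| / e); first by rewrite divr_ge0// ltW.
have [M M0 aM] := dual_bounded (Delta a).
(* The strict excess d pays for the truncation: its error is at most M d / (M + 1), with M a bound
   for this one Delta a. *)
set d := normc (Delta a f) - `|C| / e * K * Linf0_norm f.
have d0 : 0 < d by rewrite subr_gt0.
have M1 : 0 < M + 1 by rewrite ltr_wpDl.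
have [s s0 hs] := trunc_approx f (divr_gt0 d0 M1).
pose g0 := trunc s f.
have big0 : `|C| / e * K * Linf0_norm f <= normc (Delta a g0).
  have E : Delta a f = Delta a (f - g0) + Delta a g0 by rewrite -dualD subrK.
  have h1 : normc (Delta a (f - g0)) <= d.
    apply: le_trans (aM _) _; apply: le_trans (ler_wpM2l M0 hs) _.
    by rewrite mulrCA ler_piMr ?(ltW d0)// ler_pdivrMr// mul1r lerDl.
  have h2 := le_normcD (Delta a (f - g0)) (Delta a g0).
  rewrite -E in h2; have := lerD h1 (lexx (normc (Delta a g0))) => h3.
  have := le_trans h2 h3; rewrite /d; lra.
pose g : Linf0 w := ((Linf0_norm f)^-1)%:C *: g0.
have gsupp : supported s g.
  apply: aeHS (aeHI (Linf0ZE ((Linf0_norm f)^-1)%:C g0) (trunc_supported s f)).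
  by move=> x x0 [-> h] sx; rewrite h ?mulr0.
have [L L0 hL] := Delta_bounded_at s0 gsupp.
exists ((e / K)%:C *: a, g); split => /=.
- exact: bounded_by_scale.
- apply: le_trans (Linf0_normZ _ _) _; rewrite normc_real ger0_norm ?invr_ge0 ?(ltW f0)//.
  by rewrite mulrC ler_pdivrMr// mul1r trunc_norm.
- rewrite dE normc_Delta_scale// dualZ normcM normc_real ger0_norm ?invr_ge0 ?(ltW f0)//.
  apply: le_trans (ler_norm C) _.
  have := ler_wpM2l (ltW (divr_gt0 (divr_gt0 e0 K0) f0)) big0.
  rewrite (_ : e / K / _ * _ = `|C|); last by field; rewrite !gt_eqF.
  by move=> h; apply: le_trans h _; rewrite mulrA.
- by exists L => // b K' K'0 bK'; rewrite dE; exact: hL.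
Qed.

(** * Vanishing of a character on the range of a bounded derivation *)

Section character.
Variable k : nat.
Let chi a : R[i] := a (expk w k).

Let chiM a b : chi (arens a b) = chi a * chi b.
Proof. exact: arens_expk. Qed.

Let chiD a b : chi (a + b) = chi a + chi b.
Proof. by []. Qed.

(** The analogue of a zero of order n at the point chi, with Delta as differentiation. *)
Let vanish n b := forall m, (m < n)%N -> chi (iter m Delta b) = 0.

Let iterD m a b : iter m Delta (a + b) = iter m Delta a + iter m Delta b.
Proof. by elim: m => //= m ->; exact: DeltaD. Qed.

Let chi_iterS m a b : chi (iter m.+1 Delta (arens a b)) =
  chi (iter m Delta (arens (Delta a) b)) + chi (iter m Delta (arens a (Delta b))).
Proof. by rewrite iterSr DeltaM iterD chiD. Qed.

Let vanish_Delta n b : vanish n.+1 b -> vanish n (Delta b).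
Proof. by move=> vb m mn; rewrite -iterSr; exact: vb. Qed.

(** In the Leibniz expansion of Delta^n (a b) only the term with every Delta on b survives under
    chi. Induction on n, one Leibniz step at a time, avoids binomial sums. *)
Let vanishM n a b : vanish n b -> vanish n (arens a b) /\
  chi (iter n Delta (arens a b)) = chi a * chi (iter n Delta b).
Proof.
elim: n a b => [|n IH] a b vb; first by split => //=; exact: chiM.
have vb' : vanish n b by move=> m mn; apply: vb; exact: ltnW.
have [v1 e1] := IH (Delta a) b vb'.
have [v2 e2] := IH a (Delta b) (vanish_Delta vb).
split=> [[|m] mn|].
- by rewrite /= chiM [chi b](vb 0%N) ?mulr0.
- by rewrite chi_iterS v1// v2// addr0.
- by rewrite chi_iterS e1 e2 (vb n) ?mulr0 ?add0r// iterSr.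
Qed.

(* The identity chi (Delta^n (a^n)) = n! chi (Delta a)^n, for a in the kernel
   of chi, one factor at a time. *)
Let vanishS n a b : chi a = 0 -> vanish n b -> vanish n.+1 (arens a b) /\
  chi (iter n.+1 Delta (arens a b)) = n.+1%:R * chi (Delta a) * chi (iter n Delta b).
Proof.
move=> a0 vb; split.
  have [v e] := vanishM a vb => m; rewrite ltnS leq_eqVlt => /orP[/eqP ->|]; last exact: v.
  by rewrite e a0 mul0r.
elim: n b vb => [|n IH] b vb.
  by rewrite /= DeltaM chiD !chiM a0 mul0r addr0 mul1r.
have [_ e1] := vanishM (Delta a) vb.
rewrite chi_iterS e1 (IH (Delta b) (vanish_Delta vb)) -iterSr.
by rewrite -[n.+2%:R]natr1 !mulrDl mul1r addrC.
Qed.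

Let chi_Delta_ker a : chi a = 0 -> chi (Delta a) = 0.
Proof.
move=> a0; apply/eqP/negPn/negP => z0.
set z := chi (Delta a) in z0.
(* The product a (a (... (Delta a))) with n factors a: ending in Delta a gives chi the nonzero value
   z at n = 0, and z^(n+1) n! after n derivations. *)
pose b n := iter n (arens a) (Delta a).
have vb n : vanish n (b n) /\ chi (iter n Delta (b n)) = n`!%:R * z ^+ n.+1.
  elim: n => [|n [v e]]; first by split => //=; rewrite fact0 mul1r expr1.
  have [v' e'] := vanishS a0 v; split => //; rewrite e' e factS natrM -/z [z ^+ n.+2]exprS -!mulrA.
  by congr (_ * _); exact: mulrCA.
have [C C0 hC] := Delta_bounded; have [A A0 aA] := dual_bounded a.
have [B B0 bB] := dual_bounded (Delta a).
have bn n : bounded_by (b n) ((4 * A) ^+ n * B).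
  elim: n => [|n IH] /=; first by rewrite expr0 mul1r.
  rewrite exprS -mulrA; apply: arens_bounded => //.
  by rewrite mulr_ge0// exprn_ge0// mulr_ge0.
have itn n m : bounded_by (iter m Delta (b n)) (C ^+ m * ((4 * A) ^+ n * B)).
  elim: m => [|m IH] /=; first by rewrite expr0 mul1r.
  rewrite exprS -mulrA; apply: hC => //.
  by rewrite !mulr_ge0 ?exprn_ge0// mulr_ge0.
pose r := normc z; have r0 : 0 < r by rewrite /r lt_def normc_eq0 normc_ge0 andbT.
pose E := B * Linf0_norm (expk w k).
have ineq n : n`!%:R * r ^+ n.+1 <= E * (C * (4 * A)) ^+ n.
  have [_ e] := vb n; have := itn n n (expk w k).
  rewrite -[iter n Delta (b n) _]/(chi _) e normcM normcX normc_natr.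
  move=> h; apply: le_trans h _; rewrite /E [(C * _) ^+ n]exprMn.
  by move: (C ^+ n) ((4 * A) ^+ n) => ? ?; rewrite le_eqVlt; apply/orP; left; apply/eqP; ring.
have E0 : 0 <= E by rewrite mulr_ge0 ?Linf0_norm_ge0.
(* Divided by n! r^n the inequality reads r <= E x^n / n!, and x^n / n! tends to 0 as a term of the
   exponential series; E + 1 covers E = 0. *)
pose x := C * (4 * A) / r.
have cx : exp_coeff x n @[n --> \oo] --> 0 by exact: (cvg_series_cvg_0 (is_cvg_series_exp_coeff x)).
have ex : 0 < r / (E + 1) by rewrite divr_gt0// ltr_wpDl.
move/cvgr0Pnorm_lt: cx => /(_ _ ex)[n _ /(_ n (leqnn n)) /=].
have x0 : 0 <= x by rewrite divr_ge0 ?(ltW r0)// !mulr_ge0.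
rewrite ger0_norm ?exp_coeff_ge0// /exp_coeff /= => h.
have nf0 : (0 : R) < n`!%:R by rewrite ltr0n fact_gt0.
move: h; rewrite ltr_pdivrMr// mulrAC ltr_pdivlMr ?ltr_wpDl// => h.
have := ineq n; rewrite (_ : C * (4 * A) = x * r); last by rewrite /x divfK// gt_eqF.
rewrite exprMn exprSr mulrA mulrA [n`!%:R * _ * _]mulrAC ler_pM2r ?exprn_gt0// => h'.
have xn0 : 0 <= x ^+ n by rewrite exprn_ge0.
rewrite [n`!%:R * r]mulrC in h'.
by have := lt_le_trans h h'; rewrite mulrDr mulr1 [x ^+ n * E]mulrC gtrDl ltNge xn0.
Qed.

Lemma derivation_expk a : Delta a (expk w k) = 0.
Proof.
rewrite -[LHS]/(chi (Delta a)).
have [a0|a0] := eqVneq (chi a) 0; first exact: chi_Delta_ker.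
have ka : chi (- chi a *: a + arens a a) = 0.
  by rewrite chiD chiM -[chi (_ *: a)]/(- chi a * chi a) mulNr addNr.
have := chi_Delta_ker ka; rewrite DeltaL DeltaM !chiD !chiM.
rewrite -[chi (_ *: Delta a)]/(- chi a * chi (Delta a)).
move=> /eqP; rewrite (_ : _ + _ = chi a * chi (Delta a)); last by ring.
by rewrite mulf_eq0 (negPf a0) => /eqP.
Qed.

End character.

Lemma derivation_range a : right_annihilator (Delta a).
Proof. by apply/right_annihilatorP => k; exact: derivation_expk. Qed.

End derivation_continuity.

(** * The inclusions for D, read off from the characters *)

Unset Implicit Arguments.

Theorem theorem2p1 (R : realType) (w : weight R)
    (theta D : {linear Linf0_dual w -> Linf0_dual w})
    (htheta : homomorphism theta) (hD : derivation theta D) :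
  (D @` right_annihilator (w := w) `<=` right_annihilator (w := w) /\
   D @` unit_right_identities (w := w) `<=` right_annihilator (w := w)) /\
  (bijective theta -> range D `<=` right_annihilator (w := w)).
Proof.
have [u hu] := arensr_unit w.
split; [split|].
- move=> _ [r hr <-]; apply/right_annihilatorP => k.
  have e1 : D (arens r u) (expk w k) =
      D r (expk w k) * theta u (expk w k) + theta r (expk w k) * D u (expk w k).
    by rewrite hD dualDE !arens_expk.
  have e2 : D (arens u r) (expk w k) =
      D u (expk w k) * theta r (expk w k) + theta u (expk w k) * D r (expk w k).
    by rewrite hD dualDE !arens_expk.
  rewrite hu in e1; rewrite (hr u) linear0 dual0E in e2.
  apply: (etrans e1); apply: etrans (esym e2).
  by rewrite addrC; congr (_ + _); exact: mulrC.
- move=> _ [v [hv _] <-]; apply/right_annihilatorP => k.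
  have e1 : D (arens v v) (expk w k) =
      D v (expk w k) * theta v (expk w k) + theta v (expk w k) * D v (expk w k).
    by rewrite hD dualDE !arens_expk.
  have e2 : theta (arens v v) (expk w k) = theta v (expk w k) * theta v (expk w k).
    by rewrite htheta arens_expk.
  rewrite !hv in e1 e2.
  set d := D v (expk w k) in e1 *; set t := theta v (expk w k) in e1 e2.
  (* Multiplying d = d t + t d by t and using t t = t gives t d = 2 t d. *)
  have td : t * d = 0.
    have : t * d = t * (d * t + t * d) by rewrite -e1.
    rewrite mulrDr mulrCA (mulrA t t) -e2 mulrC => /eqP.
    by rewrite -subr_eq0 opprD addrA subrr sub0r oppr_eq0 => /eqP; rewrite mulrC.
  by rewrite e1 mulrC td addr0.
- move=> [g gK Kg] _ [a _ <-].
  have gL c m n : g (c *: m + n) = c *: g m + g n.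
    by apply: (can_inj gK); rewrite Kg linearP !Kg.
  have gM m n : g (arens m n) = arens (g m) (g n).
    by apply: (can_inj gK); rewrite Kg htheta !Kg.
  (* The derivation D o g is evaluated at theta a, where it takes the value D a. *)
  have := @derivation_range R w (fun m => D (g m)) _ _ (theta a); rewrite gK; apply.
    by move=> c m n; rewrite gL linearP.
  by move=> m n; rewrite gM hD !Kg.
Qed.
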